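(* Let $(M,g)$ be a pseudo-Riemannian manifold with Levi-Civita connection $\nabla$, let $c$ be a symmetric $(0,2)$-tensor field on $M$, and let $T^2M$ be the second-order tangent bundle of $M$ equipped with the deformed 2-nd lift metric $\overline g={}^{II}g+{}^0c$. Let $H$ be a $(1,2)$-tensor field on $M$ and let $\overline\nabla$ be the linear connection on $T^2M$ given by $\overline\nabla_{\overline X}\overline Y={}^{II}\nabla_{\overline X}\overline Y+{}^0H(\overline X,\overline Y)$ for all vector fields $\overline X,\overline Y$ on $T^2M$. If $$g(H(X,Y),Z)=\tfrac12\left[(\nabla_Xc)(Y,Z)+(\nabla_Yc)(X,Z)-(\nabla_Zc)(X,Y)\right]$$ for all vector fields $X,Y,Z$ on $M$, then $\overline\nabla$ is the Levi-Civita connection of $\overline g$.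
   Context: All objects are of class $C^\infty$; repeated indices are summed. The second-order tangent bundle $T^2M$ of an $n$-dimensional manifold $M$ is the $3n$-dimensional manifold of all 2-jets at $0$ of maps $\mathbb R\to M$. A chart $(U,x^i)$ of $M$ induces coordinates $(x^i,y^i,z^i)$ on the preimage of $U$ in $T^2M$: for the 2-jet of a curve $F$, locally $x^i=F^i(t)$, one puts $x^i=F^i(0)$, $y^i=\frac{dF^i}{dt}(0)$, $z^i=\frac12\frac{d^2F^i}{dt^2}(0)$. The deformed 2-nd lift metric is the pseudo-Riemannian metric on $T^2M$ whose matrix in induced coordinates, ordered as $(x,y,z)$, is $$\overline g={}^{II}g+{}^0c=\begin{pmatrix} z^s\partial_s g_{ij}+\frac12 y^ty^s\partial_t\partial_s g_{ij}+c_{ij} & y^s\partial_s g_{ij} & g_{ij}\\ y^s\partial_s g_{ij}& g_{ij}&0\\ g_{ij}&0&0\end{pmatrix},\qquad \partial_i=\frac{\partial}{\partial x^i}.$$ Lifts of a vector field $X=X^i\partial_i$ on $M$ to $T^2M$: ${}^0X=X^j\frac{\partial}{\partial z^j}$; ${}^IX=X^j\frac{\partial}{\partial y^j}+y^s\partial_sX^j\frac{\partial}{\partial z^j}$; ${}^{II}X=X^j\frac{\partial}{\partial x^j}+y^s\partial_sX^j\frac{\partial}{\partial y^j}+\{z^s\partial_sX^j+\frac12y^ty^s\partial_t\partial_sX^j\}\frac{\partial}{\partial z^j}$. The 2-nd lift ${}^{II}\nabla$ of $\nabla$ is the linear connection on $T^2M$ determined by: ${}^{II}\nabla_{{}^0X}{}^0Y=0$,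 ${}^{II}\nabla_{{}^0X}{}^IY=0$, ${}^{II}\nabla_{{}^0X}{}^{II}Y={}^0(\nabla_XY)$; ${}^{II}\nabla_{{}^IX}{}^0Y=0$, ${}^{II}\nabla_{{}^IX}{}^IY={}^0(\nabla_XY)$, ${}^{II}\nabla_{{}^IX}{}^{II}Y={}^I(\nabla_XY)$; ${}^{II}\nabla_{{}^{II}X}{}^0Y={}^0(\nabla_XY)$, ${}^{II}\nabla_{{}^{II}X}{}^IY={}^I(\nabla_XY)$, ${}^{II}\nabla_{{}^{II}X}{}^{II}Y={}^{II}(\nabla_XY)$, for all vector fields $X,Y$ on $M$. The 0-th lift ${}^0H$ of the $(1,2)$-tensor field $H$ is the $(1,2)$-tensor field on $T^2M$ determined by ${}^0H({}^{II}X,{}^{II}Y)={}^0(H(X,Y))$ and ${}^0H(\overline X,\overline Y)=0$ whenever at least one of $\overline X,\overline Y$ is a 0-th or 1-st lift (and the other any of the three lifts). *)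

(* Defs.v *)
From HB Require Import structures.
From mathcomp Require Import all_boot all_order all_algebra.
From mathcomp Require Import all_classical all_reals all_analysis.

Set Implicit Arguments.
Unset Strict Implicit.
Unset Printing Implicit Defensive.

Import Order.TTheory GRing.Theory Num.Theory.
Import numFieldNormedType.Exports.

Local Open Scope classical_set_scope.
Local Open Scope ring_scope.

(** Manifolds are given by an atlas, and geometric objects by their components
    in the charts, subject to the usual transformation laws.  Tangent vectors
    are row vectors and the Jacobian ['J f x] of the library acts on them on
    the right: [v *m 'J f x] is the differential of [f] at [x] applied to
    [v]. *)

(** ** Smoothness in R^m *)

Definition pd (R : realType) (m : nat) (W : normedModType R) (s : 'I_m)
    (f : 'rV[R]_m -> W) : 'rV[R]_m -> W :=
  fun x => 'D_(delta_mx 0 s) f x.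

(** [f] is of class C^oo on the open set [U]: all its iterated partial
    derivatives are differentiable on [U]. *)
Definition smooth_on (R : realType) (m : nat) (W : normedModType R)
    (U : set 'rV[R]_m) (f : 'rV[R]_m -> W) : Prop :=
  forall (s : seq 'I_m) x, U x -> differentiable (foldr (@pd R m W) f s) x.

(** ** Manifolds *)

Record atlas (R : realType) (m : nat) := Atlas {
  pt :> Type;
  chart : Type;
  dom : chart -> set pt;
  coord : chart -> pt -> 'rV[R]_m }.

Section Manifold.
Variables (R : realType) (m : nat) (A : atlas R m).

Definition chart_image (a : chart A) : set 'rV[R]_m := coord a @` dom a.

(** The coordinate expression of [f] in the chart [a], i.e. [f] composed with
    the inverse of [coord a]; only meaningful on [chart_image a]. *)
Definition local_expr (a : chart A) (W : pointedType) (f : A -> W) :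
    'rV[R]_m -> W :=
  fun x => get [set f p | p in [set p | dom a p /\ coord a p = x]].

Definition transition (a b : chart A) : 'rV[R]_m -> 'rV[R]_m :=
  local_expr a (coord b).

(** The open sets of the manifold topology induced by the atlas. *)
Definition mopen (W : set A) : Prop :=
  forall a : chart A, open (coord a @` (dom a `&` W)).

Record is_manifold : Prop := IsManifold {
  charts_cover : forall p : A, exists a : chart A, dom a p;
  chart_inj : forall a : chart A, set_inj (dom a) (coord a);
  overlap_open : forall a b : chart A, open (coord a @` (dom a `&` dom b));
  transition_smooth : forall a b : chart A,
    smooth_on (coord a @` (dom a `&` dom b)) (transition a b);
  manifold_hausdorff : forall p q : A, p <> q ->
    exists U V : set A, [/\ mopen U, mopen V, U p, V q & U `&` V = set0];
  manifold_second_countable : exists B : nat -> set A,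
    (forall i, mopen (B i)) /\
    (forall W, mopen W -> forall p, W p -> exists i, B i p /\ B i `<=` W) }.

Definition smooth_fun (f : A -> R) : Prop :=
  forall a : chart A, smooth_on (chart_image a) (local_expr a f).

Definition smooth_curve (F : R -> A) : Prop :=
  forall a : chart A, open (F @^-1` dom a) /\
    forall (k : nat) (t : R), dom a (F t) ->
      derivable (derive1n k (coord a \o F)) t 1.

(** ** Vector fields *)

(** Components are functions of the chart coordinates: [X a x] is the row of components at the point with coordinates [x] in the
    chart [a]. *)
Definition vfield := chart A -> 'rV[R]_m -> 'rV[R]_m.

Definition field_eq (X Y : vfield) : Prop :=
  forall a x, chart_image a x -> X a x = Y a x.

Definition is_vector_field (X : vfield) : Prop :=
  (forall a, smooth_on (chart_image a) (X a)) /\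
  (forall a b p, dom a p -> dom b p ->
     X b (coord b p) =
     X a (coord a p) *m 'J (transition a b) (coord a p)).

Definition vf_add (X Y : vfield) : vfield := fun a x => X a x + Y a x.

Definition vf_sub (X Y : vfield) : vfield := fun a x => X a x - Y a x.

Definition vf_zero : vfield := fun a x => 0.

Definition vf_scale (f : A -> R) (X : vfield) : vfield :=
  fun a x => local_expr a f x *: X a x.

Definition lie_bracket (X Y : vfield) : vfield :=
  fun a x => 'D_(X a x) (Y a) x - 'D_(Y a x) (X a) x.

(** ** Tensor fields *)

Definition bil (B : 'M[R]_m) (u v : 'rV[R]_m) : R := (u *m B *m v^T) 0 0.

(** [c a x] is the matrix of components [c_ij]. *)
Definition field02 := chart A -> 'rV[R]_m -> 'M[R]_m.

Definition app02 (c : field02) (X Y : vfield) :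
    chart A -> 'rV[R]_m -> R :=
  fun a x => bil (c a x) (X a x) (Y a x).

Definition is_tensor02 (c : field02) : Prop :=
  (forall a, smooth_on (chart_image a) (c a)) /\
  (forall a b p, dom a p -> dom b p ->
     let J := 'J (transition a b) (coord a p) in
     c a (coord a p) = J *m c b (coord b p) *m J^T).

Definition symmetric02 (c : field02) : Prop :=
  forall a x, chart_image a x -> (c a x)^T = c a x.

Definition is_pseudo_riemannian (g : field02) : Prop :=
  [/\ is_tensor02 g, symmetric02 g &
      forall a x, chart_image a x -> g a x \in unitmx].

(** [H a x k] is the matrix [(H^k_ij)_ij], with [k] the contravariant index. *)
Definition field12 := chart A -> 'rV[R]_m -> 'I_m -> 'M[R]_m.

Definition eval12 (h : 'I_m -> 'M[R]_m) (u v : 'rV[R]_m) : 'rV[R]_m :=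
  \row_k bil (h k) u v.

Definition app12 (H : field12) (X Y : vfield) : vfield :=
  fun a x => eval12 (H a x) (X a x) (Y a x).

Definition is_tensor12 (H : field12) : Prop :=
  (forall a k, smooth_on (chart_image a) (fun x => H a x k)) /\
  (forall a b p, dom a p -> dom b p ->
     let J := 'J (transition a b) (coord a p) in
     forall u v, eval12 (H b (coord b p)) (u *m J) (v *m J) =
                 eval12 (H a (coord a p)) u v *m J).

(** ** Linear connections *)

(** As [vfield] carries junk values outside the charts, a connection is an
    operator on vector fields up to [field_eq]. *)
Record is_connection (nabla : vfield -> vfield -> vfield) : Prop := IsConnection {
  connection_field : forall X Y, is_vector_field X -> is_vector_field Y ->
    is_vector_field (nabla X Y);
  connection_eq : forall X X' Y Y',
    is_vector_field X -> is_vector_field X' ->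
    is_vector_field Y -> is_vector_field Y' ->
    field_eq X X' -> field_eq Y Y' -> field_eq (nabla X Y) (nabla X' Y');
  connection_addl : forall X X' Y,
    is_vector_field X -> is_vector_field X' -> is_vector_field Y ->
    field_eq (nabla (vf_add X X') Y) (vf_add (nabla X Y) (nabla X' Y));
  connection_scalel : forall f X Y,
    smooth_fun f -> is_vector_field X -> is_vector_field Y ->
    field_eq (nabla (vf_scale f X) Y) (vf_scale f (nabla X Y));
  connection_addr : forall X Y Y',
    is_vector_field X -> is_vector_field Y -> is_vector_field Y' ->
    field_eq (nabla X (vf_add Y Y')) (vf_add (nabla X Y) (nabla X Y'));
  connection_leibniz : forall f X Y,
    smooth_fun f -> is_vector_field X -> is_vector_field Y ->
    field_eq (nabla X (vf_scale f Y))
      (vf_add (fun a x => 'D_(X a x) (local_expr a f) x *: Y a x)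
            (vf_scale f (nabla X Y))) }.

(** [(nabla_X c)(Y, Z) = X(c(Y, Z)) - c(nabla_X Y, Z) - c(Y, nabla_X Z)]. *)
Definition cov02 (nabla : vfield -> vfield -> vfield) (c : field02)
    (X Y Z : vfield) : chart A -> 'rV[R]_m -> R :=
  fun a x => 'D_(X a x) (app02 c Y Z a) x
             - app02 c (nabla X Y) Z a x - app02 c Y (nabla X Z) a x.

Definition torsion_free (nabla : vfield -> vfield -> vfield) : Prop :=
  forall X Y, is_vector_field X -> is_vector_field Y ->
    field_eq (vf_sub (nabla X Y) (nabla Y X)) (lie_bracket X Y).

Definition metric_connection (g : field02)
    (nabla : vfield -> vfield -> vfield) : Prop :=
  forall X Y Z, is_vector_field X -> is_vector_field Y -> is_vector_field Z ->
    forall a x, chart_image a x -> cov02 nabla g X Y Z a x = 0.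

Definition is_levi_civita (g : field02)
    (nabla : vfield -> vfield -> vfield) : Prop :=
  [/\ is_connection nabla, torsion_free nabla & metric_connection g nabla].

End Manifold.

Arguments vf_zero {R m} A.

(** ** The second-order tangent bundle *)

Section SecondOrder.
Variables (R : realType) (n : nat) (M : atlas R n).

Definition same_2jet (F G : R -> M) : Prop :=
  F 0 = G 0 /\
  forall a : chart M, dom a (F 0) ->
    derive1n 1 (coord a \o F) 0 = derive1n 1 (coord a \o G) 0 /\
    derive1n 2 (coord a \o F) 0 = derive1n 2 (coord a \o G) 0.

Definition jet2 (F : R -> M) : set (R -> M) :=
  [set G | smooth_curve G /\ same_2jet F G].

Definition T2_pt : Type :=
  {j : set (R -> M) | exists F, smooth_curve F /\ j = jet2 F}.

(** The row [(x, y, z)]. *)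
Definition xyz (x y z : 'rV[R]_n) : 'rV[R]_(n + n + n) :=
  row_mx (row_mx x y) z.

Definition xpart (w : 'rV[R]_(n + n + n)) : 'rV[R]_n := lsubmx (lsubmx w).

Definition ypart (w : 'rV[R]_(n + n + n)) : 'rV[R]_n := rsubmx (lsubmx w).

Definition zpart (w : 'rV[R]_(n + n + n)) : 'rV[R]_n := rsubmx w.

Definition T2_dom (a : chart M) : set T2_pt :=
  [set j | exists2 F, sval j F & dom a (F 0)].

Definition T2_coord (a : chart M) (j : T2_pt) : 'rV[R]_(n + n + n) :=
  get [set xyz (coord a (F 0)) (derive1n 1 (coord a \o F) 0)
               (2^-1 *: derive1n 2 (coord a \o F) 0) | F in sval j].

Definition T2 : atlas R (n + n + n) :=
  {| pt := T2_pt; chart := chart M; dom := T2_dom; coord := T2_coord |}.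

(** ** Lifts *)

(** [y^s d_s f] and [z^s d_s f + 1/2 y^t y^s d_t d_s f] at [w = (x, y, z)]. *)
Definition lift1 (W : normedModType R) (f : 'rV[R]_n -> W)
    (w : 'rV[R]_(n + n + n)) : W :=
  \sum_s ypart w 0 s *: pd s f (xpart w).

Definition lift2 (W : normedModType R) (f : 'rV[R]_n -> W)
    (w : 'rV[R]_(n + n + n)) : W :=
  \sum_s zpart w 0 s *: pd s f (xpart w) +
  2^-1 *: \sum_t \sum_s (ypart w 0 t * ypart w 0 s) *:
            pd t (pd s f) (xpart w).

Definition vlift0 (X : vfield M) : vfield T2 :=
  fun (a : chart M) w => xyz 0 0 (X a (xpart w)).

Definition vlift1 (X : vfield M) : vfield T2 :=
  fun (a : chart M) w => xyz 0 (X a (xpart w)) (lift1 (X a) w).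

Definition vlift2 (X : vfield M) : vfield T2 :=
  fun (a : chart M) w => xyz (X a (xpart w)) (lift1 (X a) w) (lift2 (X a) w).

Definition deformed_metric (g c : field02 M) : field02 T2 :=
  fun (a : chart M) w =>
    let x := xpart w in
    block_mx
      (block_mx (lift2 (g a) w + c a x) (lift1 (g a) w)
                (lift1 (g a) w)         (g a x))
      (col_mx (g a x)
              0)
      (row_mx (g a x) 0) 0.

Record is_second_lift (nabla : vfield M -> vfield M -> vfield M)
    (nabla2 : vfield T2 -> vfield T2 -> vfield T2) : Prop := IsSecondLift {
  second_lift_connection : is_connection nabla2;
  second_lift00 : forall X Y, is_vector_field X -> is_vector_field Y ->
    field_eq (nabla2 (vlift0 X) (vlift0 Y)) (vf_zero T2);
  second_lift01 : forall X Y, is_vector_field X -> is_vector_field Y ->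
    field_eq (nabla2 (vlift0 X) (vlift1 Y)) (vf_zero T2);
  second_lift02 : forall X Y, is_vector_field X -> is_vector_field Y ->
    field_eq (nabla2 (vlift0 X) (vlift2 Y)) (vlift0 (nabla X Y));
  second_lift10 : forall X Y, is_vector_field X -> is_vector_field Y ->
    field_eq (nabla2 (vlift1 X) (vlift0 Y)) (vf_zero T2);
  second_lift11 : forall X Y, is_vector_field X -> is_vector_field Y ->
    field_eq (nabla2 (vlift1 X) (vlift1 Y)) (vlift0 (nabla X Y));
  second_lift12 : forall X Y, is_vector_field X -> is_vector_field Y ->
    field_eq (nabla2 (vlift1 X) (vlift2 Y)) (vlift1 (nabla X Y));
  second_lift20 : forall X Y, is_vector_field X -> is_vector_field Y ->
    field_eq (nabla2 (vlift2 X) (vlift0 Y)) (vlift0 (nabla X Y));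
  second_lift21 : forall X Y, is_vector_field X -> is_vector_field Y ->
    field_eq (nabla2 (vlift2 X) (vlift1 Y)) (vlift1 (nabla X Y));
  second_lift22 : forall X Y, is_vector_field X -> is_vector_field Y ->
    field_eq (nabla2 (vlift2 X) (vlift2 Y)) (vlift2 (nabla X Y)) }.

(** Every [k >= 2] denotes the 2-nd lift. *)
Definition vlift (k : nat) : vfield M -> vfield T2 :=
  match k with 0 => vlift0 | 1 => vlift1 | _ => vlift2 end.

Definition is_zeroth_lift12 (H : field12 M) (H0 : field12 T2) : Prop :=
  [/\ is_tensor12 H0,
      forall X Y, is_vector_field X -> is_vector_field Y ->
        field_eq (app12 H0 (vlift2 X) (vlift2 Y)) (vlift0 (app12 H X Y)) &
      forall (i j : nat) X Y, (i < 2)%N || (j < 2)%N ->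
        is_vector_field X -> is_vector_field Y ->
        field_eq (app12 H0 (vlift i X) (vlift j Y)) (vf_zero T2)].

End SecondOrder.

(* Main.v *)
Require Import Defs.
From HB Require Import structures.
From mathcomp Require Import all_boot all_order all_algebra finmap.
From mathcomp Require Import all_classical all_reals all_analysis.
From mathcomp Require Import ring lra.
Import Order.TTheory GRing.Theory Num.Theory.
Import numFieldNormedType.Exports.
Local Open Scope classical_set_scope.
Local Open Scope ring_scope.
Set Implicit Arguments.
Unset Strict Implicit.
Unset Printing Implicit Defensive.
Require Import Defs.

(** The Levi-Civita conditions at a point of [T2 M] are relations between the
    Christoffel symbols of the connection and the components of the metric in
    the coordinates (x, y, z), and these coordinates are adapted to the lifts:
    the three lifts of the coordinate fields of [M] are the coordinate fields
    of [T2 M] ([graded_lift_delta]).  The Christoffel symbols are thus read off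
    the equations that define the second lift and the 0-th lift of [H].

    All objects are jets.  A point w = (x, y, z) is the 2-jet of the curve
    x + t y + t^2 z, and the 0-th, first and second lifts of a function are the
    coefficients of t^0, t^1, t^2 of its values along this curve.  Indexing
    lifts by the codegree d (0 for second, 1 for first, 2 for 0-th lifts, and
    zero for d > 2), three rules hold for all d and e:
    - the lift of codegree d of X maps the coefficient of index m of f to the
      coefficient of index m + d of X f ([derive_graded_lift]);
    - the second lift of nabla maps the lifts of codegrees d and e of X and Y
      to the lift of codegree d + e of nabla_X Y ([second_lift_glift]);
    - the deformed metric pairs them to the coefficient of index d + e of
      g(X, Y), plus c(X, Y) if d + e = 0 ([graded_lift_metric]).
    Hence the identity d_i g_jk = g(nabla_i e_j, e_k) + g(e_j, nabla_i e_k) on [M]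
    lifts to each coefficient, and the torsion vanishes as it does on [M].
    What remains of metric compatibility is concentrated at codegree 0, where
    it says that the covariant derivative of c is
      (nabla_i c)(e_j, e_k) = g(H(e_i, e_j), e_k) + g(H(e_i, e_k), e_j),
    a consequence of the formula for H and of the symmetry of c
    ([frame_deformation]).  The same formula and the nondegeneracy of g make H
    symmetric, so that it does not contribute to the torsion.

    Two things have to be built first.  Connections act on global fields, so
    their Christoffel symbols exist by locality, which needs cutoff functions
    on [M] ([cutoff_exists]); as charts of [T2 M] contain whole fibres, the pullbacks
    of these functions suffice on [T2 M] ([local_frame]).  And lifts of vector
    fields must be vector fields on [T2 M] ([glift_field]), for which one has to
    know the charts of [T2 M]: every (x, y, z) over a chart is the jet of a curve
    ([curve_exists]), and transition maps of [T2 M] are prolongations of those of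
    [M], by the second-order chain rule. *)

(** * Differential calculus in several variables *)

Lemma near_eq_differentiable (R : realType) (V W : normedModType R)
    (f g : V -> W) (x : V) :
  (\near x, f x = g x) -> differentiable f x -> differentiable g x.
Proof.
move=> fg df; have /diff_locallyP [dfc dfx] := df.
have key : g \o shift x = cst (g x) + 'd f x +o_ 0 id.
  apply/eqaddoP => eps e0.
  move/eqaddoP: dfx => /(_ eps e0) dfx.
  have := fg; rewrite (near_shift 0 x) /= => fg0.
  near=> y.
  rewrite -[X in `|X|]/(g (y + x) - (g x + 'd f x y)) -(nbhs_singleton fg).
  have <- : f (y + x) = g (y + x).
    by rewrite -[x]subr0; near: y.
  by near: y; exact: dfx.
by apply/diff_locallyP; rewrite (diff_unique dfc key).
Unshelve. all: by end_near. Qed.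

Lemma derive_comp (R : realType) (V V' W : normedModType R) (f : V -> V')
    (g : V' -> W) (x v : V) :
  differentiable f x -> differentiable g (f x) ->
  'D_v (g \o f) x = 'D_('D_v f x) g (f x).
Proof.
move=> df dg; rewrite !deriveE//; last exact: differentiable_comp.
by rewrite diff_comp.
Qed.

Lemma derive_rV (R : realType) (k : nat) (W : normedModType R)
    (g : 'rV[R]_k -> W) (y u : 'rV[R]_k) :
  differentiable g y -> 'D_u g y = \sum_j u 0 j *: pd j g y.
Proof.
move=> dg; rewrite deriveE// {1}[u]row_sum_delta linear_sum.
by apply: eq_bigr => j _; rewrite linearZ /pd deriveE.
Qed.

Lemma differentiable_mxP (R : realType) (V : normedModType R) (p q : nat)
    (f : V -> 'M[R]_(p, q)) (x : V) :
  differentiable f x <-> forall i j, differentiable (fun y => f y i j) x.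
Proof.
split=> [df i j|df].
  exact: (differentiable_comp df (differentiable_coord _ _ _)).
have -> : f = \sum_(i < p) \sum_(j < q) (fun y => f y i j *: delta_mx i j).
  apply/funext => y; rewrite {1}[f y]matrix_sum_delta fct_sumE.
  by apply: eq_bigr => i _; rewrite fct_sumE.
apply: differentiable_sum => i; apply: differentiable_sum => j.
exact: differentiableZl.
Qed.

Section CkOn.
Variables (R : realType) (V : normedModType R) (I : Type) (e : I -> V).

(** Functions of class C^(N+1) in the directions [e], up to the continuity of
    the last derivatives.  The directions are a parameter because two cases
    are needed: the canonical basis of R^m, and the single direction 1 of R
    for curves.  Bounding the order turns closure under products and
    compositions, whose derivatives are sums of such, into inductions on
    [N]. *)
Fixpoint Ck_on (W : normedModType R) (N : nat) (U : set V) (f : V -> W) : Prop :=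
  (forall x, U x -> differentiable f x) /\
  (if N is N'.+1 then forall i, Ck_on N' U ('D_(e i) f) else True).

(** The innermost derivative sits at the end of the list, so the induction
    peels lists from the right. *)
Lemma smooth_Ck_on (W : normedModType R) (U : set V) (f : V -> W) :
  (forall (s : seq I) x, U x ->
     differentiable (foldr (fun i f => 'D_(e i) f) f s) x) <->
  (forall N, Ck_on N U f).
Proof.
split=> [fs N|fs s].
  elim: N f fs => [|N IH] f fs /=; split=> //; try exact: (fs [::]).
  by move=> i; apply: IH => s x Ux; have := fs (rcons s i) x Ux; rewrite foldr_rcons.
elim/last_ind: s f fs => [|s i IH] f fs x Ux /=; first exact: (fs 0%N).1.
rewrite foldr_rcons; apply: IH => // N; exact: (fs N.+1).2.
Qed.

Lemma Ck_on_local (W : normedModType R) N (U : set V) (f : V -> W) :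
  (forall x, U x -> exists2 U', U' x & Ck_on N U' f) -> Ck_on N U f.
Proof.
elim: N f => [|N IH] f fs /=; split=> //; try by move=> x /fs [U' Ux [+ _]]; apply.
by move=> i; apply: IH => x /fs [U' Ux [_ /(_ i)]]; exists U'.
Qed.

Lemma Ck_on_sub (W : normedModType R) N (U U' : set V) (f : V -> W) :
  U' `<=` U -> Ck_on N U f -> Ck_on N U' f.
Proof. by move=> UU fs; apply: Ck_on_local => x /UU; exists U. Qed.

End CkOn.

Section CkOnTheory.
Variables (R : realType) (V : normedModType R) (I : Type) (e : I -> V).

Lemma Ck_on_ext (W : normedModType R) N (U : set V) (f g : V -> W) :
  open U -> (forall x, U x -> f x = g x) -> Ck_on e N U f -> Ck_on e N U g.
Proof.
move=> oU; elim: N f g => [|N IH] f g fg [df Df]; split=> //.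
- by move=> x Ux; apply: near_eq_differentiable (df x Ux);
    apply: filterS (open_nbhs_nbhs (conj oU Ux)).
- by move=> x Ux; apply: near_eq_differentiable (df x Ux);
    apply: filterS (open_nbhs_nbhs (conj oU Ux)).
- move=> i; apply: IH (Df i) => x Ux; apply: near_eq_derive.
  exact: filterS (open_nbhs_nbhs (conj oU Ux)).
Qed.

Lemma Ck_on_pred (W : normedModType R) N (U : set V) (f : V -> W) :
  Ck_on e N.+1 U f -> Ck_on e N U f.
Proof.
elim: N f => [|N IH] f; first by case.
by move=> [df Df]; split=> // i; apply: IH; exact: Df.
Qed.

Lemma Ck_on_cst (W : normedModType R) N (U : set V) (a : W) : Ck_on e N U (cst a).
Proof.
elim: N a => [|N IH] a; split=> //; try by move=> x _; exact: differentiable_cst.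
move=> i; rewrite (_ : 'D_(e i) _ = cst 0); first exact: IH.
by apply/funext => x; rewrite derive_cst.
Qed.

(** As [U] is open, formulas for the derivatives need to hold on [U] only. *)
Lemma Ck_onS (W : normedModType R) N (U : set V) (f : V -> W) (Df : I -> V -> W) :
  open U -> (forall x, U x -> differentiable f x) ->
  (forall i x, U x -> 'D_(e i) f x = Df i x) ->
  (forall i, Ck_on e N U (Df i)) -> Ck_on e N.+1 U f.
Proof.
move=> oU df h cDf; split=> // i.
by apply: Ck_on_ext (cDf i) => // x Ux; rewrite h.
Qed.

Lemma Ck_on_add (W : normedModType R) N (U : set V) (f g : V -> W) :
  open U -> Ck_on e N U f -> Ck_on e N U g -> Ck_on e N U (fun x => f x + g x).
Proof.
move=> oU; elim: N f g => [|N IH] f g [df Df] [dg Dg].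
  by split=> // x Ux; apply: differentiableD; [exact: df|exact: dg].
apply: (@Ck_onS _ _ _ _ (fun i x => 'D_(e i) f x + 'D_(e i) g x)) => //.
- by move=> x Ux; apply: differentiableD; [exact: df|exact: dg].
- by move=> i x Ux; rewrite -deriveD//; apply: diff_derivable; [exact: df|exact: dg].
- by move=> i; apply: IH; [exact: Df|exact: Dg].
Qed.

Lemma Ck_on_mul N (U : set V) (f g : V -> R) :
  open U -> Ck_on e N U f -> Ck_on e N U g -> Ck_on e N U (fun x => f x * g x).
Proof.
move=> oU; elim: N f g => [|N IH] f g hf hg.
  by split=> // x Ux; apply: differentiableM; [exact: hf.1|exact: hg.1].
have [df Df] := hf; have [dg Dg] := hg.
apply: (@Ck_onS _ _ _ _ (fun i x => f x * 'D_(e i) g x + g x * 'D_(e i) f x)) => //.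
- by move=> x Ux; apply: differentiableM; [exact: df|exact: dg].
- by move=> i x Ux; rewrite -[LHS]/('D_(e i) (f * g) x) deriveM//;
    apply: diff_derivable; [exact: df|exact: dg].
- by move=> i; apply: Ck_on_add => //; apply: IH; try exact: Ck_on_pred hf; try exact: Ck_on_pred hg; [exact: Dg|exact: Df].
Qed.

Lemma Ck_on_sum (W : normedModType R) N (U : set V) (J : Type) (s : seq J) (P : pred J)
    (f : J -> V -> W) :
  open U -> (forall j, P j -> Ck_on e N U (f j)) -> Ck_on e N U (fun x => \sum_(j <- s | P j) f j x).
Proof.
move=> oU fs; elim: s => [|j s IH].
  by under eq_fun do rewrite big_nil; exact: Ck_on_cst.
under eq_fun do rewrite big_cons.
by case Pj: (P j) => //; apply: Ck_on_add => //; exact: fs.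
Qed.

Lemma Ck_on_mx N (U : set V) p q (f : V -> 'M[R]_(p, q)) :
  open U -> (Ck_on e N U f <-> forall i j, Ck_on e N U (fun x => f x i j)).
Proof.
move=> oU; elim: N f => [|N IH] f; split.
- by move=> [df _] i j; split=> // x Ux; move/differentiable_mxP: (df x Ux).
- by move=> fs; split=> // x Ux; apply/differentiable_mxP => i j; exact: (fs i j).1.
- move=> [df Df] i j; apply: (@Ck_onS _ _ _ _ (fun k x => 'D_(e k) f x i j)) => //.
  + by move=> x Ux; move/differentiable_mxP: (df x Ux).
  + by move=> k x Ux; rewrite derive_mx ?mxE//; exact/diff_derivable/df.
  + by move=> k; exact: ((IH _).1 (Df k)).
- move=> fs; have df x : U x -> differentiable f x.
    by move=> Ux; apply/differentiable_mxP => i j; exact: (fs i j).1.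
  split=> // k; apply/IH => i j.
  apply: Ck_on_ext ((fs i j).2 k) => // x Ux.
  by rewrite derive_mx ?mxE//; exact/diff_derivable/df.
Qed.

Lemma Ck_on_comp N (U : set V) k (U' : set 'rV[R]_k) (f : V -> 'rV[R]_k) (g : 'rV[R]_k -> R) :
  open U -> (forall x, U x -> U' (f x)) ->
  Ck_on e N U f -> Ck_on (delta_mx 0) N U' g -> Ck_on e N U (g \o f).
Proof.
move=> oU UU; elim: N g => [|N IH] g hf hg.
  by split=> // x Ux; apply: differentiable_comp; [exact: hf.1|apply: hg.1; exact: UU].
have [df Df] := hf; have [dg Dg] := hg.
apply: (@Ck_onS _ _ _ _ (fun i x => \sum_j 'D_(e i) f x 0 j * pd j g (f x))) => //.
- by move=> x Ux; apply: differentiable_comp; [exact: df|apply: dg; exact: UU].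
- move=> i x Ux; rewrite derive_comp; [|exact: df|apply: dg; exact: UU].
  by rewrite derive_rV; [|apply: dg; exact: UU].
- move=> i; apply: Ck_on_sum => // j _; apply: Ck_on_mul => //.
    by have /Ck_on_mx := Df i; apply.
  by apply: (IH (pd j g)); [exact: Ck_on_pred hf|exact: Dg].
Qed.

Lemma Ck_on_compR N (U : set V) (U' : set R) (f : V -> R) (g : R -> R) :
  open U -> (forall x, U x -> U' (f x)) ->
  Ck_on e N U f -> Ck_on (V := R) (fun _ : unit => 1) N U' g -> Ck_on e N U (g \o f).
Proof.
move=> oU UU; elim: N g => [|N IH] g hf hg.
  by split=> // x Ux; apply: differentiable_comp; [exact: hf.1|apply: hg.1; exact: UU].
have [df Df] := hf; have [dg Dg] := hg.
apply: (@Ck_onS _ _ _ _ (fun i x => 'D_(e i) f x * 'D_1 g (f x))) => //.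
- by move=> x Ux; apply: differentiable_comp; [exact: df|apply: dg; exact: UU].
- move=> i x Ux; rewrite derive_comp; [|exact: df|apply: dg; exact: UU].
  rewrite !deriveE; [|by apply: dg; exact: UU|exact: df|by apply: dg; exact: UU].
  by rewrite -[X in 'd g _ X]mulr1 -[_ * 1]/(_ *: _) linearZ.
- move=> i; apply: Ck_on_mul => //; first exact: Df.
  by apply: (IH ('D_1 g)); [exact: Ck_on_pred hf|exact: (Dg tt)].
Qed.

End CkOnTheory.

Section Schwarz.
Variables (R : realType) (V : normedModType R).

Lemma line_derive (W : normedModType R) (f : V -> W) (p u : V) (s : R) :
  differentiable f (p + s *: u) ->
  is_derive s 1 (fun s : R => f (p + s *: u)) ('D_u f (p + s *: u)).
Proof.
move=> df; pose l (s : R) := p + s *: u.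
have dz : is_derive s 1 ( *:%R^~ u : R -> V) u.
  by apply: DeriveDef; [exact/derivable1_diffP|rewrite deriveE// diff_val scale1r].
have dl : is_derive s 1 l u.
  by rewrite -[u in is_derive _ _ _ u]add0r; exact: (is_deriveD (is_derive_cst p s 1)).
have dil : differentiable l s by apply/derivable1_diffP; exact: ex_derive.
apply: DeriveDef; first by apply/derivable1_diffP/(differentiable_comp dil df).
by rewrite -[LHS]/('D_1 (f \o l) s) derive_comp// derive_val.
Qed.

Lemma near_parallelogram (P : set V) (x u v : V) : nbhs x P ->
  exists2 h : R, 0 < h &
    forall s t, 0 <= s <= h -> 0 <= t <= h -> P (x + s *: u + t *: v).
Proof.
move=> /nbhs_ballP [r /= r0 rP].
have k0 : 0 < `|u| + `|v| + 1 by rewrite ltr_wpDl// addr_ge0.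
exists (r / (`|u| + `|v| + 1)); first by rewrite divr_gt0.
move=> s t /andP[s0 sh] /andP[t0 th]; apply: rP.
rewrite -ball_normE /= -addrA opprD addNKr normrN.
apply: (le_lt_trans (ler_normD _ _)); rewrite !normrZ !ger0_norm//.
apply: (@le_lt_trans _ _ (r / (`|u| + `|v| + 1) * (`|u| + `|v|))).
  by rewrite mulrDr lerD// ler_wpM2r.
by rewrite -mulrA gtr_pMr// mulrC ltr_pdivrMr// mul1r ltrDl.
Qed.

(** The mean value theorem twice: along [u] for the difference of the values of
    [f] on two parallel segments, then along [v] for its derivative. *)
Lemma mixed_difference (f : V -> R) (U P : set V) (x u v : V) :
  open U -> U x -> nbhs x P ->
  (forall y, U y -> differentiable f y) ->
  (forall y, U y -> differentiable ('D_u f) y) ->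
  exists2 h0 : R, 0 < h0 & forall h, 0 < h <= h0 -> exists2 y, P y &
    f (x + h *: u + h *: v) - f (x + h *: u) - (f (x + h *: v) - f x) =
    h * h * 'D_v ('D_u f) y.
Proof.
move=> oU Ux nP df dDf.
have nU : nbhs x U by apply: open_nbhs_nbhs.
have [h0 h00 UP] := near_parallelogram u v (filterI nU nP).
exists h0 => // h /andP[hp hh0].
pose g (s : R) := f (x + h *: v + s *: u) - f (x + s *: u).
have inU s t : 0 <= s <= h -> 0 <= t <= h -> (U `&` P) (x + s *: u + t *: v).
  by move=> /andP[s0 sh] /andP[t0 th]; apply: UP; rewrite ?s0 ?t0 (le_trans _ hh0).
have dg s : 0 <= s <= h -> is_derive s 1 g ('D_u f (x + h *: v + s *: u) - 'D_u f (x + s *: u)).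
  move=> sh; apply: is_deriveB; apply: line_derive; apply: df.
    by rewrite addrAC; apply: (inU s h _ _).1 => //; rewrite lexx ltW.
  by rewrite -[_ + _]addr0 -(scale0r v); apply: (inU s 0 _ _).1 => //; rewrite lexx ltW.
have [||s] := @MVT R g (fun s => 'D_u f (x + h *: v + s *: u) - 'D_u f (x + s *: u)) 0 h hp.
- by move=> s; rewrite in_itv/= => /andP[s0 sh]; apply: dg; rewrite !ltW.
- apply: derivable_within_continuous => s; rewrite in_itv/= => sh.
  by have := dg s sh => -[].
rewrite in_itv/= => /andP[s0 sh] gE.
have s0h : 0 <= s <= h by rewrite !ltW.
pose k (t : R) := 'D_u f (x + s *: u + t *: v).
have dk t : 0 <= t <= h -> is_derive t 1 k ('D_v ('D_u f) (x + s *: u + t *: v)).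
  by move=> th; apply: line_derive; apply: dDf; exact: (inU s t _ _).1.
have [||t] := @MVT R k (fun t => 'D_v ('D_u f) (x + s *: u + t *: v)) 0 h hp.
- by move=> t; rewrite in_itv/= => /andP[t0 th]; apply: dk; rewrite !ltW.
- apply: derivable_within_continuous => t; rewrite in_itv/= => th.
  by have := dk t th => -[].
rewrite in_itv/= => /andP[t0 th] kE.
exists (x + s *: u + t *: v); first by apply: (inU s t _ _).2; rewrite // !ltW.
move: gE kE; rewrite /g /k !scale0r !addr0 !subr0 [x + h *: v + s *: u]addrAC => gE kE.
rewrite (_ : _ - _ - _ = f (x + h *: v + h *: u) - f (x + h *: u) - (f (x + h *: v) - f x)); last by rewrite [x + h *: v + _]addrAC.
by rewrite gE kE -mulrA mulrC.
Qed.

(** The second difference of [mixed_difference] is symmetric in [u] and [v].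
    If the two mixed derivatives differed at [x], they would by continuity
    stay apart at all pairs of points near [x]; but a small second difference
    gives a pair of points where they agree. *)
Lemma deriveC (f : V -> R) (U : set V) (x u v : V) :
  open U -> U x ->
  (forall y, U y -> differentiable f y) ->
  (forall y, U y -> differentiable ('D_u f) y) ->
  (forall y, U y -> differentiable ('D_v f) y) ->
  {for x, continuous ('D_v ('D_u f))} ->
  {for x, continuous ('D_u ('D_v f))} ->
  'D_v ('D_u f) x = 'D_u ('D_v f) x.
Proof.
move=> oU Ux df dDu dDv cvu cuv; apply/eqP/negPn/negP => ne.
set a := 'D_v _ x in ne *; set b := 'D_u _ x in ne *.
have e0 : 0 < `|a - b| / 2 by rewrite divr_gt0// normr_gt0 subr_eq0.
have na : nbhs x [set y | `|a - 'D_v ('D_u f) y| < `|a - b| / 2].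
  by move/cvgrPdist_lt: cvu => /(_ _ e0).
have nb : nbhs x [set y | `|b - 'D_u ('D_v f) y| < `|a - b| / 2].
  by move/cvgrPdist_lt: cuv => /(_ _ e0).
have [h1 h10 H1] := mixed_difference v oU Ux na df dDu.
have [h2 h20 H2] := mixed_difference u oU Ux nb df dDv.
pose h := Num.min h1 h2.
have hp : 0 < h by rewrite lt_min h10.
have [|y /= Py Ey] := H1 h; first by rewrite hp ge_min lexx.
have [|z /= Pz Ez] := H2 h; first by rewrite hp ge_min lexx orbT.
have E : 'D_v ('D_u f) y = 'D_u ('D_v f) z.
  have hh : h * h != 0 by rewrite mulf_neq0// gt_eqF.
  apply: (mulfI hh); rewrite -Ey -Ez addrAC [x + h *: v + h *: u]addrAC.
  by rewrite opprB !opprD !opprK; ring.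
have : `|a - b| < `|a - b| / 2 + `|a - b| / 2.
  apply: le_lt_trans (ltrD Py Pz).
  by rewrite E -[X in X <= _](_ : `|(a - 'D_u ('D_v f) z) - (b - 'D_u ('D_v f) z)| = _) ?ler_normB// opprB addrA subrK.
by rewrite -splitr ltxx.
Qed.

End Schwarz.

Lemma smooth_onP (R : realType) m (W : normedModType R) U (f : 'rV[R]_m -> W) :
  smooth_on U f <-> (forall N, Ck_on (delta_mx 0) N U f).
Proof. exact: smooth_Ck_on. Qed.

Lemma smooth_on_mxP (R : realType) m (U : set 'rV[R]_m) p q (f : 'rV[R]_m -> 'M[R]_(p, q)) :
  open U -> (smooth_on U f <-> forall i j, smooth_on U (fun x => f x i j)).
Proof.
move=> oU; split=> [/smooth_onP fs i j|fs]; apply/smooth_onP => N.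
  by have /Ck_on_mx := fs N; apply.
by apply/Ck_on_mx => // i j; have /smooth_onP := fs i j.
Qed.

Section SmoothOn.
Variables (R : realType) (m : nat).
Implicit Types (U : set 'rV[R]_m).

Lemma smooth_on_differentiable (W : normedModType R) U (f : 'rV[R]_m -> W) x :
  smooth_on U f -> U x -> differentiable f x.
Proof. by move=> fs; exact: (fs [::]). Qed.

Lemma smooth_on_ext (W : normedModType R) U (f g : 'rV[R]_m -> W) :
  open U -> (forall x, U x -> f x = g x) -> smooth_on U f -> smooth_on U g.
Proof.
by move=> oU fg /smooth_onP fs; apply/smooth_onP => N; exact: Ck_on_ext (fs N).
Qed.

Lemma smooth_on_local (W : normedModType R) U (f : 'rV[R]_m -> W) :
  (forall x, U x -> exists2 U', U' x & smooth_on U' f) -> smooth_on U f.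
Proof. by move=> fs s x /fs[U' U'x]; apply. Qed.

Lemma smooth_on_sub (W : normedModType R) U U' (f : 'rV[R]_m -> W) :
  U' `<=` U -> smooth_on U f -> smooth_on U' f.
Proof. by move=> UU fs s x /UU; apply: fs. Qed.

Lemma smooth_on_cst (W : normedModType R) U (a : W) :
  smooth_on U (fun _ : 'rV[R]_m => a).
Proof. by apply/smooth_onP => N; exact: Ck_on_cst. Qed.

Lemma smooth_on_add (W : normedModType R) U (f g : 'rV[R]_m -> W) :
  open U -> smooth_on U f -> smooth_on U g -> smooth_on U (fun x => f x + g x).
Proof.
by move=> oU /smooth_onP fs /smooth_onP gs; apply/smooth_onP => N; exact: Ck_on_add.
Qed.

Lemma smooth_on_mul U (f g : 'rV[R]_m -> R) :
  open U -> smooth_on U f -> smooth_on U g -> smooth_on U (fun x => f x * g x).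
Proof.
by move=> oU /smooth_onP fs /smooth_onP gs; apply/smooth_onP => N; exact: Ck_on_mul.
Qed.

Lemma smooth_on_sum (W : normedModType R) U (J : Type) (s : seq J) (P : pred J)
    (f : J -> 'rV[R]_m -> W) :
  open U -> (forall j, P j -> smooth_on U (f j)) ->
  smooth_on U (fun x => \sum_(j <- s | P j) f j x).
Proof.
move=> oU fs; apply/smooth_onP => N; apply: Ck_on_sum => // j Pj.
exact: (smooth_onP U (f j)).1 (fs j Pj) N.
Qed.

Lemma smooth_on_coord U i j : open U -> smooth_on U (fun x : 'rV[R]_m => x i j).
Proof.
move=> oU.
apply/smooth_onP => -[|N].
  by split=> // x _; exact: differentiable_coord.
apply: (@Ck_onS _ _ _ _ _ _ _ _ (fun k => cst ((delta_mx 0 k : 'rV[R]_m) i j))) => //.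
- by move=> x _; exact: differentiable_coord.
- move=> k x _; have : 'D_(delta_mx 0 k) id x = delta_mx 0 k :> 'rV[R]_m by rewrite derive_id.
  rewrite derive_mx; last exact: derivable_id.
  by move=> /matrixP/(_ i j); rewrite mxE.
- by move=> k; exact: Ck_on_cst.
Qed.

Lemma smooth_on_comp U k (U' : set 'rV[R]_k) (f : 'rV[R]_m -> 'rV[R]_k)
    (g : 'rV[R]_k -> R) :
  open U -> (forall x, U x -> U' (f x)) ->
  smooth_on U f -> smooth_on U' g -> smooth_on U (fun x => g (f x)).
Proof.
move=> oU UU /smooth_onP fs /smooth_onP gs; apply/smooth_onP => N.
exact: (Ck_on_comp oU UU (fs N) (gs N)).
Qed.

Lemma smooth_on_comp_mx U k (U' : set 'rV[R]_k) (f : 'rV[R]_m -> 'rV[R]_k)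
    p q (g : 'rV[R]_k -> 'M[R]_(p, q)) :
  open U -> open U' -> (forall x, U x -> U' (f x)) ->
  smooth_on U f -> smooth_on U' g -> smooth_on U (fun x => g (f x)).
Proof.
move=> oU oU' UU fs /smooth_on_mxP gs; apply/smooth_on_mxP => // i j.
exact: (smooth_on_comp oU UU fs (gs oU' i j)).
Qed.

Lemma smooth_on_compR U (f : 'rV[R]_m -> R) (g : R -> R) :
  open U -> smooth_on U f -> (forall N, Ck_on (V := R) (fun _ : unit => 1) N setT g) ->
  smooth_on U (fun x => g (f x)).
Proof.
move=> oU /smooth_onP fs gs; apply/smooth_onP => N.
exact: (Ck_on_compR (U' := setT) oU _ (fs N) (gs N)).
Qed.

Lemma smooth_on_pd (W : normedModType R) U (f : 'rV[R]_m -> W) i :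
  smooth_on U f -> smooth_on U (pd i f).
Proof. by move=> fs s x Ux; have := fs (rcons s i) x Ux; rewrite foldr_rcons. Qed.

Lemma pdE (W : normedModType R) U (f : 'rV[R]_m -> W) x v :
  smooth_on U f -> U x -> 'D_v f x = \sum_i v 0 i *: pd i f x.
Proof. by move=> fs Ux; apply: derive_rV; exact: smooth_on_differentiable Ux. Qed.

Lemma pdC U (f : 'rV[R]_m -> R) x i j :
  open U -> smooth_on U f -> U x -> pd i (pd j f) x = pd j (pd i f) x.
Proof.
move=> oU fs Ux; apply: (deriveC oU Ux).
- by move=> y; exact: smooth_on_differentiable.
- by move=> y; apply: smooth_on_differentiable; exact: smooth_on_pd.
- by move=> y; apply: smooth_on_differentiable; exact: smooth_on_pd.
- apply/differentiable_continuous.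
  by apply: smooth_on_differentiable Ux; do 2 apply: smooth_on_pd.
- apply/differentiable_continuous.
  by apply: smooth_on_differentiable Ux; do 2 apply: smooth_on_pd.
Qed.

Lemma pd_mxE U p q (f : 'rV[R]_m -> 'M[R]_(p, q)) k x i j :
  smooth_on U f -> U x -> pd k f x i j = pd k (fun y => f y i j) x.
Proof.
move=> fs Ux; rewrite /pd derive_mx ?mxE//.
by apply: diff_derivable; exact: smooth_on_differentiable Ux.
Qed.

Lemma pd_ext (W : normedModType R) U (f g : 'rV[R]_m -> W) i x :
  open U -> (forall x, U x -> f x = g x) -> U x -> pd i f x = pd i g x.
Proof.
move=> oU fg Ux; apply: near_eq_derive.
by apply: filterS (open_nbhs_nbhs (conj oU Ux)).
Qed.

End SmoothOn.

Lemma derive_mxE (R : realType) (V : normedModType R) p q (f : V -> 'M[R]_(p, q)) v x i j :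
  differentiable f x -> 'D_v f x i j = 'D_v (fun y => f y i j) x.
Proof. by move=> df; rewrite derive_mx ?mxE//; exact: diff_derivable. Qed.

Section Chain2.
Variables (R : realType) (V : normedModType R) (k : nat).
Variables (U : set V) (U' : set 'rV[R]_k) (f : V -> 'rV[R]_k) (g : 'rV[R]_k -> R).
Hypotheses (oU : open U) (UU : forall x, U x -> U' (f x)).
Hypotheses (df : forall x, U x -> differentiable f x) (gs : smooth_on U' g).

Lemma derive_comp_rV v x : U x ->
  'D_v (fun x => g (f x)) x = \sum_j 'D_v f x 0 j * pd j g (f x).
Proof.
move=> Ux; rewrite -[LHS]/('D_v (g \o f) x) derive_comp.
- by rewrite (pdE _ gs)//; exact: UU.
- exact: df.
- by apply: smooth_on_differentiable gs _; exact: UU.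
Qed.

Lemma derive2_comp_rV v x : U x -> differentiable ('D_v f) x ->
  'D_v ('D_v (fun x => g (f x))) x =
  \sum_j 'D_v ('D_v f) x 0 j * pd j g (f x) +
  \sum_j \sum_i ('D_v f x 0 j * 'D_v f x 0 i) * pd j (pd i g) (f x).
Proof.
move=> Ux dDf.
have pdc j y : U y -> differentiable (fun x => pd j g (f x)) y.
  move=> Uy; apply: differentiable_comp; first exact: df.
  by apply: smooth_on_differentiable (smooth_on_pd j gs) _; exact: UU.
have dDfj j : differentiable (fun x => 'D_v f x 0 j) x.
  exact: (differentiable_comp dDf (differentiable_coord _ _ _)).
rewrite (_ : 'D_v ('D_v _) x = 'D_v (\sum_j ((fun y => 'D_v f y 0 j) * (fun y => pd j g (f y)))) x); last first.
  apply: near_eq_derive; apply: filterS (open_nbhs_nbhs (conj oU Ux)) => y Uy.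
  by rewrite derive_comp_rV// fct_sumE.
rewrite derive_sum; last by move=> j; apply: diff_derivable; apply: differentiableM => //; exact: pdc.
rewrite exchange_big -big_split; apply: eq_bigr => j _ /=.
rewrite deriveM; [|exact: diff_derivable|by apply: diff_derivable; exact: pdc].
rewrite [LHS]addrC; congr (_ + _); first by rewrite -[LHS]/(pd j g (f x) * _) mulrC derive_mxE.
have := @derive_comp _ _ _ _ f (pd j g) x v (df Ux).
rewrite /comp => ->; last by apply: smooth_on_differentiable (smooth_on_pd j gs) _; exact: UU.
rewrite (pdE _ (smooth_on_pd j gs)); last exact: UU.
rewrite -[LHS]/('D_v f x 0 j * _) big_distrr; apply: eq_bigr => i _ /=.
by rewrite -[_ *: _]/(_ * _) mulrA; congr (_ * _); rewrite mulrC.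
Qed.

End Chain2.

Opaque derive.
(** * Jets of order two of functions *)

Ltac generalize_derive :=
  repeat match goal with |- context [derive ?f ?a ?v] => move: (derive f a v) => ? end.

Section Pointwise.
Variables (R : realType) (V : normedModType R).

Lemma derive_mulf (f g : V -> R) x v : differentiable f x -> differentiable g x ->
  'D_v (fun y => f y * g y) x = f x * 'D_v g x + g x * 'D_v f x.
Proof. by move=> df dg; rewrite -[LHS]/('D_v (f * g) x) deriveM//; exact: diff_derivable. Qed.

Lemma derive_addf (W : normedModType R) (f g : V -> W) x v :
  differentiable f x -> differentiable g x ->
  'D_v (fun y => f y + g y) x = 'D_v f x + 'D_v g x.
Proof. by move=> df dg; rewrite -[LHS]/('D_v (f + g) x) deriveD//; exact: diff_derivable. Qed.

Lemma derive_sumf (W : normedModType R) k (f : 'I_k -> V -> W) x v :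
  (forall i, differentiable (f i) x) ->
  'D_v (fun y => \sum_i f i y) x = \sum_i 'D_v (f i) x.
Proof.
move=> df; rewrite -derive_sum; last by move=> i; exact: diff_derivable.
by congr ('D_v _ x); apply/funext => y; rewrite fct_sumE.
Qed.

Lemma derive_cmulf (k : R) (f : V -> R) x v : differentiable f x ->
  'D_v (fun y => k * f y) x = k * 'D_v f x.
Proof. by move=> df; rewrite -[LHS]/('D_v (k *: f) x) deriveZ//; exact: diff_derivable. Qed.

Lemma differentiable_sumf (W : normedModType R) k (f : 'I_k -> V -> W) x :
  (forall i, differentiable (f i) x) -> differentiable (fun y => \sum_i f i y) x.
Proof.
move=> df; rewrite (_ : (fun y => _) = \sum_i f i); first exact: differentiable_sum.
by apply/funext => y; rewrite fct_sumE.
Qed.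

End Pointwise.

Section Parts.
Variables (R : realType) (n : nat).
Implicit Types w : 'rV[R]_(n + n + n).

Lemma xpartE w i j : xpart w i j = w i (lshift n (lshift n j)).
Proof. by rewrite !mxE. Qed.
Lemma ypartE w i j : ypart w i j = w i (lshift n (rshift n j)).
Proof. by rewrite !mxE. Qed.
Lemma zpartE w i j : zpart w i j = w i (rshift (n + n) j).
Proof. by rewrite !mxE. Qed.

Lemma xpart_xyz (x y z : 'rV[R]_n) : xpart (xyz x y z) = x.
Proof. by rewrite /xpart /xyz !row_mxKl. Qed.
Lemma ypart_xyz (x y z : 'rV[R]_n) : ypart (xyz x y z) = y.
Proof. by rewrite /ypart /xyz row_mxKl row_mxKr. Qed.
Lemma zpart_xyz (x y z : 'rV[R]_n) : zpart (xyz x y z) = z.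
Proof. by rewrite /zpart /xyz row_mxKr. Qed.
Lemma xyz_parts w : xyz (xpart w) (ypart w) (zpart w) = w.
Proof. by rewrite /xyz /xpart /ypart /zpart !hsubmxK. Qed.

Lemma smooth_on_xpart (U : set 'rV[R]_(n + n + n)) : open U -> smooth_on U (@xpart R n).
Proof.
move=> oU; apply/smooth_on_mxP => // i j; under eq_fun do rewrite xpartE.
exact: smooth_on_coord.
Qed.

Lemma differentiable_xpart w : differentiable (@xpart R n) w.
Proof. exact: (smooth_on_differentiable (smooth_on_xpart openT)). Qed.

Lemma open_cyl (U : set 'rV[R]_n) : open U -> open [set w | U (xpart w)].
Proof.
move=> oU; apply: (open_comp _ oU) => w _.
exact/differentiable_continuous/differentiable_xpart.
Qed.

Lemma derive_coord k (v x : 'rV[R]_k) i j : 'D_v (fun y : 'rV[R]_k => y i j) x = v i j.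
Proof.
have : 'D_v id x = v by rewrite derive_id.
by rewrite derive_mx => [/matrixP/(_ i j)|]; [rewrite mxE|exact: derivable_id].
Qed.

Lemma derive_xpart v w : 'D_v (@xpart R n) w = xpart v.
Proof.
apply/matrixP => i j; rewrite derive_mxE; last exact: differentiable_xpart.
by under eq_fun do rewrite xpartE; rewrite derive_coord xpartE.
Qed.

Lemma derive_comp_xpart (W : normedModType R) (f : 'rV[R]_n -> W) v w : differentiable f (xpart w) ->
  'D_v (fun w => f (xpart w)) w = 'D_(xpart v) f (xpart w).
Proof.
move=> df; rewrite -[LHS]/('D_v (f \o @xpart R n) w) derive_comp ?derive_xpart//.
exact: differentiable_xpart.
Qed.

End Parts.

Section Jets.
Variables (R : realType) (n : nat).
Implicit Types w : 'rV[R]_(n + n + n).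

(** The Taylor coefficient of [t^(2-m)] of [f (x + t y + t^2 z)] at
    [w = (x, y, z)].  Counting from the top makes the indices additive under
    the graded lifts below, and the value 0 beyond [m = 2] lets the formulas
    hold for all indices. *)
Definition jet (W : normedModType R) (m : nat) (f : 'rV[R]_n -> W) w : W :=
  match m with 0 => lift2 f w | 1 => lift1 f w | 2 => f (xpart w) | _ => 0 end.

Lemma jet_mxE U p q (f : 'rV[R]_n -> 'M[R]_(p, q)) m w i j :
  open U -> smooth_on U f -> U (xpart w) ->
  jet m f w i j = jet m (fun x => f x i j) w.
Proof.
move=> oU fs Uw; case: m => [|[|[|m]]] //=; last by rewrite mxE.
- rewrite /lift2 !mxE summxE; congr (_ + _ * _).
    by apply: eq_bigr => s _; rewrite mxE (pd_mxE _ _ _ fs).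
  rewrite summxE; apply: eq_bigr => t _; rewrite summxE; apply: eq_bigr => s _.
  rewrite mxE (pd_mxE _ _ _ (smooth_on_pd s fs))//; congr (_ * _).
  by apply: (pd_ext (U := U)) => // x Ux; rewrite (pd_mxE _ _ _ fs).
- by rewrite /lift1 summxE; apply: eq_bigr => s _; rewrite mxE (pd_mxE _ _ _ fs).
Qed.

Lemma jet_ext (W : normedModType R) U (f g : 'rV[R]_n -> W) m w :
  open U -> (forall x, U x -> f x = g x) -> U (xpart w) -> jet m f w = jet m g w.
Proof.
move=> oU fg Uw; case: m => [|[|[|m]]]; last by [].
- rewrite /= /lift2; congr (_ + _ *: _).
    by apply: eq_bigr => s _; rewrite (pd_ext _ oU fg).
  apply: eq_bigr => t _; apply: eq_bigr => s _; congr (_ *: _).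
  by apply: (pd_ext _ oU _ Uw) => x Ux; exact: (pd_ext _ oU fg).
- by apply: eq_bigr => s _; rewrite (pd_ext _ oU fg).
- exact: fg.
Qed.

Variables (U : set 'rV[R]_n).
Hypothesis oU : open U.
Let cylU : set 'rV[R]_(n + n + n) := [set w | U (xpart w)].
Let ocyl : open cylU. Proof. exact: open_cyl. Qed.

Lemma lift1E (f : 'rV[R]_n -> R) w : smooth_on U f -> U (xpart w) ->
  lift1 f w = 'D_(ypart w) f (xpart w).
Proof. by move=> fs Uw; rewrite (pdE _ fs). Qed.

Lemma lift2_lift1 (f : 'rV[R]_n -> R) w :
  lift2 f w = \sum_s zpart w 0 s * pd s f (xpart w) +
              2^-1 * \sum_s ypart w 0 s * lift1 (pd s f) w.
Proof.
rewrite /lift2; congr (_ + _ * _); rewrite exchange_big; apply: eq_bigr => s _.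
by rewrite mulr_sumr; apply: eq_bigr => t _; rewrite mulrA [_ * ypart w 0 t]mulrC.
Qed.

Lemma lift2E (f : 'rV[R]_n -> R) w : smooth_on U f -> U (xpart w) ->
  lift2 f w = 'D_(zpart w) f (xpart w) +
    2^-1 * 'D_(ypart w) ('D_(ypart w) f) (xpart w).
Proof.
move=> fs Uw; rewrite lift2_lift1 -(pdE _ fs)//; congr (_ + _ * _).
rewrite (_ : 'D__ ('D__ f) _ = 'D_(ypart w) (fun x => \sum_s ypart w 0 s * pd s f x) (xpart w)); last first.
  apply: near_eq_derive; apply: filterS (open_nbhs_nbhs (conj oU Uw)) => x Ux.
  by rewrite (pdE _ fs).
have df s := smooth_on_differentiable (smooth_on_pd s fs) Uw.
rewrite derive_sumf; last by move=> s; apply: differentiableZ.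
apply: eq_bigr => s _; rewrite derive_cmulf// (lift1E (smooth_on_pd s fs))//.
Qed.

Lemma smooth_on_comp_xpart (f : 'rV[R]_n -> R) : smooth_on U f ->
  smooth_on cylU (fun w => f (xpart w)).
Proof. by move=> fs; apply: (smooth_on_comp _ _ _ fs) => //; exact: smooth_on_xpart. Qed.

Lemma smooth_on_lift1 (f : 'rV[R]_n -> R) : smooth_on U f -> smooth_on cylU (lift1 f).
Proof.
move=> fs; apply: smooth_on_sum => // s _; apply: smooth_on_mul => //.
  by under eq_fun do rewrite ypartE; exact: smooth_on_coord.
by apply: smooth_on_comp_xpart; exact: smooth_on_pd.
Qed.

Lemma smooth_on_jet m (f : 'rV[R]_n -> R) : smooth_on U f -> smooth_on cylU (jet m f).
Proof.
move=> fs; case: m => [|[|[|m]]].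
- rewrite -[jet 0 f]/(lift2 f) (_ : lift2 f = fun w => \sum_s zpart w 0 s * pd s f (xpart w) +
              2^-1 * \sum_s ypart w 0 s * lift1 (pd s f) w); last first.
    by apply/funext => w; rewrite lift2_lift1.
  apply: smooth_on_add => //.
    apply: smooth_on_sum => // s _; apply: smooth_on_mul => //.
      by under eq_fun do rewrite zpartE; exact: smooth_on_coord.
    by apply: smooth_on_comp_xpart; exact: smooth_on_pd.
  apply: smooth_on_mul => //; first exact: smooth_on_cst.
  apply: smooth_on_sum => // s _; apply: smooth_on_mul => //.
    by under eq_fun do rewrite ypartE; exact: smooth_on_coord.
  by apply: smooth_on_lift1; exact: smooth_on_pd.
- exact: smooth_on_lift1.
- exact: smooth_on_comp_xpart.
- exact: smooth_on_cst.
Qed.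

Lemma smooth_on_dir (f : 'rV[R]_n -> R) v : smooth_on U f -> smooth_on U ('D_v f).
Proof.
move=> fs; apply: (smooth_on_ext (f := fun x => \sum_i v 0 i * pd i f x)) => //.
  by move=> x Ux; rewrite (pdE _ fs).
apply: smooth_on_sum => // i _; apply: smooth_on_mul => //; first exact: smooth_on_cst.
exact: smooth_on_pd.
Qed.

Lemma derive_ext (W : normedModType R) (f g : 'rV[R]_n -> W) x v :
  (forall x, U x -> f x = g x) -> U x -> 'D_v f x = 'D_v g x.
Proof.
by move=> fg Ux; apply: near_eq_derive; apply: filterS (open_nbhs_nbhs (conj oU Ux)).
Qed.

Lemma jetD m (f g : 'rV[R]_n -> R) w : smooth_on U f -> smooth_on U g -> U (xpart w) ->
  jet m (fun x => f x + g x) w = jet m f w + jet m g w.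
Proof.
move=> fs gs Uw; have fgs := smooth_on_add oU fs gs.
have E v x : U x -> 'D_v (fun x => f x + g x) x = 'D_v f x + 'D_v g x.
  by move=> Ux; rewrite derive_addf//; apply: smooth_on_differentiable Ux.
case: m => [|[|[|m]]] //=; last by rewrite addr0.
- rewrite !lift2E// E// (derive_ext _ (E _) Uw) derive_addf.
  + by generalize_derive => *; ring.
  + by apply: smooth_on_differentiable Uw; exact: smooth_on_dir.
  + by apply: smooth_on_differentiable Uw; exact: smooth_on_dir.
- by rewrite !lift1E// E.
Qed.

Lemma jet0 m w : jet m (fun _ : 'rV[R]_n => 0 : R) w = 0.
Proof.
have z : smooth_on U (fun _ : 'rV[R]_n => 0 : R) by exact: smooth_on_cst.
have d s : pd s (fun _ : 'rV[R]_n => 0 : R) = fun _ => 0.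
  by apply/funext => x; exact: derive_cst.
case: m => [|[|[|m]]] //=.
- rewrite lift2_lift1 /lift1 !big1 ?mulr0 ?addr0// => s _.
    by rewrite big1 ?mulr0// => t _; rewrite !d scaler0.
  by rewrite d mulr0.
- by rewrite /lift1 big1// => s _; rewrite d scaler0.
Qed.

Lemma jet_sum m (J : Type) (r : seq J) (P : pred J) (f : J -> 'rV[R]_n -> R) w :
  (forall j, smooth_on U (f j)) -> U (xpart w) ->
  jet m (fun x => \sum_(j <- r | P j) f j x) w = \sum_(j <- r | P j) jet m (f j) w.
Proof.
move=> fs Uw; elim: r => [|j r IH].
  by under eq_fun do rewrite big_nil; rewrite big_nil jet0.
under eq_fun do rewrite big_cons; rewrite big_cons; case: (P j) => //.
by rewrite jetD ?IH//; apply: smooth_on_sum.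
Qed.

(** Multiplication of truncated power series.  The first factor is evaluated
    at the three indices that occur in a lift of codegree [d]; whatever [d] and
    [m] are, the terms that do not belong to the product have an index beyond
    2 and vanish. *)
Lemma jetM d m (f g : 'rV[R]_n -> R) w : smooth_on U f -> smooth_on U g -> U (xpart w) ->
  jet (m + d) (fun x => f x * g x) w =
  jet d.+2 f w * jet m g w + jet d.+1 f w * jet m.+1 g w + jet d f w * jet m.+2 g w.
Proof.
move=> fs gs Uw; have fgs := smooth_on_mul oU fs gs.
have df h : smooth_on U h -> differentiable h (xpart w).
  by move=> hs; exact: smooth_on_differentiable Uw.
have E v x : U x -> 'D_v (fun x => f x * g x) x = f x * 'D_v g x + g x * 'D_v f x.
  by move=> Ux; rewrite derive_mulf//; apply: smooth_on_differentiable Ux.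
have E2 v : 'D_v ('D_v (fun x => f x * g x)) (xpart w) =
    f (xpart w) * 'D_v ('D_v g) (xpart w) + 2 * ('D_v f (xpart w) * 'D_v g (xpart w)) +
    g (xpart w) * 'D_v ('D_v f) (xpart w).
  have fv := smooth_on_dir v fs; have gv := smooth_on_dir v gs.
  rewrite (derive_ext _ (E _) Uw) derive_addf; first last.
  - by apply: differentiableM; exact: df.
  - by apply: differentiableM; exact: df.
  rewrite !derive_mulf; [|exact: df|exact: df|exact: df|exact: df].
  by move: (f (xpart w)) (g (xpart w)) => ? ?; generalize_derive => *; ring.
case: d m => [|[|[|d]]] [|[|[|m]]]; rewrite ?addn0 ?addSn ?addnS /= ?mulr0 ?mul0r ?add0r ?addr0 ?lift2E ?lift1E ?E ?E2//;
  move: (f (xpart w)) (g (xpart w)) => ? ?; generalize_derive; try by field.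
Qed.
End Jets.

Section JetCalculus.
Variables (R : realType) (n : nat) (U : set 'rV[R]_n).
Hypothesis oU : open U.
Implicit Types w v : 'rV[R]_(n + n + n).
Let cylU : set 'rV[R]_(n + n + n) := [set w | U (xpart w)].
Let ocyl : open cylU. Proof. exact: open_cyl. Qed.

Lemma smooth_on_cyl_differentiable (f : 'rV[R]_(n + n + n) -> R) w :
  smooth_on cylU f -> U (xpart w) -> differentiable f w.
Proof. by move=> fs Uw; exact: (smooth_on_differentiable fs). Qed.

Lemma derive_lift1 (f : 'rV[R]_n -> R) v w : smooth_on U f -> U (xpart w) ->
  'D_v (lift1 f) w = \sum_i xpart v 0 i * lift1 (pd i f) w +
                     \sum_i ypart v 0 i * pd i f (xpart w).
Proof.
move=> fs Uw; have dpd s := smooth_on_pd s fs.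
have dpdw s : differentiable (fun w => pd s f (xpart w)) w.
  by apply: smooth_on_cyl_differentiable => //; exact: smooth_on_comp_xpart.
rewrite -[LHS]/('D_v (fun w => \sum_s ypart w 0 s * pd s f (xpart w)) w).
have dy s : differentiable (fun w => ypart w 0 s) w.
  by under eq_fun do rewrite ypartE; exact: differentiable_coord.
rewrite derive_sumf; last by move=> s; exact: differentiableM.
under eq_bigr => s _.
  rewrite derive_mulf// derive_comp_xpart; last exact: smooth_on_differentiable (dpd s) Uw.
  rewrite (pdE _ (dpd s))//.
  have -> : 'D_v (fun w => ypart w 0 s) w = ypart v 0 s.
    by under eq_fun do rewrite ypartE; rewrite derive_coord ypartE.
  over.
rewrite big_split; congr (_ + _); last by apply: eq_bigr => s _; rewrite mulrC.
under eq_bigr do rewrite mulr_sumr.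
rewrite exchange_big; apply: eq_bigr => i _ /=.
rewrite /lift1 mulr_sumr; apply: eq_bigr => s _.
by rewrite (pdC _ _ oU fs)// mulrCA.
Qed.

(** A jet coefficient is a polynomial in [y] and [z] whose coefficients are
    iterated derivatives at [x].  Differentiating in [y] (resp. [z]) removes
    one factor of weight 1 (resp. 2), which shifts the index; the commutation
    of partial derivatives brings the new derivative next to [f]. *)
Lemma derive_jet m (f : 'rV[R]_n -> R) v w : smooth_on U f -> U (xpart w) ->
  'D_v (jet m f) w = \sum_i (xpart v 0 i * jet m (pd i f) w +
    ypart v 0 i * jet m.+1 (pd i f) w + zpart v 0 i * jet m.+2 (pd i f) w).
Proof.
move=> fs Uw; have dpd s := smooth_on_pd s fs.
have dz s : differentiable (fun w => zpart w 0 s) w.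
  by under eq_fun do rewrite zpartE; exact: differentiable_coord.
have dy s : differentiable (fun w => ypart w 0 s) w.
  by under eq_fun do rewrite ypartE; exact: differentiable_coord.
case: m => [|[|[|m]]].
- rewrite -[jet 0 f]/(lift2 f) (_ : lift2 f = fun w => \sum_s zpart w 0 s * pd s f (xpart w) +
              2^-1 * \sum_s ypart w 0 s * lift1 (pd s f) w); last first.
    by apply/funext => x; rewrite lift2_lift1.
  have d1 s : differentiable (fun w => pd s f (xpart w)) w.
    by apply: smooth_on_cyl_differentiable => //; exact: smooth_on_comp_xpart.
  have d2 s : differentiable (lift1 (pd s f)) w.
    by apply: smooth_on_cyl_differentiable => //; exact: smooth_on_lift1.
  have d3 : differentiable (fun w => \sum_s zpart w 0 s * pd s f (xpart w)) w.
    by apply: differentiable_sumf => s; exact: differentiableM.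
  have d4 : differentiable (fun w => \sum_s ypart w 0 s * lift1 (pd s f) w) w.
    by apply: differentiable_sumf => s; exact: differentiableM.
  rewrite derive_addf//; last exact: differentiableZ.
  rewrite derive_cmulf// !derive_sumf; try by move=> s; exact: differentiableM.
  have -> : \sum_s 'D_v (fun w => zpart w 0 s * pd s f (xpart w)) w =
      \sum_i xpart v 0 i * (\sum_s zpart w 0 s * pd s (pd i f) (xpart w)) +
      \sum_i zpart v 0 i * pd i f (xpart w).
    under eq_bigr => s _.
      rewrite derive_mulf// derive_comp_xpart; last exact: smooth_on_differentiable (dpd s) Uw.
      rewrite (pdE _ (dpd s))//.
      have -> : 'D_v (fun w => zpart w 0 s) w = zpart v 0 s.
        by under eq_fun do rewrite zpartE; rewrite derive_coord zpartE.
      over.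
    rewrite big_split; congr (_ + _); last by apply: eq_bigr => s _; rewrite mulrC.
    under eq_bigr do rewrite mulr_sumr.
    rewrite exchange_big; apply: eq_bigr => i _ /=.
    rewrite mulr_sumr; apply: eq_bigr => s _.
    by rewrite (pdC _ _ oU fs)// mulrCA.
  have E i s : lift1 (pd i (pd s f)) w = lift1 (pd s (pd i f)) w.
    apply: (@jet_ext _ _ _ U _ _ 1 _ oU _ Uw) => x Ux.
    exact: (pdC _ _ oU fs Ux).
  have -> : \sum_s 'D_v (fun w => ypart w 0 s * lift1 (pd s f) w) w =
      \sum_i xpart v 0 i * (\sum_s ypart w 0 s * lift1 (pd s (pd i f)) w) +
      2 * \sum_i ypart v 0 i * lift1 (pd i f) w.
    under eq_bigr => s _.
      rewrite derive_mulf// derive_lift1//.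
      have -> : 'D_v (fun w => ypart w 0 s) w = ypart v 0 s.
        by under eq_fun do rewrite ypartE; rewrite derive_coord ypartE.
      rewrite mulrDr -addrA.
      over.
    rewrite !big_split /=; congr (_ + _).
      under eq_bigr do rewrite mulr_sumr.
      rewrite exchange_big; apply: eq_bigr => i _ /=.
      rewrite [RHS]mulr_sumr; apply: eq_bigr => s _.
      exact: (etrans (congr1 (fun t => ypart w 0 s * (xpart v 0 i * t)) (E i s)) (mulrCA _ _ _)).
    rewrite mulr2n mulrDl !mul1r; congr (_ + _).
      under eq_bigr do rewrite mulr_sumr.
      rewrite exchange_big; apply: eq_bigr => i _ /=.
      rewrite mulr_sumr; apply: eq_bigr => s _; rewrite mulrCA.
      by rewrite (pdC _ _ oU fs).
    by apply: eq_bigr => s _; rewrite mulrC.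
  have E1 : \sum_i xpart v 0 i * lift2 (pd i f) w =
      \sum_i xpart v 0 i * (\sum_s zpart w 0 s * pd s (pd i f) (xpart w)) +
      2^-1 * \sum_i xpart v 0 i * (\sum_s ypart w 0 s * lift1 (pd s (pd i f)) w).
    rewrite mulr_sumr -big_split; apply: eq_bigr => i _ /=.
    by rewrite lift2_lift1 mulrDr; congr (_ + _); exact: mulrCA.
  rewrite !big_split /= E1 mulrDr mulKf ?pnatr_eq0// addrACA.
  by rewrite [X in _ + _ + X = _]addrC addrA.
- rewrite [LHS]derive_lift1// -big_split; apply: eq_bigr => i _ /=.
  by rewrite mulr0 addr0.
- rewrite [LHS]derive_comp_xpart; last exact: smooth_on_differentiable Uw.
  by rewrite (pdE _ fs)//; apply: eq_bigr => i _ /=; rewrite !mulr0 !addr0.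
- rewrite [LHS]derive_cst big1// => i _ /=; by rewrite !mulr0 !addr0.
Qed.

(** The first and second order chain rules, along the line of direction [y]:
    the derivatives of [phi] that they produce are the components of the
    prolonged point. *)
Lemma jet_comp k m (phi : 'rV[R]_n -> 'rV[R]_k) (U' : set 'rV[R]_k) (g : 'rV[R]_k -> R) w :
  smooth_on U phi -> (forall x, U x -> U' (phi x)) -> open U' -> smooth_on U' g -> U (xpart w) ->
  jet m (fun x => g (phi x)) w = jet m g (xyz (phi (xpart w)) (lift1 phi w) (lift2 phi w)).
Proof.
move=> ps UU oU' gs Uw.
have gps := smooth_on_comp oU UU ps gs.
have dp x : U x -> differentiable phi x := smooth_on_differentiable ps.
have pj j : smooth_on U (fun x => phi x 0 j) by move/smooth_on_mxP: ps; apply.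
have dDp u : differentiable ('D_u phi) (xpart w).
  apply/differentiable_mxP => i j; rewrite (ord1 i).
  apply: (near_eq_differentiable (f := 'D_u (fun x => phi x 0 j))).
    by apply: filterS (open_nbhs_nbhs (conj oU Uw)) => x Ux; rewrite derive_mxE//; exact: dp.
  by apply: smooth_on_differentiable (smooth_on_dir oU _ (pj j)) Uw.
have l1 j : lift1 phi w 0 j = 'D_(ypart w) phi (xpart w) 0 j.
  by rewrite -[lift1 phi w]/(jet 1 phi w) (jet_mxE _ _ _ oU ps)// [LHS](lift1E (pj j))// derive_mxE//; exact: dp.
have l2 j : lift2 phi w 0 j = 'D_(zpart w) phi (xpart w) 0 j +
    2^-1 * 'D_(ypart w) ('D_(ypart w) phi) (xpart w) 0 j.
  rewrite -[lift2 phi w]/(jet 0 phi w) (jet_mxE _ _ _ oU ps)// [LHS](lift2E oU (pj j))//.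
  rewrite (derive_mxE _ _ _ (dp _ Uw)) (derive_mxE _ _ _ (dDp _)); congr (_ + _ * _).
  by apply: (derive_ext oU _ _ Uw) => x Ux; rewrite derive_mxE//; exact: dp.
set W := xyz _ _ _.
have xW : xpart W = phi (xpart w) by rewrite xpart_xyz.
have yW j : ypart W 0 j = 'D_(ypart w) phi (xpart w) 0 j by rewrite ypart_xyz.
have zW j : zpart W 0 j = 'D_(zpart w) phi (xpart w) 0 j +
    2^-1 * 'D_(ypart w) ('D_(ypart w) phi) (xpart w) 0 j by rewrite zpart_xyz.
move: W xW yW zW => W xW yW zW.
case: m => [|[|[|m]]].
- rewrite [LHS](lift2E oU gps)// (derive_comp_rV UU dp gs)// (derive2_comp_rV oU UU dp gs)//.
  rewrite -[RHS]/(lift2 g W) /lift2 mulrDr addrA xW; congr (_ + _).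
    rewrite mulr_sumr -big_split; apply: eq_bigr => j _ /=.
    by rewrite zW mulrA -mulrDl.
  by congr (_ * _); apply: eq_bigr => j _; apply: eq_bigr => i _; rewrite !yW.
- rewrite [LHS](lift1E gps)// (derive_comp_rV UU dp gs)// -[RHS]/(lift1 g W) /lift1 xW.
  by apply: eq_bigr => j _; rewrite yW.
- by rewrite /= xW.
- by [].
Qed.

End JetCalculus.

(** * Cutoff functions on R^n *)

Section Bump.
Variable R : realType.

(** The derivatives of [exp (- 1 / t)], extended by 0, are combinations of
    these functions. *)
Definition flat (j : nat) (t : R) : R := if 0 < t then t^-1 ^+ j * expR (- t^-1) else 0.

Lemma flat_le (j : nat) (t : R) : 0 < t -> 0 <= flat j.+1 t <= j.+2`!%:R * t.
Proof.
move=> t0; rewrite /flat t0 mulr_ge0 ?expR_ge0 ?exprn_ge0 ?invr_ge0 ?(ltW t0)//=.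
have ti0 : 0 < t^-1 by rewrite invr_gt0.
have f0 : 0 < (j.+2`!%:R : R) by rewrite ltr0n fact_gt0.
have H : t^-1 ^+ j.+2 <= j.+2`!%:R * expR t^-1.
  rewrite mulrC -ler_pdivrMr//; by apply: le_trans (@expR_ge1Dxn R t^-1 j.+1 (ltW ti0)); rewrite lerDr.
rewrite expRN ler_pdivrMr ?expR_gt0// -mulrA -[X in _ <= X]mulrCA.
by rewrite -ler_pdivrMl// -exprS.
Qed.

Lemma flat_derive_gt0 j (t : R) : 0 < t ->
  is_derive t 1 (flat j) (flat j.+2 t - j%:R * flat j.+1 t).
Proof.
move=> t0.
have tn : t != 0 by rewrite gt_eqF.
have di : is_derive t 1 (fun t : R => t^-1) (- t^-1 ^+ 2).
  apply: is_derive_eq; first exact: (is_deriveV (f := id)).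
  by rewrite /GRing.scale/= mulr1 exprVn.
apply: (@near_eq_is_derive _ _ _ (fun t : R => t^-1 ^+ j * expR (- t^-1))).
  have := @lt_nbhsr R 0 t t0; apply: filterS => s /= s0.
  by rewrite /flat s0.
have dX := is_deriveX j di.
have dE : is_derive t 1 (fun t : R => expR (- t^-1)) (t^-1 ^+ 2 * expR (- t^-1)).
  have dN := is_deriveN di.
  have := is_derive1_comp (f := expR) (g := fun t : R => - t^-1) (is_derive_expR _) dN.
  by rewrite opprK mulrC.
have dM := is_deriveM dX dE.
have -> : (fun t : R => t^-1 ^+ j * expR (- t^-1)) =
    (fun t : R => t^-1) ^+ j * (fun t : R => expR (- t^-1)).
  by apply/funext => s; rewrite exprfctE.
apply: (is_derive_eq dM).
rewrite /flat t0 exprfctE /GRing.scale/=.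
move: (t^-1) (expR _) => i E; case: j {dX dM} => [|j].
  by rewrite !mul0r !mulr0 addr0 subr0 expr0 mul1r.
by rewrite /= !exprS; ring.
Qed.

Lemma flat_le0 j (t : R) : t <= 0 -> flat j t = 0.
Proof. by rewrite /flat; case: ltrP. Qed.

(** Away from 0 this is the usual calculus; at 0 the difference quotient of
    [flat j] is [flat j.+1], which tends to 0. *)
Lemma flat_derive j (t : R) :
  is_derive t 1 (flat j) (flat j.+2 t - j%:R * flat j.+1 t).
Proof.
case: (ltrgt0P t) => [t0|t0|->]; first exact: flat_derive_gt0.
  rewrite !flat_le0 ?(ltW t0)// mulr0 subrr.
  have dc : is_derive t 1 (cst 0 : R -> R) 0 by exact: is_derive_cst.
  apply: near_eq_is_derive dc.
  have := @lt_nbhsl R t 0 t0; apply: filterS => s /= s0.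
  by rewrite (flat_le0 j (ltW s0)).
rewrite !flat_le0// mulr0 subrr.
have C0 : 0 < (j.+2`!%:R : R) by rewrite ltr0n fact_gt0.
have F : h^-1 *: ((flat j \o shift 0) (h *: 1) - flat j 0) @[h --> (0:R)^'] --> (0 : R).
  apply/cvgrPdist_le => e e0; near=> h.
  rewrite /= [h *: 1]mulr1 addr0 (flat_le0 j (lexx 0)) subr0 sub0r normrN.
  case: (ltrP 0 h) => h0; last by rewrite (flat_le0 j h0) scaler0 normr0 ltW.
  have -> : h^-1 *: flat j h = flat j.+1 h by rewrite /flat h0 exprS -mulrA.
  have /andP[f0 f1] := flat_le j h0.
  rewrite ger0_norm//; apply: (le_trans f1); rewrite mulrC -ler_pdivlMr//.
  rewrite -[h]gtr0_norm//; near: h.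
  by apply: dnbhs0_le; rewrite divr_gt0.
apply: DeriveDef; last exact: cvg_lim.
by apply/cvg_ex; exists 0.
Unshelve. all: by end_near. Qed.

Lemma flat_Ck_on N j : Ck_on (V := R) (fun _ : unit => 1) N setT (flat j).
Proof.
have df k x : setT x -> differentiable (flat k) x.
  by move=> _; apply/derivable1_diffP; have := flat_derive k x => -[].
elim: N j => [|N IH] j; first by split=> // x; exact: df.
apply: (@Ck_onS _ _ _ _ _ _ _ _ (fun _ x => flat j.+2 x + (- j%:R) * flat j.+1 x)).
- exact: openT.
- exact: df.
- by move=> _ x _; rewrite mulNr; have := flat_derive j x => -[].
- move=> _; apply: Ck_on_add; [exact: openT|exact: IH|].
  by apply: Ck_on_mul; [exact: openT|exact: Ck_on_cst|exact: IH].
Qed.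

(** The nesting produces both constant pieces without any quotient of
    functions: the inner term is 0 for [1 <= t], and it is at least
    [flat 0 1] for [t <= 0]. *)
Definition smooth_step (t : R) : R := (flat 0 (flat 0 1))^-1 * flat 0 (flat 0 1 - flat 0 (1 - t)).

Lemma flat0_gt0 (t : R) : 0 < t -> 0 < flat 0 t.
Proof. by move=> t0; rewrite /flat t0 expr0 mul1r expR_gt0. Qed.

Lemma smooth_step_ge1 t : 1 <= t -> smooth_step t = 1.
Proof.
move=> t1; rewrite /smooth_step [flat 0 (1 - t)]flat_le0 ?subr_le0// subr0 mulVf//.
by rewrite gt_eqF// flat0_gt0// flat0_gt0.
Qed.

Lemma smooth_step_le0 t : t <= 0 -> smooth_step t = 0.
Proof.
move=> t0; rewrite /smooth_step [X in _ * X]flat_le0 ?mulr0// subr_le0.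
have h : 1 <= 1 - t by rewrite lerDl oppr_ge0.
have h0 : 0 < 1 - t by exact: lt_le_trans h.
by rewrite /flat ltr01 h0 !expr0 !mul1r ler_expR lerN2 lef_pV2 ?posrE.
Qed.

Lemma Ck_on_id N : Ck_on (V := R) (fun _ : unit => 1) N setT (fun t : R => t).
Proof.
case: N => [|N]; first by split=> // x _; exact: ex_diff.
apply: (@Ck_onS _ _ _ _ _ _ _ _ (fun _ : unit => cst (1 : R) : R -> R)).
- exact: openT.
- by move=> x _; exact: ex_diff.
- by move=> _ x _; rewrite derive_id.
- by move=> _; exact: Ck_on_cst.
Qed.

Lemma smooth_step_Ck_on N : Ck_on (V := R) (fun _ : unit => 1) N setT smooth_step.
Proof.
have oT : open (setT : set R) := openT.
have aff (a : R) (f : R -> R) : Ck_on (V := R) (fun _ : unit => 1) N setT f ->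
    Ck_on (V := R) (fun _ : unit => 1) N setT (fun t : R => a - f t).
  move=> cf; rewrite (_ : (fun t => _) = (fun t => a + (-1) * f t)); last first.
    by apply/funext => t; rewrite mulN1r.
  apply: Ck_on_add => //; first exact: Ck_on_cst.
  by apply: Ck_on_mul => //; exact: Ck_on_cst.
apply: Ck_on_mul => //; first exact: Ck_on_cst.
apply: (Ck_on_compR (U' := setT) oT _ _ (flat_Ck_on N 0)) => //.
apply: (aff); apply: (Ck_on_compR (U' := setT) oT _ _ (flat_Ck_on N 0)) => //.
by apply: (aff); exact: Ck_on_id.
Qed.

Lemma plateau_exists n (a : 'rV[R]_n) (r : R) : 0 < r ->
  exists phi : 'rV[R]_n -> R,
    [/\ smooth_on setT phi, \forall x \near a, phi x = 1 &
        forall x, r < `|a - x| -> phi x = 0].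
Proof.
move=> r0; pose q (x : 'rV[R]_n) := \sum_i (x 0 i - a 0 i) * (x 0 i - a 0 i).
have oT : open (setT : set 'rV[R]_n) := openT.
have qs : smooth_on setT q.
  apply: smooth_on_sum => // i _.
  have h : smooth_on setT (fun x : 'rV[R]_n => x 0 i - a 0 i).
    by apply: smooth_on_add; [exact: oT|exact: smooth_on_coord|exact: smooth_on_cst].
  exact: smooth_on_mul.
(* The Euclidean square [q] is below [d] near [a], and at least 2 [d] outside the ball. *)
pose d := r ^+ 2 / 2; have d0 : 0 < d by rewrite divr_gt0// exprn_gt0.
exists (fun x => smooth_step (2 + (- d^-1) * q x)); split.
- apply: smooth_on_compR; [exact: oT| |exact: smooth_step_Ck_on].
  apply: smooth_on_add; [exact: oT|exact: smooth_on_cst|].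
  by apply: smooth_on_mul; [exact: oT|exact: smooth_on_cst|].
- have qc : {for a, continuous q}.
    exact/differentiable_continuous/(smooth_on_differentiable qs).
  have qa : q a = 0 by rewrite /q big1// => i _; rewrite subrr mulr0.
  have /cvgrPdist_lt/(_ d d0) := qc.
  apply: filterS => x; rewrite qa sub0r normrN => /(le_lt_trans (ler_norm _)) qd.
  apply: smooth_step_ge1; rewrite mulNr lerBrDl -lerBrDr.
  by rewrite ler_pdivrMl// (le_trans (ltW qd))//; lra.
- move=> x nx; apply: smooth_step_le0; rewrite mulNr subr_le0 ler_pdivlMl//.
  have [i ri] : exists i, r < `|a 0 i - x 0 i|.
    apply: contrapT => /forallNP h; move: nx; rewrite ltNge => /negP; apply.
    rewrite [X in X <= _]mx_normrE (bigmax_le _ (ltW r0))//= => -[k i] _.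
    rewrite (ord1 k) !mxE /= leNgt; exact/negP/h.
  rewrite /q (bigD1 i)//=; apply: ler_wpDr.
    by apply: sumr_ge0 => j _; rewrite -expr2 sqr_ge0.
  rewrite -expr2 -real_normK ?num_real// distrC.
  have -> : d * 2 = r ^+ 2 by rewrite /d divfK ?pnatr_eq0.
  by rewrite ler_pXn2r ?nnegrE// ltW.
Qed.
End Bump.

(** * Atlases with smooth transition maps *)

Lemma smooth_on_scale_mx (R : realType) m (U : set 'rV[R]_m) p q (f : 'rV[R]_m -> R) (X : 'rV[R]_m -> 'M[R]_(p, q)) :
  open U -> smooth_on U f -> smooth_on U X -> smooth_on U (fun x => f x *: X x).
Proof.
move=> oU fs /smooth_on_mxP Xs; apply/smooth_on_mxP => // i j.
under eq_fun do rewrite mxE; apply: smooth_on_mul => //; exact: Xs.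
Qed.

Section SmoothAtlas.
Variables (R : realType) (m : nat) (A : atlas R m).
Implicit Types (a b c : chart A) (p q : A).

(** The part of [is_manifold] that passes from [M] to [T2 M] by local
    computations. *)
Record smooth_atlas : Prop := SmoothAtlas {
  smooth_atlas_inj : forall a : chart A, set_inj (dom a) (coord a);
  smooth_atlas_overlap : forall a b : chart A, open (coord a @` (dom a `&` dom b));
  smooth_atlas_transition : forall a b : chart A,
    smooth_on (coord a @` (dom a `&` dom b)) (transition a b) }.

Hypothesis HA : smooth_atlas.

Definition overlap a b : set 'rV[R]_m := coord a @` (dom a `&` dom b).

Lemma coord_inj a p q : dom a p -> dom a q -> coord a p = coord a q -> p = q.
Proof. by move=> ap aq; apply: smooth_atlas_inj; rewrite ?inE. Qed.

Lemma open_overlap a b : open (overlap a b).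
Proof. exact: smooth_atlas_overlap. Qed.
Arguments open_overlap : clear implicits.

Lemma chart_image_overlap a : chart_image a = overlap a a.
Proof. by rewrite /overlap setIid. Qed.

Lemma open_chart_image a : open (chart_image a).
Proof. by rewrite chart_image_overlap; exact: open_overlap. Qed.
Arguments open_chart_image : clear implicits.

Lemma overlap_coord a b p : dom a p -> dom b p -> overlap a b (coord a p).
Proof. by move=> ap bp; exists p. Qed.

Lemma chart_image_coord a p : dom a p -> chart_image a (coord a p).
Proof. by exists p. Qed.

Lemma local_exprE (W : pointedType) a (f : A -> W) p :
  dom a p -> local_expr a f (coord a p) = f p.
Proof.
move=> ap; rewrite /local_expr; apply: get_unique; first by exists p.
by move=> w [q [aq /(coord_inj aq ap) ->] <-].
Qed.

Lemma transitionE a b p : dom a p -> transition a b (coord a p) = coord b p.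
Proof. exact: local_exprE. Qed.

Lemma smooth_on_transition a b : smooth_on (overlap a b) (transition a b).
Proof. exact: smooth_atlas_transition. Qed.
Arguments smooth_on_transition : clear implicits.

Lemma differentiable_transition a b p : dom a p -> dom b p ->
  differentiable (transition a b) (coord a p).
Proof.
move=> ap bp.
exact: (smooth_on_differentiable (smooth_on_transition a b) (overlap_coord ap bp)).
Qed.

Lemma transition_overlap a b x : overlap a b x -> overlap b a (transition a b x).
Proof. by move=> [p [ap bp] <-]; rewrite transitionE//; exists p. Qed.

Lemma transition_derive_comp a b c p v : dom a p -> dom b p -> dom c p ->
  'D_('D_v (transition a b) (coord a p)) (transition b c) (coord b p) =
  'D_v (transition a c) (coord a p).
Proof.
move=> ap bp cp; rewrite -{1}(transitionE b ap) -derive_comp; first last.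
- by rewrite transitionE//; exact: differentiable_transition.
- exact: differentiable_transition.
apply: near_eq_derive.
have oab := open_overlap a b; have oac := open_overlap a c.
apply: filterS (open_nbhs_nbhs (conj (openI oab oac) (conj _ _))); try by exists p.
move=> x [[q [aq bq] <-] [r [ar cr] /(coord_inj ar aq) qr]]; subst r.
by rewrite /= !transitionE.
Qed.

Lemma derive_transition_id a p v : dom a p -> 'D_v (transition a a) (coord a p) = v.
Proof.
move=> ap; rewrite -[RHS](derive_id (coord a p) v); apply: near_eq_derive.
apply: filterS (open_nbhs_nbhs (conj (open_chart_image a) (chart_image_coord ap))).
by move=> x [q aq <-]; rewrite transitionE.
Qed.

Lemma jacobian_transition a b p v : dom a p -> dom b p ->
  v *m 'J (transition a b) (coord a p) = 'D_v (transition a b) (coord a p).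
Proof. by move=> ap bp; rewrite deriveEjacobian//; exact: differentiable_transition. Qed.

Lemma vector_field_transition (X : vfield A) a b p : is_vector_field X ->
  dom a p -> dom b p ->
  X b (coord b p) = 'D_(X a (coord a p)) (transition a b) (coord a p).
Proof. by move=> [_ hX] ap bp; rewrite (hX a b p)// jacobian_transition. Qed.

Lemma vector_field_of (X : vfield A) : (forall a, smooth_on (chart_image a) (X a)) ->
  (forall a b p, dom a p -> dom b p ->
    X b (coord b p) = 'D_(X a (coord a p)) (transition a b) (coord a p)) ->
  is_vector_field X.
Proof. by move=> sX tX; split=> // a b p ap bp; rewrite jacobian_transition//; exact: tX. Qed.

Lemma vf_add_field (X Y : vfield A) : is_vector_field X -> is_vector_field Y ->
  is_vector_field (vf_add X Y).
Proof.
move=> [sX tX] [sY tY]; split=> [a|a b p ap bp].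
  by apply: smooth_on_add => //; exact: open_chart_image.
by rewrite /vf_add (tX _ _ _ ap bp) (tY _ _ _ ap bp) mulmxDl.
Qed.

Lemma vf_scale_field f (X : vfield A) : smooth_fun f -> is_vector_field X ->
  is_vector_field (vf_scale f X).
Proof.
move=> sf [sX tX]; split=> [a|a b p ap bp].
  by apply: smooth_on_scale_mx => //; exact: open_chart_image.
by rewrite /vf_scale !local_exprE// (tX _ _ _ ap bp) scalemxAl.
Qed.

Lemma vf_zero_field : is_vector_field (vf_zero A).
Proof.
split=> [a|a b p ap bp]; first exact: smooth_on_cst.
by rewrite /vf_zero mul0mx.
Qed.

(** What extension by 0 outside the chart needs in order to be smooth at the
    points that the chart does not contain. *)
Definition vanishes_off (W : normedModType R) a (f : 'rV[R]_m -> W) : Prop :=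
  forall b q, dom b q -> ~ dom a q -> exists Q : set 'rV[R]_m,
    [/\ open Q, Q (coord b q) &
     forall p, dom a p -> dom b p -> Q (coord b p) -> f (coord a p) = 0].

Definition extend (W : normedModType R) a (f : 'rV[R]_m -> W) (p : A) : W :=
  if `[< dom a p >] then f (coord a p) else 0.

Lemma extendE (W : normedModType R) a (f : 'rV[R]_m -> W) p :
  dom a p -> extend a f p = f (coord a p).
Proof. by move=> ap; rewrite /extend asboolT. Qed.

Lemma extend_out (W : normedModType R) a (f : 'rV[R]_m -> W) p :
  ~ dom a p -> extend a f p = 0.
Proof. by move=> ap; rewrite /extend asboolF. Qed.

Lemma smooth_extend a (f : 'rV[R]_m -> R) :
  smooth_on (chart_image a) f -> vanishes_off a f -> smooth_fun (extend a f).
Proof.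
move=> fs f0 b; apply: smooth_on_local => _ [q bq <-].
have [aq|naq] := pselect (dom a q).
  exists (overlap b a); first by exists q.
  apply: (smooth_on_ext (f := fun x => f (transition b a x))).
  - exact: open_overlap.
  - by move=> _ [p [bp ap] <-]; rewrite transitionE// local_exprE// extendE.
  apply: smooth_on_comp (smooth_on_transition b a) fs.
  - exact: open_overlap.
  - by move=> _ [p [bp ap] <-]; rewrite transitionE//; exists p.
have [Q [oQ Qq Qf]] := f0 b q bq naq.
exists (Q `&` chart_image b); first by split => //; exists q.
apply: (smooth_on_ext (f := fun _ => 0)); last exact: smooth_on_cst.
  by apply: openI => //; exact: open_chart_image.
move=> x [Qx [p bp px]]; move: Qx; rewrite -px => Qp; rewrite local_exprE// /extend.
by case: asboolP => // ap; rewrite Qf.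
Qed.

Definition vextend a (X : 'rV[R]_m -> 'rV[R]_m) : vfield A :=
  fun b => local_expr b (fun p => extend a (fun x => X x *m 'J (transition a b) x) p).

Lemma vextendE a (X : 'rV[R]_m -> 'rV[R]_m) p : dom a p ->
  vextend a X a (coord a p) = X (coord a p).
Proof.
move=> ap; rewrite /vextend local_exprE// extendE// jacobian_transition//.
exact: derive_transition_id.
Qed.

Lemma vextend_coord a b (X : 'rV[R]_m -> 'rV[R]_m) p : dom a p -> dom b p ->
  vextend a X b (coord b p) = 'D_(X (coord a p)) (transition a b) (coord a p).
Proof.
move=> ap bp; rewrite /vextend local_exprE// (extendE _ ap).
exact: jacobian_transition.
Qed.

Lemma vextend_out a b (X : 'rV[R]_m -> 'rV[R]_m) p : ~ dom a p -> dom b p ->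
  vextend a X b (coord b p) = 0.
Proof. by move=> ap bp; rewrite /vextend local_exprE// (extend_out _ ap). Qed.

Lemma jacobian_entry (f : 'rV[R]_m -> 'rV[R]_m) x i j :
  differentiable f x -> 'J f x i j = pd i f x 0 j.
Proof. by move=> df; rewrite /pd deriveEjacobian// -rowE [RHS]mxE. Qed.

(** The chain rule for transition maps, [transition_derive_comp], is the
    transformation law of the extended field. *)
Lemma vextend_field a (X : 'rV[R]_m -> 'rV[R]_m) :
  smooth_on (chart_image a) X -> vanishes_off a X -> is_vector_field (vextend a X).
Proof.
move=> sX X0; apply: vector_field_of => [b|b c p bp cp].
  apply: smooth_on_local => _ [q bq <-].
  have [aq|naq] := pselect (dom a q).
    exists (overlap b a); first by exists q.
    apply: (smooth_on_ext (f := fun x => \row_j \sum_i X (transition b a x) 0 i *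
        pd i (transition a b) (transition b a x) 0 j)).
    - exact: open_overlap.
    - move=> _ [p [bp ap] <-]; rewrite transitionE// /vextend local_exprE// extendE//.
      apply/rowP => j; rewrite !mxE; apply: eq_bigr => i _.
      by rewrite jacobian_entry//; exact: differentiable_transition.
    have oba := open_overlap b a; have oab := open_overlap a b.
    apply/smooth_on_mxP => // i j; under eq_fun do rewrite mxE.
    apply: smooth_on_sum => // k _; apply: smooth_on_mul => //.
      have Xk : smooth_on (chart_image a) (fun x => X x 0 k).
        by have [h _] := smooth_on_mxP X (open_chart_image a); exact: h.
      apply: (smooth_on_comp oba _ (smooth_on_transition b a) Xk).
      by move=> _ [p [bp ap] <-]; rewrite transitionE//; exists p.
    have Jk : smooth_on (overlap a b) (fun x => pd k (transition a b) x 0 j).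
      have [h _] := smooth_on_mxP (pd k (transition a b)) (open_overlap a b).
      by apply: h; exact: smooth_on_pd (smooth_on_transition a b).
    apply: (smooth_on_comp oba _ (smooth_on_transition b a) Jk).
    by move=> x; exact: transition_overlap.
  have [Q [oQ Qq Qf]] := X0 b q bq naq.
  exists (Q `&` chart_image b); first by split => //; exists q.
  apply: (smooth_on_ext (f := fun _ => 0)); last exact: smooth_on_cst.
    by apply: openI => //; exact: open_chart_image.
  move=> x [Qx [p bp px]]; move: Qx; rewrite -px => Qp; rewrite /vextend local_exprE// /extend.
  by case: asboolP => // ap; rewrite Qf// mul0mx.
have [ap|nap] := pselect (dom a p).
  have Eb := vextend_coord X ap bp; have Ec := vextend_coord X ap cp.
  move: (vextend a X b (coord b p)) (vextend a X c (coord c p)) Eb Ec => _ _ -> ->.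
  by rewrite transition_derive_comp.
have Eb := vextend_out X nap bp; have Ec := vextend_out X nap cp.
move: (vextend a X b (coord b p)) (vextend a X c (coord c p)) Eb Ec => _ _ -> ->.
by rewrite derive0.
Qed.

End SmoothAtlas.
Arguments open_overlap {R m A} HA a b.
Arguments open_chart_image {R m A} HA a.
Arguments smooth_on_transition {R m A} HA a b.

(** * Connections in a coordinate frame *)

Section Connection.
Variables (R : realType) (m : nat) (A : atlas R m).
Hypothesis HA : smooth_atlas A.
Variable nabla : vfield A -> vfield A -> vfield A.
Hypothesis Hn : is_connection nabla.
Implicit Types (a b : chart A) (p q : A) (X Y : vfield A).

Definition vf_comb (J : Type) (r : seq J) (f : J -> A -> R) (E : J -> vfield A) : vfield A :=
  fun a x => \sum_(k <- r) local_expr a (f k) x *: E k a x.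

Lemma vf_comb_cons (J : Type) k (r : seq J) f E :
  vf_comb (k :: r) f E = vf_add (vf_scale (f k) (E k)) (vf_comb r f E).
Proof.
by apply/funext => a; apply/funext => x; rewrite /vf_comb big_cons.
Qed.

Lemma vf_comb_nil (J : Type) (f : J -> A -> R) E : vf_comb [::] f E = vf_zero A.
Proof. by apply/funext => a; apply/funext => x; rewrite /vf_comb big_nil. Qed.

Lemma vf_comb_field (J : Type) (r : seq J) f E :
  (forall k, smooth_fun (f k)) -> (forall k, is_vector_field (E k)) ->
  is_vector_field (vf_comb r f E).
Proof.
move=> sf vE; elim: r => [|k r IH].
  by rewrite vf_comb_nil; exact: vf_zero_field.
by rewrite vf_comb_cons; apply: vf_add_field => //; exact: vf_scale_field.
Qed.

Lemma vf_zero_add : vf_add (vf_zero A) (vf_zero A) = vf_zero A.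
Proof. by apply/funext => a; apply/funext => x; rewrite /vf_add /vf_zero addr0. Qed.

Lemma connection_zeror X : is_vector_field X -> field_eq (nabla X (vf_zero A)) (vf_zero A).
Proof.
move=> vX a x ax; have vz := @vf_zero_field _ _ A.
have := connection_addr Hn vX vz vz ax; rewrite vf_zero_add /vf_add => h.
by apply: (addrI (nabla X (vf_zero A) a x)); rewrite -h /vf_zero addr0.
Qed.

Lemma connection_zerol X : is_vector_field X -> field_eq (nabla (vf_zero A) X) (vf_zero A).
Proof.
move=> vX a x ax; have vz := @vf_zero_field _ _ A.
have := connection_addl Hn vz vz vX ax; rewrite vf_zero_add /vf_add => h.
by apply: (addrI (nabla (vf_zero A) X a x)); rewrite -h /vf_zero addr0.
Qed.

Lemma connection_combr (J : Type) (r : seq J) f E X : is_vector_field X ->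
  (forall k, smooth_fun (f k)) -> (forall k, is_vector_field (E k)) ->
  forall a x, chart_image a x ->
  nabla X (vf_comb r f E) a x =
  \sum_(k <- r) ('D_(X a x) (local_expr a (f k)) x *: E k a x +
                 local_expr a (f k) x *: nabla X (E k) a x).
Proof.
move=> vX sf vE a x ax; elim: r => [|k r IH].
  by rewrite vf_comb_nil big_nil (connection_zeror vX ax).
rewrite vf_comb_cons big_cons -IH.
have vk := vf_scale_field HA (sf k) (vE k).
by rewrite (connection_addr Hn vX vk (vf_comb_field r sf vE) ax) /vf_add
  (connection_leibniz Hn (sf k) vX (vE k) ax).
Qed.

Lemma connection_combl (J : Type) (r : seq J) f E Y : is_vector_field Y ->
  (forall k, smooth_fun (f k)) -> (forall k, is_vector_field (E k)) ->
  forall a x, chart_image a x ->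
  nabla (vf_comb r f E) Y a x =
  \sum_(k <- r) local_expr a (f k) x *: nabla (E k) Y a x.
Proof.
move=> vY sf vE a x ax; elim: r => [|k r IH].
  by rewrite vf_comb_nil big_nil (connection_zerol vY ax).
rewrite vf_comb_cons big_cons -IH.
have vk := vf_scale_field HA (sf k) (vE k).
by rewrite (connection_addl Hn vk (vf_comb_field r sf vE) vY ax) /vf_add
  (connection_scalel Hn (sf k) (vE k) vY ax).
Qed.

Section Local.
Variables (a : chart A) (p : A) (psi : A -> R).
Hypotheses (ap : dom a p) (spsi : smooth_fun psi) (psip : psi p = 1).

Lemma vf_scale_eq Y Y' : is_vector_field Y -> is_vector_field Y' ->
  (forall q, psi q <> 0 -> dom a q /\ Y a (coord a q) = Y' a (coord a q)) ->
  field_eq (vf_scale psi Y) (vf_scale psi Y').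
Proof.
move=> vY vY' YY b _ [q bq <-]; rewrite /vf_scale (local_exprE HA)//.
have [->|/YY [aq YYq]] := pselect (psi q = 0); first by rewrite !scale0r.
have Eb := vector_field_transition HA vY aq bq.
have Eb' := vector_field_transition HA vY' aq bq.
move: (Y b (coord b q)) (Y' b (coord b q)) Eb Eb' => _ _ -> ->.
by rewrite YYq.
Qed.

(** [psi Y] and [psi Y'] agree everywhere, hence so do their covariant
    derivatives.  At [p], where [psi] is 1, the Leibniz rule writes these as
    the derivatives of [Y] and [Y'] plus the same multiple of the equal
    vectors [Y p] and [Y' p]. *)
Lemma connection_localr X Y Y' : is_vector_field X -> is_vector_field Y -> is_vector_field Y' ->
  (forall q, psi q <> 0 -> dom a q /\ Y a (coord a q) = Y' a (coord a q)) ->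
  nabla X Y a (coord a p) = nabla X Y' a (coord a p).
Proof.
move=> vX vY vY' YY; have ax := chart_image_coord ap.
have [_ YYp] : dom a p /\ Y a (coord a p) = Y' a (coord a p).
  by apply: YY; rewrite psip; apply/eqP; rewrite oner_eq0.
have sY := vf_scale_field HA spsi vY; have sY' := vf_scale_field HA spsi vY'.
have h := connection_eq Hn vX vX sY sY' (fun _ _ _ => erefl) (vf_scale_eq vY vY' YY) ax.
have E := connection_leibniz Hn spsi vX vY ax.
have E' := connection_leibniz Hn spsi vX vY' ax.
move: E E'; rewrite h => -> /=; rewrite /vf_add /vf_scale (local_exprE HA)// psip !scale1r YYp.
by move/addrI.
Qed.

Lemma connection_locall X X' Y : is_vector_field X -> is_vector_field X' -> is_vector_field Y ->
  (forall q, psi q <> 0 -> dom a q /\ X a (coord a q) = X' a (coord a q)) ->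
  nabla X Y a (coord a p) = nabla X' Y a (coord a p).
Proof.
move=> vX vX' vY XX; have ax := chart_image_coord ap.
have sX := vf_scale_field HA spsi vX; have sX' := vf_scale_field HA spsi vX'.
have h := connection_eq Hn sX sX' vY vY (vf_scale_eq vX vX' XX) (fun _ _ _ => erefl) ax.
have E := connection_scalel Hn spsi vX vY ax.
have E' := connection_scalel Hn spsi vX' vY ax.
by move: E E'; rewrite h => ->; rewrite /vf_scale (local_exprE HA)// psip !scale1r.
Qed.

Variables (V : set 'rV[R]_m) (E : 'I_m -> vfield A).
Hypotheses (oV : open V) (Vp : V (coord a p)).
Hypothesis vE : forall k, is_vector_field (E k).
Hypothesis EV : forall k q, dom a q -> V (coord a q) -> E k a (coord a q) = delta_mx 0 k.
Hypothesis psiV : forall q, psi q <> 0 -> dom a q /\ V (coord a q).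
Hypothesis extV : forall h, smooth_on (chart_image a) h -> exists2 f : A -> R,
  smooth_fun f & forall q, dom a q -> V (coord a q) -> f q = h (coord a q).

Lemma frame_comb X : is_vector_field X -> exists2 f : 'I_m -> A -> R,
  (forall k, smooth_fun (f k)) &
  forall k q, dom a q -> V (coord a q) -> f k q = X a (coord a q) 0 k.
Proof.
move=> [sX _].
have H k : exists f : A -> R, smooth_fun f /\
    forall q, dom a q -> V (coord a q) -> f q = X a (coord a q) 0 k.
  have [|f sf fE] := extV (h := fun x => X a x 0 k).
    by have [h _] := smooth_on_mxP (X a) (open_chart_image HA a); exact: h.
  by exists f.
have [f fP] := choice H; exists f => k; first by have [] := fP k.
by move=> q; have [_] := fP k; apply.
Qed.

Lemma frame_combE X f : is_vector_field X -> (forall k, smooth_fun (f k)) ->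
  (forall k q, dom a q -> V (coord a q) -> f k q = X a (coord a q) 0 k) ->
  forall q, psi q <> 0 -> dom a q /\ X a (coord a q) = vf_comb (index_enum 'I_m) f E a (coord a q).
Proof.
move=> vX sf fE q /psiV [aq Vq]; split => //.
rewrite [LHS]row_sum_delta /vf_comb; apply: eq_bigr => k _.
by rewrite (local_exprE HA)// fE// EV.
Qed.

(** Coefficients of fields are cut off so as to be functions on the whole
    manifold; by locality both fields may then be replaced by combinations of
    the frame, to which the axioms of a connection apply.  The vectors
    [nabla (E i) (E j)] are the Christoffel symbols, since [E] is the
    coordinate frame near [p]. *)
Lemma connection_frame X Y : is_vector_field X -> is_vector_field Y ->
  nabla X Y a (coord a p) = 'D_(X a (coord a p)) (Y a) (coord a p) +
    \sum_i \sum_j (X a (coord a p) 0 i * Y a (coord a p) 0 j) *: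
      nabla (E i) (E j) a (coord a p).
Proof.
move=> vX vY; have ax := chart_image_coord ap.
have [fX sfX fXE] := frame_comb vX; have [fY sfY fYE] := frame_comb vY.
have vfX := vf_comb_field (index_enum 'I_m) sfX vE.
have vfY := vf_comb_field (index_enum 'I_m) sfY vE.
rewrite (connection_localr vX vY vfY (frame_combE vY sfY fYE)).
rewrite (connection_combr _ vX sfY vE ax) big_split /=; congr (_ + _).
  rewrite [RHS]row_sum_delta; apply: eq_bigr => k _; rewrite EV//; congr (_ *: _).
  rewrite derive_mxE; last first.
    by have [sY _] := vY; exact: (smooth_on_differentiable (sY a)).
  apply: near_eq_derive.
  apply: filterS (open_nbhs_nbhs (conj (openI oV (open_chart_image HA a)) (conj Vp ax))).
  by move=> x [Vx [q aq qx]]; move: Vx; rewrite -qx => Vq; rewrite (local_exprE HA)// fYE.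
rewrite exchange_big; apply: eq_bigr => j _ /=.
rewrite (connection_locall vX vfX (vE j) (frame_combE vX sfX fXE)).
rewrite (connection_combl _ (vE j) sfX vE ax) scaler_sumr; apply: eq_bigr => i _.
by rewrite !(local_exprE HA)// fXE// fYE// scalerA mulrC.
Qed.

End Local.
End Connection.

(** * Cutoff functions on a manifold *)

Section ManifoldBump.
Variables (R : realType) (n : nat) (M : atlas R n).
Hypothesis HM : is_manifold M.

Lemma manifold_smooth_atlas : smooth_atlas M.
Proof.
split; [exact: chart_inj HM|exact: overlap_open HM|exact: transition_smooth HM].
Qed.
Let HA := manifold_smooth_atlas.

(** Compact sets are closed in a Hausdorff space: a point outside the chart
    has a neighbourhood that avoids [K]. *)
Lemma compact_vanishes_off (a : chart M) (K : set 'rV[R]_n) (f : 'rV[R]_n -> R) :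
  compact K -> K `<=` chart_image a -> (forall x, ~ K x -> f x = 0) -> vanishes_off (A := M) a f.
Proof.
move=> cK Ka f0 b q bq naq.
have sep k : exists UV : set M * set M,
    K k -> [/\ mopen UV.1, mopen UV.2, (coord a @` (dom a `&` UV.1)) k, UV.2 q & UV.1 `&` UV.2 = set0].
  have [Kk|nKk] := pselect (K k); last by exists (set0, set0).
  have [pk apk pkk] := Ka _ Kk.
  have pkq : pk <> q by move=> pq; apply: naq; rewrite -pq.
  have [U [V [mU mV Up Vq UV0]]] := manifold_hausdorff HM pkq.
  by exists (U, V) => _; split => //; exists pk.
have [UV UVP] := choice sep.
have fop k : K k -> open (coord a @` (dom a `&` (UV k).1)).
  by move=> Kk; have [mU _ _ _ _] := UVP k Kk; exact: mU.
have Kcov : K `<=` cover K (fun k => coord a @` (dom a `&` (UV k).1)).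
  by move=> k Kk; exists k => //; have [_ _ h _ _] := UVP k Kk.
move: cK; rewrite compact_cover => /(_ _ K _ fop Kcov) [D DK Dcov].
pose Vb k := coord b @` (dom b `&` (UV k).2).
exists (\bigcap_(k in [set` D]) Vb k)°; split.
- exact: open_interior.
- suff h : nbhs (coord b q) (\bigcap_(k in [set` D]) Vb k) by exact: h.
  apply: filter_bigI => k /DK; rewrite inE => Kk.
  have [_ mV _ Vq _] := UVP k Kk.
  by apply: open_nbhs_nbhs; split; [exact: mV|exists q].
- move=> p ap bp /interior_subset pV; apply: f0 => Kp.
  have [k /= kD [p' [ap' Up'] pp']] := Dcov _ Kp.
  have [p'' [bp'' Vp''] pp''] := pV k kD.
  have ep : p' = p by exact: (coord_inj HA ap' ap pp').
  have eq : p'' = p by exact: (coord_inj HA bp'' bp pp'').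
  subst p' p''.
  have /DK := kD; rewrite inE => /UVP [_ _ _ _] UV0.
  by have : ((UV k).1 `&` (UV k).2) p by []; rewrite UV0.
Qed.

Lemma cutoff_exists (a : chart M) p (V : set 'rV[R]_n) : dom a p -> open V -> V (coord a p) ->
  exists phi : 'rV[R]_n -> R, [/\ smooth_on setT phi, vanishes_off (A := M) a phi,
    \forall x \near coord a p, phi x = 1 & forall x, phi x <> 0 -> V x /\ chart_image a x].
Proof.
move=> ap oV Vp.
have : nbhs (coord a p) (V `&` chart_image a).
  apply: open_nbhs_nbhs; split; last by split => //; exists p.
  by apply: openI => //; exact: open_chart_image.
move=> /nbhs_ballP [r /= r0 rV].
have r20 : 0 < r / 2 by rewrite divr_gt0.
have [phi [sphi phi1 phi0]] := plateau_exists (coord a p) r20.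
have KV x : `|coord a p - x| <= r / 2 -> (V `&` chart_image a) x.
  move=> xr; apply: rV; rewrite -ball_normE /=; apply: (le_lt_trans xr).
  by rewrite ltr_pdivrMr// ltr_pMr// ltr1n.
exists phi; split => //.
- apply: (@compact_vanishes_off a [set x | `|coord a p - x| <= r / 2]).
  + rewrite (_ : [set x | _] = closed_ball_ Num.norm (coord a p) (r / 2)) //.
    rewrite -closed_ballE//.
    apply: bounded_closed_compact; last exact: closed_ball_closed.
    exists (`|coord a p| + r / 2); split; first exact: num_real.
    move=> s ms x; rewrite closed_ballE// /closed_ball_ /= => xr.
    apply: ltW; apply: le_lt_trans ms.
    rewrite -[x in `|x|](subKr (coord a p)).
    by apply: (le_trans (ler_normB _ _)); rewrite lerD2l.
  + by move=> x /KV[].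
  + by move=> x /negP; rewrite -ltNge; exact: phi0.
- by move=> x phix; apply: KV; rewrite leNgt; apply/negP => /phi0.
Qed.

End ManifoldBump.

(** * Curves with a given 2-jet *)

Section CurveCalculus.
Variable R : realType.
Let e1 := (fun _ : unit => 1 : R).

Lemma derive1_fun (W : normedModType R) (f : R -> W) : derive1 f = 'D_1 f.
Proof. by apply/funext => t; rewrite derive1E. Qed.

Lemma derive1n1E (W : normedModType R) (f : R -> W) t : derive1n 1 f t = 'D_1 f t.
Proof. by rewrite derive1n1 derive1E. Qed.

Lemma derive1n2E (W : normedModType R) (f : R -> W) t : derive1n 2 f t = 'D_1 ('D_1 f) t.
Proof. by rewrite derive1nS derive1n1 derive1E derive1_fun. Qed.

Lemma Ck_on_derive1n (W : normedModType R) (U : set R) (f : R -> W) k t :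
  (forall N, Ck_on (V := R) e1 N U f) -> U t -> derivable (derive1n k f) t 1.
Proof.
move=> cf Ut; apply/derivable1_diffP.
have [_ h] := @smooth_Ck_on _ _ _ e1 W U f.
have := h cf (nseq k tt) t Ut.
rewrite (_ : foldr _ f (nseq k tt) = derive1n k f)//.
by elim: k => [//|k IH]; rewrite derive1nS /= IH derive1_fun.
Qed.

Lemma sin_cos_Ck_on N : Ck_on (V := R) e1 N setT (@sin R) /\ Ck_on (V := R) e1 N setT (@cos R).
Proof.
have oT : open (setT : set R) := openT.
have ds x : setT x -> differentiable (@sin R) x.
  by move=> _; apply/derivable1_diffP; have := is_derive_sin x => -[].
have dc x : setT x -> differentiable (@cos R) x.
  by move=> _; apply/derivable1_diffP; have := is_derive_cos x => -[].
elim: N => [|N [IHs IHc]]; first by do 2 split.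
split.
- apply: (@Ck_onS _ _ _ _ _ _ _ _ (fun _ : unit => @cos R)) => //.
  by move=> i x _; have := is_derive_sin x => -[].
- apply: (@Ck_onS _ _ _ _ _ _ _ _ (fun _ : unit => (fun x : R => (-1) * sin x) : R -> R)) => //.
    by move=> i x _; rewrite mulN1r; have := is_derive_cos x => -[].
  by move=> i; apply: Ck_on_mul => //; exact: Ck_on_cst.
Qed.

(** Bounded by [k^-1], but equal to t + O(t^3) at 0: a curve reparametrized by
    it is confined to a small ball and keeps its 2-jet. *)
Definition osc (k t : R) : R := k^-1 * sin (k * t).

Lemma is_derive_kt k (t : R) : is_derive t 1 (fun t : R => k * t) k.
Proof.
have h : differentiable (fun t : R => t) t by exact: ex_diff.
apply: DeriveDef; first exact/diff_derivable/differentiableZ.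
by rewrite derive_cmulf// derive_id mulr1.
Qed.

Lemma osc_derive k (t : R) : k != 0 -> is_derive t 1 (osc k) (cos (k * t)).
Proof.
move=> k0; have := is_derive1_comp (is_derive_sin (k * t)) (is_derive_kt k t) => ds.
have dsin : differentiable (fun t => sin (k * t)) t.
  by apply/derivable1_diffP; case: ds.
apply: DeriveDef; first exact/diff_derivable/differentiableZ.
rewrite derive_cmulf//; have -> : 'D_1 (fun t => sin (k * t)) t = cos (k * t) * k by case: ds.
by rewrite mulrCA mulVf// mulr1.
Qed.

Lemma cos_derive k (t : R) : is_derive t 1 (fun t => cos (k * t)) (- sin (k * t) * k).
Proof. exact: is_derive1_comp (is_derive_cos (k * t)) (is_derive_kt k t). Qed.

Lemma osc_Ck_on k N : Ck_on (V := R) e1 N setT (osc k).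
Proof.
have oT : open (setT : set R) := openT.
apply: Ck_on_mul => //; first exact: Ck_on_cst.
apply: (Ck_on_compR (U' := setT) (f := fun t => k * t) oT _ _ (sin_cos_Ck_on N).1) => //.
by apply: Ck_on_mul => //; [exact: Ck_on_cst|exact: Ck_on_id].
Qed.

Lemma osc0 k : osc k 0 = 0.
Proof. by rewrite /osc mulr0 sin0 mulr0. Qed.

Lemma osc_le k t : 0 < k -> `|osc k t| <= k^-1.
Proof.
move=> k0; rewrite /osc normrM gtr0_norm ?invr_gt0// ler_piMr ?invr_ge0 ?(ltW k0)//.
by rewrite ler_norml sin_geN1 sin_le1.
Qed.

Opaque osc.
Section Parabola.
Variables (n : nat) (k : R) (x y z : 'rV[R]_n).
Hypothesis k0 : 0 < k.

Definition parabola (t : R) : 'rV[R]_n := x + osc k t *: y + (osc k t * osc k t) *: z.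

Lemma parabolaE i j t : parabola t i j = x i j + osc k t * y i j + osc k t * osc k t * z i j.
Proof. by rewrite !mxE. Qed.

Lemma parabola_Ck_on N : Ck_on (V := R) e1 N setT parabola.
Proof.
have oT : open (setT : set R) := openT.
apply/Ck_on_mx => // i j; under eq_fun do rewrite parabolaE.
have o := osc_Ck_on k N.
apply: Ck_on_add => //; first apply: Ck_on_add => //.
- exact: Ck_on_cst.
- by apply: Ck_on_mul => //; exact: Ck_on_cst.
- by apply: Ck_on_mul => //; [exact: Ck_on_mul|exact: Ck_on_cst].
Qed.

Lemma parabola0 : parabola 0 = x.
Proof. by rewrite /parabola osc0 mul0r !scale0r !addr0. Qed.

Let kn : k != 0. Proof. by rewrite gt_eqF. Qed.
Let dos t : differentiable (osc k) t.
Proof. by apply/derivable1_diffP; case: (osc_derive t kn). Qed.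
Let dco t : differentiable (fun t => cos (k * t)) t.
Proof. by apply/derivable1_diffP; case: (cos_derive k t). Qed.
Let Dos t : 'D_1 (osc k) t = cos (k * t).
Proof. by case: (osc_derive t kn). Qed.
Let Dco t : 'D_1 (fun t => cos (k * t)) t = - sin (k * t) * k.
Proof. by case: (cos_derive k t). Qed.

Lemma parabola_derive t :
  'D_1 parabola t = cos (k * t) *: y + (2 * (osc k t * cos (k * t))) *: z.
Proof.
apply/matrixP => i j; rewrite derive_mxE; last first.
  by have [h _] := parabola_Ck_on 0; exact: h.
under eq_fun do rewrite parabolaE.
have h1 : differentiable (fun t => osc k t * y i j) t by exact: differentiableM.
have h2 : differentiable (fun t => osc k t * osc k t) t by exact: differentiableM.
have h3 : differentiable (fun t => osc k t * osc k t * z i j) t by exact: differentiableM.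
rewrite derive_addf//; last exact: differentiableD.
rewrite derive_addf// derive_cst 3?derive_mulf// !Dos !derive_cst !mxE.
by ring.
Qed.

Lemma parabola_derive2 : 'D_1 ('D_1 parabola) 0 = 2 *: z.
Proof.
have oT : open (setT : set R) := openT.
have [_ /(_ tt) [h _]] := parabola_Ck_on 1.
apply/matrixP => i j; rewrite derive_mxE; last exact: h.
under eq_fun do rewrite parabola_derive !mxE.
have h1 t : differentiable (fun t => cos (k * t) * y i j) t by exact: differentiableM.
have h2 t : differentiable (fun t => osc k t * cos (k * t)) t by exact: differentiableM.
have h3 t : differentiable (fun t => 2 * (osc k t * cos (k * t))) t by exact: differentiableM.
have h4 t : differentiable (fun t => 2 * (osc k t * cos (k * t)) * z i j) t by exact: differentiableM.
rewrite derive_addf// 4?derive_mulf// Dos Dco !derive_cst osc0 !mulr0 sin0 cos0 !mxE.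
by ring.
Qed.

Lemma parabola_near t : 1 <= k -> `|x - parabola t| <= (`|y| + `|z|) / k.
Proof.
move=> k1; rewrite /parabola -addrA opprD addNKr normrN.
apply: (le_trans (ler_normD _ _)); rewrite (normrZ _ y) (normrZ _ z) [X in _ <= X]mulrC mulrDr.
have ok := osc_le t k0; move: (osc k t) ok => o ok.
apply: lerD; apply: ler_wpM2r => //.
rewrite normrM; apply: (le_trans _ ok); apply: ler_piMr => //.
by apply: (le_trans ok); rewrite invf_le1.
Qed.

End Parabola.
End CurveCalculus.

(** * The charts of the second-order tangent bundle *)

Opaque derive1n.
Section T2Atlas.
Variables (R : realType) (n : nat) (M : atlas R n).
Hypothesis HA : smooth_atlas M.
Implicit Types (a b : chart M) (j : T2_pt M) (F G : R -> M).

Definition jet_coord a F : 'rV[R]_(n + n + n) :=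
  xyz (coord a (F 0)) (derive1n 1 (coord a \o F) 0) (2^-1 *: derive1n 2 (coord a \o F) 0).

(** The transition maps of [T2 M] are the prolongations of those of [M]. *)
Definition prolong (f : 'rV[R]_n -> 'rV[R]_n) (w : 'rV[R]_(n + n + n)) :=
  xyz (f (xpart w)) (lift1 f w) (lift2 f w).

Lemma xyz_inj (x y z x' y' z' : 'rV[R]_n) : xyz x y z = xyz x' y' z' ->
  [/\ x = x', y = y' & z = z'].
Proof. by move=> /eq_row_mx [/eq_row_mx [-> ->] ->]. Qed.

Lemma same_2jet_refl F : same_2jet F F. Proof. by split. Qed.

Lemma same_2jet_sym F G : same_2jet F G -> same_2jet G F.
Proof.
move=> [FG h]; split; [exact: esym FG|move=> a; rewrite -FG => /h [e1 e2]].
exact: (conj (esym e1) (esym e2)).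
Qed.

Lemma same_2jet_trans F G K : same_2jet F G -> same_2jet G K -> same_2jet F K.
Proof.
move=> [FG h] [GK k]; split; first by rewrite FG.
move=> a aF; have [e1 e2] := h a aF.
have aG : dom a (G 0) by rewrite -FG.
have [e3 e4] := k a aG.
exact: (conj (etrans e1 e3) (etrans e2 e4)).
Qed.

Lemma same_2jet_coord a F G : same_2jet F G -> dom a (F 0) -> jet_coord a F = jet_coord a G.
Proof.
move=> [FG h] aF; have [e1 e2] := h a aF.
rewrite /jet_coord.
exact: (f_equal3 (@xyz R n) (congr1 (coord a) FG) e1 (congr1 (GRing.scale 2^-1) e2)).
Qed.

Lemma T2_rep j : exists F, [/\ sval j F, smooth_curve F & sval j = jet2 F].
Proof. by case: j => j [F [sF jF]]; exists F; split => //=; rewrite jF; split. Qed.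

Definition rep j : R -> M := sval (cid (T2_rep j)).

Lemma rep_in j : sval j (rep j). Proof. by rewrite /rep; case: cid => F []. Qed.
Lemma rep_smooth j : smooth_curve (rep j). Proof. by rewrite /rep; case: cid => F []. Qed.
Lemma repE j : sval j = jet2 (rep j). Proof. by rewrite {1}/rep; case: cid => F []. Qed.

Definition base j : M := rep j 0.

Lemma rep_same j F : sval j F -> same_2jet (rep j) F.
Proof. by rewrite repE => -[]. Qed.

Lemma T2_domE a j : T2_dom a j <-> dom a (base j).
Proof.
split; first by move=> [F jF aF]; rewrite /base; have [-> _] := rep_same jF.
by move=> aj; exists (rep j) => //; exact: rep_in.
Qed.

Lemma T2_coordE a j : T2_dom a j -> T2_coord a j = jet_coord a (rep j).
Proof.
move=> /T2_domE aj; apply: get_unique; first by exists (rep j) => //; exact: rep_in.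
by move=> w [F jF <-]; rewrite (same_2jet_coord (rep_same jF)).
Qed.

Lemma xpart_T2_coord a j : T2_dom a j -> xpart (T2_coord a j) = coord a (base j).
Proof. by move=> aj; rewrite T2_coordE// xpart_xyz. Qed.

Lemma curve_derivable F a k t : smooth_curve F -> dom a (F t) ->
  derivable (derive1n k (coord a \o F)) t 1.
Proof. by move=> sF; have [_] := sF a; apply. Qed.
Arguments curve_derivable {F a} k {t}.

(** In the second chart the curve is [transition a b] composed with its
    expression in the first one, so this is the chain rule; the factor 1/2 in
    the [z] coordinate is the one in [lift2]. *)
Lemma jet_coord_change a b F : smooth_curve F -> dom a (F 0) -> dom b (F 0) ->
  jet_coord b F = prolong (transition a b) (jet_coord a F).
Proof.
move=> sF aF bF; rewrite /prolong.
pose f := coord a \o F; pose U := (F @^-1` dom a) `&` (F @^-1` dom b).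
have oU : open U by apply: openI; [have [] := sF a|have [] := sF b].
have U0 : U 0 by [].
have df t : U t -> differentiable f t.
  move=> [at_ _]; apply/derivable1_diffP.
  by have := curve_derivable 0 sF at_; rewrite derive1n0.
have ddf t : U t -> differentiable ('D_1 f) t.
  move=> [at_ _]; apply/derivable1_diffP.
  by have := curve_derivable 1 sF at_; rewrite derive1n1 derive1_fun.
have dg t : U t -> differentiable (coord b \o F) t.
  move=> [_ bt]; apply/derivable1_diffP.
  by have := curve_derivable 0 sF bt; rewrite derive1n0.
have ddg t : U t -> differentiable ('D_1 (coord b \o F)) t.
  move=> [_ bt]; apply/derivable1_diffP.
  by have := curve_derivable 1 sF bt; rewrite derive1n1 derive1_fun.
have fU t : U t -> overlap a b (f t) by move=> [at_ bt]; exists (F t).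
have ts := smooth_on_transition HA a b.
have tsj l : smooth_on (overlap a b) (fun x => transition a b x 0 l).
  by have [h _] := smooth_on_mxP (transition a b) (open_overlap HA a b); exact: h.
have E t l : U t -> (coord b \o F) t 0 l = transition a b (f t) 0 l.
  by move=> [at_ bt]; rewrite /f /= (transitionE HA).
have D1 t l : U t -> 'D_1 (coord b \o F) t 0 l = 'D_1 (fun t => transition a b (f t) 0 l) t.
  move=> Ut; rewrite derive_mxE//; last exact: dg.
  by apply: near_eq_derive; apply: filterS (open_nbhs_nbhs (conj oU Ut)) => s Us; exact: E.
set w := jet_coord a F.
have xw : xpart w = f 0 by rewrite xpart_xyz.
have yw : ypart w = 'D_1 f 0 by rewrite ypart_xyz derive1n1E.
have zw : zpart w = 2^-1 *: 'D_1 ('D_1 f) 0 by rewrite zpart_xyz derive1n2E.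
have Uw : overlap a b (xpart w) by rewrite xw; exact: fU.
have oo := open_overlap HA a b.
have R1 l : lift1 (transition a b) w 0 l = lift1 (fun x => transition a b x 0 l) w.
  exact: (@jet_mxE _ _ _ _ _ (transition a b) 1 w 0 l oo ts Uw).
have R2 l : lift2 (transition a b) w 0 l = lift2 (fun x => transition a b x 0 l) w.
  exact: (@jet_mxE _ _ _ _ _ (transition a b) 0 w 0 l oo ts Uw).
rewrite /jet_coord; congr xyz.
- by rewrite xw /f /= (transitionE HA).
- apply/rowP => l; rewrite derive1n1E D1// (derive_comp_rV fU df (tsj l))//.
  by rewrite R1 /lift1 yw xw.
- apply/rowP => l; rewrite derive1n2E mxE derive_mxE; last exact: ddg.
  rewrite (_ : 'D_(1 : R) (fun t : R => 'D_(1 : R) (coord b \o F) t 0 l) 0 =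
      'D_(1 : R) ('D_(1 : R) (fun t : R => transition a b (f t) 0 l)) 0); last first.
    by apply: near_eq_derive; apply: filterS (open_nbhs_nbhs (conj oU U0)) => s Us; exact: D1.
  rewrite R2 /lift2 zw yw xw (derive2_comp_rV oU fU df (tsj l))//; last exact: ddf.
  rewrite mulrDr; congr (_ + _).
  by rewrite mulr_sumr; apply: eq_bigr => i _; rewrite mxE mulrA.
Qed.

Lemma T2_transition_coord a b j : T2_dom a j -> T2_dom b j ->
  T2_coord b j = prolong (transition a b) (T2_coord a j).
Proof.
move=> aj bj; rewrite (T2_coordE aj) (T2_coordE bj).
apply: jet_coord_change; [exact: rep_smooth|exact/T2_domE|exact/T2_domE].
Qed.

Lemma jet_coord_inj a F G : smooth_curve F -> smooth_curve G -> dom a (F 0) -> dom a (G 0) ->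
  jet_coord a F = jet_coord a G -> same_2jet F G.
Proof.
move=> sF sG aF aG FGa.
have [/(coord_inj HA aF aG) FG _ _] := xyz_inj FGa.
split; first exact: FG.
move=> b bF; have bG : dom b (G 0) by rewrite -FG.
have : jet_coord b F = jet_coord b G.
  by rewrite (jet_coord_change sF aF bF) (jet_coord_change sG aG bG) FGa.
move=> /xyz_inj [_ e1 e2]; split; first exact: e1.
have h2 : (2^-1 : R) != 0 by rewrite invr_eq0 pnatr_eq0.
exact: (scalerI h2 e2).
Qed.

(** Equality of 2-jets in one chart implies it in all charts, as the
    coordinates in the others are computed by [prolong]. *)
Lemma T2_coord_inj a j j' : T2_dom a j -> T2_dom a j' -> T2_coord a j = T2_coord a j' -> j = j'.
Proof.
move=> aj aj' jj'.
have h : same_2jet (rep j) (rep j').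
  have E : jet_coord a (rep j) = jet_coord a (rep j').
    exact: (etrans (esym (T2_coordE aj)) (etrans jj' (T2_coordE aj'))).
  apply: jet_coord_inj E; [exact: rep_smooth|exact: rep_smooth|exact/T2_domE|exact/T2_domE].
have : sval j = sval j'.
  rewrite !repE; apply/seteqP; split => F [sF FF]; split; try exact: sF.
    exact: (same_2jet_trans (same_2jet_sym h) FF).
  exact: (same_2jet_trans h FF).
case: j j' {aj aj' h jj'} => [j jP] [j' jP'] /= jj'; subst j'; congr exist; exact: Prop_irrelevance.
Qed.

(** Curves are defined on all of R, so the parabola [x + t y + t^2 z] has to be
    reparametrized by [osc] to stay in the chart. *)
Lemma curve_exists a (w : 'rV[R]_(n + n + n)) : chart_image a (xpart w) ->
  exists F, [/\ smooth_curve F, dom a (F 0) & jet_coord a F = w].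
Proof.
move=> aw; set x := xpart w; set y := ypart w; set z := zpart w.
have : nbhs x (chart_image a).
  by apply: open_nbhs_nbhs; split => //; exact: (open_chart_image HA).
move=> /nbhs_ballP [r /= r0 ra].
(* The curve stays at distance at most (|y| + |z|) / k < r of [x]. *)
pose k := (`|y| + `|z|) / r + 1.
have yz : 0 <= (`|y| + `|z|) / r by rewrite divr_ge0// ?addr_ge0// ltW.
have k1 : 1 <= k by rewrite lerDr.
have k0 : 0 < k by exact: lt_le_trans k1.
have ga t : exists p, dom a p /\ coord a p = parabola k x y z t.
  have : chart_image a (parabola k x y z t).
    apply: ra; rewrite -ball_normE /=; apply: le_lt_trans (parabola_near x y z k0 t k1) _.
    rewrite ltr_pdivrMr// /k mulrDr mulr1 mulrC divfK ?gt_eqF//.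
    by rewrite ltrDl.
  by move=> [p ap px]; exists p.
have [F FP] := choice ga.
have aF t : dom a (F t) by have [] := FP t.
have FE : coord a \o F = parabola k x y z by apply/funext => t; have [_] := FP t.
have oT : open (setT : set R) := openT.
have dpar t : differentiable (parabola k x y z) t.
  by have [h _] := parabola_Ck_on k x y z 0; exact: h.
exists F; split => //.
- move=> b.
  have UE : F @^-1` dom b = parabola k x y z @^-1` overlap a b.
    apply/seteqP; split => t /=.
      by move=> bt; rewrite -FE /=; exists (F t).
    rewrite -FE /= => -[p [ap bp] /(coord_inj HA ap (aF t)) pF].
    by rewrite -pF.
  have oU : open (F @^-1` dom b).
    rewrite UE; apply: open_comp (open_overlap HA a b) => t _.
    exact: differentiable_continuous.
  split => // m t bt; apply: (Ck_on_derive1n (U := F @^-1` dom b)) bt => N.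
  apply/Ck_on_mx => // i j.
  apply: (Ck_on_ext (f := fun t => transition a b (parabola k x y z t) i j)) => //.
    by move=> s bs; rewrite -FE /= (transitionE HA).
  have ts : smooth_on (overlap a b) (fun x => transition a b x i j).
    have [h _] := smooth_on_mxP (transition a b) (open_overlap HA a b).
    exact: (h (smooth_on_transition HA a b)).
  apply: (Ck_on_comp (U' := overlap a b) (f := parabola k x y z) (g := fun x => transition a b x i j) oU).
  + by rewrite UE.
  + by apply: Ck_on_sub (parabola_Ck_on k x y z N).
  + by move/smooth_onP: ts.
- rewrite /jet_coord FE derive1n1E derive1n2E (parabola_derive2 _ _ _ k0).
  rewrite (parabola_derive _ _ _ k0) osc0 mulr0 cos0 mul0r mulr0 scale0r addr0 scale1r.
  rewrite scalerA mulVf ?pnatr_eq0// scale1r.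
  rewrite -[coord a (F 0)]/((coord a \o F) 0) FE parabola0.
  exact: xyz_parts.
Qed.

Lemma T2_exists a w : chart_image a (xpart w) -> exists j, T2_dom a j /\ T2_coord a j = w.
Proof.
move=> /curve_exists [F [sF aF Fw]].
pose j : T2_pt M := exist _ (jet2 F) (ex_intro _ F (conj sF erefl)).
have jF : sval j F by split; [exact: sF|exact: same_2jet_refl].
exists j; have aj : T2_dom a j by exists F.
split; first exact: aj.
have rF : dom a (rep j 0) by exact/T2_domE.
exact: (etrans (T2_coordE aj) (etrans (same_2jet_coord (rep_same jF) rF) Fw)).
Qed.

Lemma T2_chart_image a w : chart_image (A := T2 M) a w <-> chart_image a (xpart w).
Proof.
split; last by move=> /T2_exists [j [aj jw]]; exists j.
by move=> [j aj <-]; rewrite xpart_T2_coord//; exists (base j) => //; exact/T2_domE.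
Qed.

Lemma T2_overlap a b w : overlap (A := T2 M) a b w <-> overlap a b (xpart w).
Proof.
split.
  move=> [j [aj bj] <-]; rewrite xpart_T2_coord//; exists (base j) => //.
  by split; exact/T2_domE.
move=> [p [ap bp] pw]; have [|j [aj jw]] := @T2_exists a w; first by exists p.
exists j => //; split => //; apply/T2_domE.
suff -> : base j = p by [].
apply: (coord_inj HA (a := a)) => //; first exact/T2_domE.
by rewrite -(xpart_T2_coord aj) jw.
Qed.

Lemma T2_coord_set_inj a : set_inj (T2_dom a) (T2_coord a).
Proof. by move=> j j'; rewrite !inE; exact: T2_coord_inj. Qed.

Lemma T2_transitionE a b w : overlap a b (xpart w) ->
  transition (A := T2 M) a b w = prolong (transition a b) w.
Proof.
move=> /T2_overlap [j [aj bj] <-]; rewrite -(T2_transition_coord aj bj).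
rewrite /transition /local_expr; apply: get_unique; first by exists j.
by move=> v [j' [aj' /(T2_coord_inj aj' aj) ->] <-].
Qed.

Lemma T2_open_overlap a b : open (overlap (A := T2 M) a b).
Proof.
rewrite (_ : overlap _ _ = [set w | overlap a b (xpart w)]); last first.
  by apply/seteqP; split => w /T2_overlap.
exact: open_cyl (open_overlap HA a b).
Qed.

Lemma xyzE (x y z : 'rV[R]_n) (i : 'I_1) (k : 'I_(n + n + n)) :
  xyz x y z i k = match fintype.split k with
    | inl k' => match fintype.split k' with inl l => x i l | inr l => y i l end
    | inr l => z i l end.
Proof. by rewrite /xyz !mxE; case: (fintype.split k) => // k'; rewrite !mxE; case: (fintype.split k'). Qed.

Lemma smooth_on_xyz (U : set 'rV[R]_(n + n + n)) (f g h : 'rV[R]_(n + n + n) -> 'rV[R]_n) :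
  open U -> smooth_on U f -> smooth_on U g -> smooth_on U h ->
  smooth_on U (fun w => xyz (f w) (g w) (h w)).
Proof.
move=> oU sf sg sh; apply/smooth_on_mxP => // i k.
under eq_fun do rewrite xyzE.
have [F _] := smooth_on_mxP f oU; have [G _] := smooth_on_mxP g oU; have [K _] := smooth_on_mxP h oU.
case: (fintype.split k) => [k'|l]; last exact: K.
by case: (fintype.split k') => l; [exact: F|exact: G].
Qed.

Lemma smooth_on_jet_mx (U : set 'rV[R]_n) p q m (f : 'rV[R]_n -> 'M[R]_(p, q)) :
  open U -> smooth_on U f -> smooth_on [set w | U (xpart w)] (jet m f).
Proof.
move=> oU sf; apply/smooth_on_mxP; first exact: open_cyl.
move=> i k; apply: (smooth_on_ext (f := jet m (fun x => f x i k))).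
- exact: open_cyl.
- by move=> w Uw; rewrite (jet_mxE _ _ _ oU sf).
- apply: smooth_on_jet => //.
  by have [F _] := smooth_on_mxP f oU; exact: F.
Qed.

Lemma T2_smooth_atlas : smooth_atlas (T2 M).
Proof.
split; [exact: T2_coord_set_inj|exact: T2_open_overlap|].
move=> a b; apply: (smooth_on_ext (f := prolong (@transition R n M a b))).
- exact: T2_open_overlap.
- by move=> w /T2_overlap abw; rewrite T2_transitionE.
- apply: (@smooth_on_sub _ _ _ [set w | @overlap R n M a b (xpart w)]).
    by move=> w /T2_overlap.
  have oo := open_overlap HA a b; have ts := smooth_on_transition HA a b.
  apply: smooth_on_xyz; first exact: open_cyl.
  + exact: (smooth_on_jet_mx 2 oo ts).
  + exact: (smooth_on_jet_mx 1 oo ts).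
  + exact: (smooth_on_jet_mx 0 oo ts).
Qed.

End T2Atlas.

(** * Torsion and metric compatibility through Christoffel symbols *)

Section Bilinear.
Variables (R : realType) (m : nat).
Implicit Types (B : 'M[R]_m) (u v : 'rV[R]_m).

Lemma bil_row B u v : bil B u v = \sum_k (u *m B) 0 k * v 0 k.
Proof. by rewrite /bil mxE; apply: eq_bigr => k _; rewrite !mxE. Qed.

Lemma bilE B u v : bil B u v = \sum_i \sum_k u 0 i * B i k * v 0 k.
Proof.
rewrite bil_row exchange_big; apply: eq_bigr => k _.
by rewrite mxE mulr_suml.
Qed.

Lemma bilC B u v : B^T = B -> bil B u v = bil B v u.
Proof.
by move=> BT; rewrite /bil -[u *m B *m v^T]trmxK mxE trmx_mul trmxK trmx_mul BT mulmxA.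
Qed.

Lemma bilDl B u u' v : bil B (u + u') v = bil B u v + bil B u' v.
Proof. by rewrite /bil !mulmxDl mxE. Qed.
Lemma bilDr B u v v' : bil B u (v + v') = bil B u v + bil B u v'.
Proof. by rewrite /bil linearD mulmxDr mxE. Qed.
Lemma bilZl B k u v : bil B (k *: u) v = k * bil B u v.
Proof. by rewrite /bil -!scalemxAl mxE. Qed.
Lemma bilZr B k u v : bil B u (k *: v) = k * bil B u v.
Proof. by rewrite /bil linearZ -scalemxAr mxE. Qed.

Lemma eval12Dl (h : 'I_m -> 'M[R]_m) u u' v : eval12 h (u + u') v = eval12 h u v + eval12 h u' v.
Proof. by apply/rowP => k; rewrite !mxE bilDl. Qed.
Lemma eval12Dr (h : 'I_m -> 'M[R]_m) u v v' : eval12 h u (v + v') = eval12 h u v + eval12 h u v'.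
Proof. by apply/rowP => k; rewrite !mxE bilDr. Qed.
Lemma eval12Zl (h : 'I_m -> 'M[R]_m) k u v : eval12 h (k *: u) v = k *: eval12 h u v.
Proof. by apply/rowP => l; rewrite !mxE bilZl. Qed.
Lemma eval12Zr (h : 'I_m -> 'M[R]_m) k u v : eval12 h u (k *: v) = k *: eval12 h u v.
Proof. by apply/rowP => l; rewrite !mxE bilZr. Qed.

Lemma smooth_on_bil U (B : 'rV[R]_m -> 'M[R]_m) (u v : 'rV[R]_m -> 'rV[R]_m) :
  open U -> smooth_on U B -> smooth_on U u -> smooth_on U v ->
  smooth_on U (fun x => bil (B x) (u x) (v x)).
Proof.
move=> oU sB su sv; under eq_fun do rewrite bilE.
have [hB _] := smooth_on_mxP B oU; have [hu _] := smooth_on_mxP u oU.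
have [hv _] := smooth_on_mxP v oU.
apply: smooth_on_sum => // i _; apply: smooth_on_sum => // k _.
apply: smooth_on_mul; [exact: oU| |exact: hv].
by apply: smooth_on_mul; [exact: oU|exact: hu|exact: hB].
Qed.
End Bilinear.

Section TensorPerturbation.
Variables (R : realType) (m : nat) (A : atlas R m).
Hypothesis HA : smooth_atlas A.

Lemma app12_field (T : field12 A) (X Y : vfield A) : is_tensor12 T ->
  is_vector_field X -> is_vector_field Y -> is_vector_field (app12 T X Y).
Proof.
move=> [sT tT] [sX tX] [sY tY]; split=> [a|a b p ap bp].
  have oa := open_chart_image HA a.
  apply/smooth_on_mxP => // i k; rewrite /app12 /eval12.
  under eq_fun do rewrite mxE.
  by apply: smooth_on_bil; [exact: oa|exact: sT|exact: sX|exact: sY].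
by rewrite /app12 (tX _ _ _ ap bp) (tY _ _ _ ap bp) (tT _ _ _ ap bp).
Qed.

Lemma connection_add_tensor nabla (T : field12 A) : is_connection nabla -> is_tensor12 T ->
  is_connection (fun X Y => vf_add (nabla X Y) (app12 T X Y)).
Proof.
move=> Hn tT; split.
- by move=> X Y vX vY; apply: vf_add_field => //; [exact: connection_field|exact: app12_field].
- move=> X X' Y Y' vX vX' vY vY' XX YY a x ax.
  by rewrite /vf_add (connection_eq Hn vX vX' vY vY' XX YY ax) /app12 XX// YY.
- move=> X X' Y vX vX' vY a x ax.
  rewrite /vf_add (connection_addl Hn vX vX' vY ax) /vf_add /app12 eval12Dl.
  by rewrite addrACA.
- move=> f X Y sf vX vY a x ax.
  by rewrite /vf_add (connection_scalel Hn sf vX vY ax) /vf_scale /app12 eval12Zl scalerDr.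
- move=> X Y Y' vX vY vY' a x ax.
  rewrite /vf_add (connection_addr Hn vX vY vY' ax) /vf_add /app12 eval12Dr.
  by rewrite addrACA.
- move=> f X Y sf vX vY a x ax.
  by rewrite /vf_add (connection_leibniz Hn sf vX vY ax) /vf_add /vf_scale /app12 eval12Zr scalerDr addrA.
Qed.

End TensorPerturbation.

Section Christoffel.
Variables (R : realType) (m : nat) (A : atlas R m).
Hypothesis HA : smooth_atlas A.
Variables (nabla : vfield A -> vfield A -> vfield A) (a : chart A) (x : 'rV[R]_m).
Hypothesis ax : chart_image a x.
Variable Gamma : 'I_m -> 'I_m -> 'rV[R]_m.
Hypothesis nablaE : forall X Y, is_vector_field X -> is_vector_field Y ->
  nabla X Y a x = 'D_(X a x) (Y a) x + \sum_i \sum_j (X a x 0 i * Y a x 0 j) *: Gamma i j.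

Lemma torsion_free_Christoffel : (forall i j, Gamma i j = Gamma j i) ->
  forall X Y, is_vector_field X -> is_vector_field Y ->
  vf_sub (nabla X Y) (nabla Y X) a x = lie_bracket X Y a x.
Proof.
move=> GC X Y vX vY; rewrite /vf_sub /lie_bracket !nablaE// opprD addrACA.
rewrite -[RHS]addr0; congr (_ + _); apply/eqP; rewrite subr_eq0; apply/eqP.
rewrite exchange_big; apply: eq_bigr => j _; apply: eq_bigr => i _.
by rewrite GC mulrC.
Qed.

(** The Leibniz rule for [g(Y, Z)]; the derivatives of [Y] and [Z] cancel
    against those in the covariant derivatives, and the hypothesis on the
    components of the metric cancels the remaining terms. *)
Lemma metric_Christoffel (G : field02 A) : smooth_on (chart_image a) (G a) ->
  (G a x)^T = G a x ->
  (forall i j k, pd i (fun y => G a y j k) x =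
     (Gamma i j *m G a x) 0 k + (Gamma i k *m G a x) 0 j) ->
  forall X Y Z, is_vector_field X -> is_vector_field Y -> is_vector_field Z ->
  cov02 nabla G X Y Z a x = 0.
Proof.
move=> sG GT DG X Y Z vX vY vZ.
have oa := open_chart_image HA a.
have [hG _] := smooth_on_mxP (G a) oa; have [hY _] := smooth_on_mxP (Y a) oa.
have [hZ _] := smooth_on_mxP (Z a) oa.
have {}hG := hG sG; have {}hY := hY (vY.1 a); have {}hZ := hZ (vZ.1 a).
have dG i j : differentiable (fun y => G a y i j) x := smooth_on_differentiable (hG i j) ax.
have dY j : differentiable (fun y => Y a y 0 j) x := smooth_on_differentiable (hY 0 j) ax.
have dZ j : differentiable (fun y => Z a y 0 j) x := smooth_on_differentiable (hZ 0 j) ax.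
have dYa : differentiable (Y a) x := smooth_on_differentiable (vY.1 a) ax.
have dZa : differentiable (Z a) x := smooth_on_differentiable (vZ.1 a) ax.
set v := X a x.
(* Differentiating the two fields gives the first two terms, differentiating [G] the third. *)
have E1 : 'D_v (app02 G Y Z a) x = bil (G a x) ('D_v (Y a) x) (Z a x) +
    bil (G a x) (Y a x) ('D_v (Z a) x) +
    \sum_j \sum_k Y a x 0 j * 'D_v (fun y => G a y j k) x * Z a x 0 k.
  have -> : app02 G Y Z a = fun y => \sum_j \sum_k Y a y 0 j * G a y j k * Z a y 0 k.
    by apply/funext => y; rewrite /app02 bilE.
  have d1 j k : differentiable (fun y => Y a y 0 j * G a y j k) x by exact: differentiableM.
  have d2 j k : differentiable (fun y => Y a y 0 j * G a y j k * Z a y 0 k) x.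
    exact: differentiableM.
  rewrite derive_sumf; last by move=> j; apply: differentiable_sumf.
  rewrite !bilE -!big_split; apply: eq_bigr => j _ /=.
  rewrite derive_sumf// -!big_split; apply: eq_bigr => k _ /=.
  rewrite derive_mulf// derive_mulf// !derive_mxE//.
  move: ('D_v _ x) ('D_v _ x) ('D_v _ x) (Y a x 0 j) (Z a x 0 k) (G a x j k) => *.
  ring.
have E2 : \sum_j \sum_k Y a x 0 j * 'D_v (fun y => G a y j k) x * Z a x 0 k =
    \sum_i \sum_j \sum_k v 0 i * Y a x 0 j * Z a x 0 k * (Gamma i j *m G a x) 0 k +
    \sum_i \sum_j \sum_k v 0 i * Y a x 0 j * Z a x 0 k * (Gamma i k *m G a x) 0 j.
  transitivity (\sum_i \sum_j \sum_k
      (v 0 i * Y a x 0 j * Z a x 0 k * (Gamma i j *m G a x) 0 k +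
       v 0 i * Y a x 0 j * Z a x 0 k * (Gamma i k *m G a x) 0 j)); last first.
    rewrite -big_split; apply: eq_bigr => i _; rewrite -big_split.
    by apply: eq_bigr => j _; rewrite -big_split.
  rewrite [RHS]exchange_big; apply: eq_bigr => j _.
  rewrite [RHS]exchange_big; apply: eq_bigr => k _ /=.
  rewrite (pdE _ (hG j k))// mulr_sumr mulr_suml; apply: eq_bigr => i _.
  rewrite DG -[_ *: _]/(_ * _).
  move: (v 0 i) (Y a x 0 j) (Z a x 0 k) ((Gamma i j *m _) 0 k) ((Gamma i k *m _) 0 j) => *.
  ring.
have S1 : bil (G a x) (\sum_i \sum_j (v 0 i * Y a x 0 j) *: Gamma i j) (Z a x) =
    \sum_i \sum_j \sum_k v 0 i * Y a x 0 j * Z a x 0 k * (Gamma i j *m G a x) 0 k.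
  rewrite /bil mulmx_suml mulmx_suml summxE; apply: eq_bigr => i _.
  rewrite mulmx_suml mulmx_suml summxE; apply: eq_bigr => j _.
  rewrite -[LHS]/(bil _ _ _) bilZl bil_row mulr_sumr; apply: eq_bigr => k _.
  by move: (v 0 i) (Y a x 0 j) (Z a x 0 k) ((Gamma i j *m _) 0 k) => *; ring.
have S2 : bil (G a x) (Y a x) (\sum_i \sum_j (v 0 i * Z a x 0 j) *: Gamma i j) =
    \sum_i \sum_j \sum_k v 0 i * Y a x 0 j * Z a x 0 k * (Gamma i k *m G a x) 0 j.
  rewrite bilC// /bil mulmx_suml mulmx_suml summxE; apply: eq_bigr => i _.
  rewrite mulmx_suml mulmx_suml summxE exchange_big; apply: eq_bigr => k _.
  rewrite -[LHS]/(bil _ _ _) bilZl bil_row mulr_sumr; apply: eq_bigr => j _.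
  by move: (v 0 i) (Y a x 0 j) (Z a x 0 k) ((Gamma i k *m _) 0 j) => *; ring.
rewrite /cov02 -/v E1 E2 /app02 !nablaE// -/v bilDl bilDr S1 S2.
move: (bil _ _ _) (bil _ _ _) (\sum_i _) (\sum_i _) => *; ring.
Qed.

End Christoffel.

(** * Lifts of vector fields *)

Section GradedLift.
Variables (R : realType) (n : nat).
Implicit Types (w : 'rV[R]_(n + n + n)).

(** The three lifts are shifts of one another: codegree [d] gives the second
    lift for 0, the first for 1 and the 0-th for 2, and zero beyond. *)
Definition graded_lift (d : nat) (X : 'rV[R]_n -> 'rV[R]_n) w : 'rV[R]_(n + n + n) :=
  xyz (jet d.+2 X w) (jet d.+1 X w) (jet d X w).

Variables (U : set 'rV[R]_n).
Hypothesis oU : open U.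

Lemma graded_lift_entries d X w i : smooth_on U X -> U (xpart w) ->
  [/\ xpart (graded_lift d X w) 0 i = jet d.+2 (fun x => X x 0 i) w,
      ypart (graded_lift d X w) 0 i = jet d.+1 (fun x => X x 0 i) w &
      zpart (graded_lift d X w) 0 i = jet d (fun x => X x 0 i) w].
Proof.
move=> sX Uw; rewrite /graded_lift xpart_xyz ypart_xyz zpart_xyz.
by split; exact: (jet_mxE _ _ _ oU sX Uw).
Qed.

(** [derive_jet] gives the left-hand side in terms of the components of the
    lift, and [jetM] recognizes the jets of the products [X^i (pd i f)]. *)
Lemma derive_graded_lift d m X (f : 'rV[R]_n -> R) w :
  smooth_on U X -> smooth_on U f -> U (xpart w) ->
  'D_(graded_lift d X w) (jet m f) w = jet (m + d) (fun x => 'D_(X x) f x) w.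
Proof.
move=> sX sf Uw; rewrite (derive_jet oU)//.
have [hX _] := smooth_on_mxP X oU; have {}hX := hX sX.
have sp i : smooth_on U (fun x => X x 0 i * pd i f x).
  by apply: smooth_on_mul; [exact: oU|exact: hX|exact: smooth_on_pd].
transitivity (jet (m + d) (fun x => \sum_i X x 0 i * pd i f x) w); last first.
  by apply: (jet_ext _ oU _ Uw) => x Ux; rewrite (pdE _ sf).
rewrite (jet_sum oU) //; apply: eq_bigr => i _.
have [-> -> ->] := graded_lift_entries d i sX Uw.
by rewrite (jetM oU _ _ (hX 0 i) (smooth_on_pd i sf) Uw).
Qed.

Lemma jet_cst (W : normedModType R) m (e : W) w :
  jet m (fun _ => e) w = if m == 2 then e else 0.
Proof.
have d1 s : pd s (fun _ : 'rV[R]_n => e) = fun _ => 0.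
  by apply/funext => x; exact: derive_cst.
have d0 s : pd s (fun _ : 'rV[R]_n => (0 : W)) = fun _ => 0.
  by apply/funext => x; exact: derive_cst.
case: m => [|[|[|m]]] //=.
- rewrite /lift2 !big1 ?scaler0 ?addr0// => s _; last by rewrite d1 scaler0.
  by rewrite big1// => t _; rewrite d1 d0 scaler0.
- by rewrite /lift1 big1// => s _; rewrite d1 scaler0.
Qed.

Lemma graded_lift_ext d X Y w : (forall x, U x -> X x = Y x) -> U (xpart w) ->
  graded_lift d X w = graded_lift d Y w.
Proof. by move=> XY Uw; rewrite /graded_lift; congr xyz; exact: (jet_ext _ oU). Qed.

Lemma graded_lift_ge3 d X w : graded_lift d.+3 X w = 0.
Proof. by rewrite /graded_lift /= /xyz !row_mx0. Qed.

End GradedLift.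

Section LiftField.
Variables (R : realType) (n : nat) (M : atlas R n).
Hypothesis HA : smooth_atlas M.

Definition glift (d : nat) (X : vfield M) : vfield (T2 M) :=
  fun a : chart M => graded_lift d (X a).


Lemma prolong_entry (f : 'rV[R]_n -> 'rV[R]_n) w k : prolong f w 0 k =
  match fintype.split k with
  | inl k' => match fintype.split k' with inl l => jet 2 f w 0 l | inr l => jet 1 f w 0 l end
  | inr l => jet 0 f w 0 l end.
Proof. exact: xyzE. Qed.

Lemma derive_prolong (U : set 'rV[R]_n) d X (f Xf : 'rV[R]_n -> 'rV[R]_n) w :
  open U -> smooth_on U X -> smooth_on U f -> U (xpart w) ->
  smooth_on U Xf -> (forall x, U x -> Xf x = 'D_(X x) f x) ->
  'D_(graded_lift d X w) (prolong f) w = graded_lift d Xf w.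
Proof.
move=> oU sX sf Uw sXf XfE; have oc := open_cyl oU.
have [hf _] := smooth_on_mxP f oU; have {}hf := hf sf.
have E m l : 'D_(graded_lift d X w) (fun w => jet m f w 0 l) w = jet (m + d) Xf w 0 l.
  rewrite (jet_mxE _ _ _ oU sXf)//.
  transitivity ('D_(graded_lift d X w) (jet m (fun x => f x 0 l)) w).
    apply: near_eq_derive; apply: filterS (open_nbhs_nbhs (conj oc Uw)) => v Uv.
    by rewrite (jet_mxE _ _ _ oU sf).
  rewrite (derive_graded_lift oU)//; apply: (jet_ext _ oU _ Uw) => x Ux.
  by rewrite XfE// derive_mxE//; exact: (smooth_on_differentiable sf Ux).
have dp : differentiable (prolong f) w.
  have sp : smooth_on [set w | U (xpart w)] (prolong f).
    apply: smooth_on_xyz; first exact: oc.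
    + exact: (smooth_on_jet_mx 2 oU sf).
    + exact: (smooth_on_jet_mx 1 oU sf).
    + exact: (smooth_on_jet_mx 0 oU sf).
  exact: (smooth_on_differentiable sp).
apply/rowP => k; rewrite derive_mxE//.
under eq_fun do rewrite prolong_entry.
rewrite [RHS]xyzE; case: (fintype.split k) => [k'|l]; last by rewrite E.
by case: (fintype.split k') => l; rewrite E.
Qed.

Lemma prolong_graded_lift (U U' : set 'rV[R]_n) d (f Y : 'rV[R]_n -> 'rV[R]_n) w :
  open U -> open U' -> smooth_on U f -> smooth_on U' Y -> (forall x, U x -> U' (f x)) ->
  U (xpart w) ->
  graded_lift d (fun x => Y (f x)) w = graded_lift d Y (prolong f w).
Proof.
move=> oU oU' sf sY UU Uw.
have sYf : smooth_on U (fun x => Y (f x)) by exact: (smooth_on_comp_mx oU oU' UU sf sY).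
have [hY _] := smooth_on_mxP Y oU'; have {}hY := hY sY.
have U'w : U' (xpart (prolong f w)) by rewrite xpart_xyz; exact: UU.
have E m : jet m (fun x => Y (f x)) w = jet m Y (prolong f w).
  apply/rowP => l; rewrite (jet_mxE _ _ _ oU sYf)// (jet_mxE _ _ _ oU' sY)//.
  exact: (jet_comp oU _ sf UU oU' (hY 0 l) Uw).
by rewrite /graded_lift !E.
Qed.

(** On the overlap of two charts with transition [tau], the components of [X]
    satisfy [X_b \o tau = X_a tau].  The prolongation of [tau] therefore sends
    the lift of [X_a] to the lift of [X_b \o tau], which by the chain rule for
    jets is the lift of [X_b] at the image point. *)
Lemma glift_field d X : is_vector_field X -> is_vector_field (glift d X).
Proof.
move=> vX; apply: (vector_field_of (T2_smooth_atlas HA)) => [a|a b j aj bj];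
  change (chart M) in a.
  have oa := open_chart_image HA a; have sX : smooth_on (chart_image a) (X a) := vX.1 a.
  apply: (@smooth_on_sub _ _ _ [set w | @chart_image R n M a (xpart w)]).
    by move=> w /(T2_chart_image HA).
  apply: smooth_on_xyz; first exact: open_cyl.
  + exact: (smooth_on_jet_mx d.+2 oa sX).
  + exact: (smooth_on_jet_mx d.+1 oa sX).
  + exact: (smooth_on_jet_mx d oa sX).
change (chart M) in b; change (T2_pt M) in j.
change (T2_dom a j) in aj; change (T2_dom b j) in bj.
change (glift d X b (T2_coord b j) =
  'D_(glift d X a (T2_coord a j)) (@transition R _ (T2 M) a b) (T2_coord a j)).
set w := T2_coord a j; pose tau := @transition R n M a b; pose U := @overlap R n M a b.
have wU : U (xpart w) by apply/(T2_overlap HA); exists j.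
have oU : open U := open_overlap HA a b.
have st : smooth_on U tau := smooth_on_transition HA a b.
have sXa : smooth_on U (X a).
  by apply: smooth_on_sub (vX.1 a) => x [p [ap _] <-]; exists p.
have UU x : U x -> chart_image b (tau x).
  by move=> Ux; have [p [bp _] pE] := transition_overlap HA Ux; exists p.
have sXb : smooth_on (chart_image b) (X b) := vX.1 b.
have ob := open_chart_image HA b.
rewrite (T2_transition_coord HA aj bj).
rewrite -[LHS]/(graded_lift d (X b) (prolong tau w)).
rewrite -(prolong_graded_lift d oU ob st sXb UU wU).
rewrite -(derive_prolong d oU sXa st wU (Xf := fun x => X b (tau x))).
- apply: near_eq_derive; apply: filterS (open_nbhs_nbhs (conj (open_cyl oU) wU)) => v Uv.
  by rewrite (T2_transitionE HA).
- exact: (smooth_on_comp_mx oU ob UU st sXb).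
- move=> _ [p [ap bp] <-]; rewrite /tau (transitionE HA)//.
  exact: vector_field_transition.
Qed.

Variables (nabla : vfield M -> vfield M -> vfield M).
Variables (nabla2 : vfield (T2 M) -> vfield (T2 M) -> vfield (T2 M)).

Lemma glift_ge3 d X : glift d.+3 X = vf_zero (T2 M).
Proof. by apply/funext => a; apply/funext => w; exact: graded_lift_ge3. Qed.

(** In terms of codegrees the nine equations say that codegrees add up. *)
Lemma second_lift_glift d e X Y : is_second_lift nabla nabla2 ->
  is_vector_field X -> is_vector_field Y -> (d < 3)%N -> (e < 3)%N ->
  field_eq (nabla2 (glift d X) (glift e Y)) (glift (d + e) (nabla X Y)).
Proof.
move=> [_ H00 H01 H02 H10 H11 H12 H20 H21 H22] vX vY.
case: d => [|[|[|d]]] //; case: e => [|[|[|e]]] //= _ _;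
  rewrite ?addn0 ?add0n ?addSn ?addn0 ?addnS ?addn0 ?glift_ge3.
- exact: H22.
- exact: H21.
- exact: H20.
- exact: H12.
- exact: H11.
- exact: H10.
- exact: H02.
- exact: H01.
- exact: H00.
Qed.

Lemma zeroth_lift_glift (H : field12 M) (H0 : field12 (T2 M)) d e X Y :
  is_zeroth_lift12 H H0 -> is_vector_field X -> is_vector_field Y ->
  (d < 3)%N -> (e < 3)%N ->
  field_eq (app12 H0 (glift d X) (glift e Y))
           (if (d + e == 0)%N then glift 2 (app12 H X Y) else vf_zero (T2 M)).
Proof.
move=> [_ H22 Hij] vX vY.
case: d => [|[|[|d]]] //; case: e => [|[|[|e]]] //= _ _.
- exact: H22.
- exact: (Hij 2 1).
- exact: (Hij 2 0).
- exact: (Hij 1 2).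
- exact: (Hij 1 1).
- exact: (Hij 1 0).
- exact: (Hij 0 2).
- exact: (Hij 0 1).
- exact: (Hij 0 0).
Qed.

End LiftField.

(** * The deformed metric in coordinates *)

Arguments jet : simpl never.
Section FrameIndex.
Variable n : nat.
Implicit Types K : 'I_(n + n + n).

(** The codegree of the lift whose direction is the [K]-th coordinate; with
    [bidx] it identifies the coordinates of [T2 M] with the lifts of those of
    [M]. *)
Definition bdeg K : nat :=
  match fintype.split K with
  | inl K' => match fintype.split K' with inl _ => 0 | inr _ => 1 end
  | inr _ => 2
  end.

Definition bidx K : 'I_n :=
  match fintype.split K with
  | inl K' => match fintype.split K' with inl i => i | inr i => i end
  | inr i => i
  end.

Lemma frame_index_ind (P : 'I_(n + n + n) -> nat -> 'I_n -> Prop) :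
  (forall i, P (lshift n (lshift n i)) 0 i) -> (forall i, P (lshift n (rshift n i)) 1 i) ->
  (forall i, P (rshift (n + n) i) 2 i) -> forall K, P K (bdeg K) (bidx K).
Proof.
move=> Px Py Pz K; rewrite /bdeg /bidx.
rewrite -{1}(splitK K); case: (fintype.split K) => [K'|i]; last exact: Pz.
by rewrite /= -{1}(splitK K'); case: (fintype.split K') => i; [exact: Px|exact: Py].
Qed.

Lemma bdeg_lt3 K : (bdeg K < 3)%N.
Proof. by apply: (@frame_index_ind (fun _ d _ => (d < 3)%N)). Qed.

Lemma split_lshift p q (i : 'I_p) : fintype.split (lshift q i) = inl i.
Proof. exact: (unsplitK (inl i)). Qed.

Lemma split_rshift p q (i : 'I_q) : fintype.split (rshift p i) = inr i.
Proof. exact: (unsplitK (inr i)). Qed.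

Lemma bdegE : [/\ forall i, bdeg (lshift n (lshift n i)) = 0%N,
  forall i, bdeg (lshift n (rshift n i)) = 1%N & forall i, bdeg (rshift (n + n) i) = 2].
Proof. by split => i; rewrite /bdeg ?split_lshift ?split_rshift ?split_lshift ?split_rshift. Qed.

Lemma bidxE : [/\ forall i, bidx (lshift n (lshift n i)) = i,
  forall i, bidx (lshift n (rshift n i)) = i & forall i, bidx (rshift (n + n) i) = i].
Proof. by split => i; rewrite /bidx ?split_lshift ?split_rshift ?split_lshift ?split_rshift. Qed.

Lemma sum_frame (R : nmodType) (F : 'I_(n + n + n) -> R) :
  \sum_K F K = \sum_i (F (lshift n (lshift n i)) + F (lshift n (rshift n i)) + F (rshift (n + n) i)).
Proof. by rewrite !big_split_ord !big_split. Qed.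

End FrameIndex.

Section Coordinates.
Variables (R : realType) (n : nat).
Implicit Types w : 'rV[R]_(n + n + n).

(** Derivatives of constant fields vanish, so the lifts of the coordinate
    fields of [M] are the coordinate fields of [T2 M]. *)
Lemma graded_lift_delta K w :
  graded_lift (bdeg K) (fun _ => delta_mx 0 (bidx K) : 'rV[R]_n) w = delta_mx 0 K.
Proof.
apply: (@frame_index_ind n (fun K d i =>
  graded_lift d (fun _ => delta_mx 0 i : 'rV[R]_n) w = delta_mx 0 K)) => i;
  rewrite /graded_lift !jet_cst /= /xyz.
- by rewrite !delta_mx_lshift.
- by rewrite delta_mx_lshift delta_mx_rshift.
- by rewrite row_mx0 delta_mx_rshift.
Qed.

(** The block of codegrees [r] and [s] of the second lift of [g] depends on
    [r + s] only. *)
Lemma deformed_metricE (M : atlas R n) (g c : field02 M) a w B C :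
  deformed_metric g c a w B C = jet (bdeg B + bdeg C) (g a) w (bidx B) (bidx C) +
    (if (bdeg B + bdeg C == 0)%N then c a (xpart w) (bidx B) (bidx C) else 0).
Proof.
pose P d i B C e k := deformed_metric g c a w B C = jet (d + e) (g a) w i k +
  (if (d + e == 0)%N then c a (xpart w) i k else 0).
apply: (@frame_index_ind n (fun B d i => P d i B C (bdeg C) (bidx C))) => i;
  apply: (@frame_index_ind n (P _ i _)) => k; rewrite /P /jet /deformed_metric /=;
  rewrite ?block_mxEul ?block_mxEur ?block_mxEdl ?block_mxEdr ?row_mxEl ?row_mxEr ?col_mxEu ?col_mxEd
   ?block_mxEul ?block_mxEur ?block_mxEdl ?block_mxEdr ?addr0 ?mxE //.
Qed.

Variables (M : atlas R n) (g c : field02 M) (a : chart M) (U : set 'rV[R]_n).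
Hypotheses (oU : open U) (sg : smooth_on U (g a)).

(** The sum over the three blocks is the one of [jetM]. *)
Lemma graded_lift_metric d Z w C : smooth_on U Z -> U (xpart w) ->
  (graded_lift d Z w *m deformed_metric g c a w) 0 C =
  jet (bdeg C + d) (fun x => (Z x *m g a x) 0 (bidx C)) w +
  (if (bdeg C + d == 0)%N then (Z (xpart w) *m c a (xpart w)) 0 (bidx C) else 0).
Proof.
move=> sZ Uw.
have [hg _] := smooth_on_mxP (g a) oU; have {}hg := hg sg.
have [hZ _] := smooth_on_mxP Z oU; have {}hZ := hZ sZ.
set e := bdeg C; set k := bidx C.
have -> : jet (e + d) (fun x => (Z x *m g a x) 0 k) w =
    \sum_i (jet d.+2 (fun x => Z x 0 i) w * jet e (fun x => g a x i k) w +
            jet d.+1 (fun x => Z x 0 i) w * jet e.+1 (fun x => g a x i k) w +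
            jet d (fun x => Z x 0 i) w * jet e.+2 (fun x => g a x i k) w).
  under eq_fun do rewrite mxE.
  rewrite (jet_sum oU)//; last by move=> i; apply: smooth_on_mul; [exact: oU|exact: hZ|exact: hg].
  by apply: eq_bigr => i _; rewrite (jetM oU _ _ (hZ 0 i) (hg i k) Uw).
rewrite mxE sum_frame.
have [dx dy dz] := bdegE n; have [ix iy iz] := bidxE n.
have -> : (if (e + d == 0)%N then (Z (xpart w) *m c a (xpart w)) 0 k else 0) =
    \sum_i (jet d.+2 (fun x => Z x 0 i) w * (if (e == 0)%N then c a (xpart w) i k else 0)).
  case: d => [|d].
    rewrite addn0; case: eqP => _; first by rewrite mxE.
    by rewrite big1// => i _; rewrite mulr0.
  by rewrite addnS /= big1// => i _; rewrite mul0r.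
rewrite -big_split; apply: eq_bigr => i _ /=.
rewrite !deformed_metricE dx dy dz ix iy iz.
have [<- <- <-] := graded_lift_entries oU d i sZ Uw.
rewrite xpartE ypartE zpartE add0n add1n add2n /= !addr0.
rewrite !(jet_mxE _ _ _ oU sg)// -/e -/k.
rewrite mulrDr -!addrA; congr (_ + _); rewrite [in RHS]addrA.
by rewrite [RHS]addrC.
Qed.

End Coordinates.

(** * Local frames of the base and of the bundle *)

Section LocalFrame.
Variables (R : realType) (n : nat) (M : atlas R n).
Hypothesis HM : is_manifold M.
Let HA : smooth_atlas M := manifold_smooth_atlas HM.
Let HT : smooth_atlas (T2 M) := T2_smooth_atlas HA.

(** A chart of [T2 M] contains whole fibres, so a point outside it lies over
    a point outside the chart of [M]: cutoff functions on [M] suffice for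
    [T2 M]. *)
Lemma vanishes_off_xpart (a : chart M) (phi : 'rV[R]_n -> R) (h : 'rV[R]_(n + n + n) -> R) :
  vanishes_off (A := M) a phi ->
  vanishes_off (A := T2 M) a (fun w => phi (xpart w) * h w).
Proof.
move=> van b j bj naj; change (chart M) in b; change (T2_pt M) in j.
have bj' : dom b (base j) by exact/T2_domE.
have naj' : ~ dom a (base j) by move=> aj; apply: naj; exact/T2_domE.
have [Q [oQ Qj Qphi]] := van b (base j) bj' naj'.
exists [set w | Q (xpart w)]; split; first exact: open_cyl.
  have := xpart_T2_coord bj; rewrite /mkset => E.
  change (Q (xpart (T2_coord b j))); rewrite E; exact: Qj.
move=> q aq bq; change (T2_pt M) in q => Qq.
have Ea := xpart_T2_coord aq; have Eb := xpart_T2_coord bq.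
change (phi (xpart (T2_coord a q)) * h (T2_coord a q) = 0).
have Qq' : Q (coord b (base q)) by rewrite -Eb; exact: Qq.
rewrite Ea Qphi ?mul0r//; exact/T2_domE.
Qed.

Lemma smooth_xpart_mul (a : chart M) (phi : 'rV[R]_n -> R) (h : 'rV[R]_(n + n + n) -> R) :
  smooth_on setT phi -> smooth_on (chart_image (A := T2 M) a) h ->
  smooth_on (chart_image (A := T2 M) a) (fun w => phi (xpart w) * h w).
Proof.
move=> sphi sh; have oT := open_chart_image HT a.
apply: smooth_on_mul; [exact: oT| |exact: sh].
apply: (smooth_on_comp (U' := setT) oT _ (smooth_on_xpart oT) sphi) => //.
Qed.

(** Cut off on [M], the coordinate fields extend to vector fields [E i], whose
    lifts coincide with the coordinate fields of [T2 M] over [V].  A second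
    cutoff function, supported in [V], is the one that localizes
    connections. *)
Lemma local_frame (a : chart M) (j : T2_pt M) : T2_dom a j ->
  exists (V : set 'rV[R]_n) (E : 'I_n -> vfield M),
  [/\ open V, V (xpart (T2_coord a j)), V `<=` chart_image a,
      forall i, is_vector_field (E i) &
      forall i x, V x -> E i a x = delta_mx 0 i] /\
  forall nabla, is_connection nabla ->
  forall Xb Yb : vfield (T2 M), is_vector_field Xb -> is_vector_field Yb ->
  nabla Xb Yb a (T2_coord a j) = 'D_(Xb a (T2_coord a j)) (Yb a) (T2_coord a j) +
    \sum_A \sum_B (Xb a (T2_coord a j) 0 A * Yb a (T2_coord a j) 0 B) *:
      nabla (glift (bdeg A) (E (bidx A))) (glift (bdeg B) (E (bidx B))) a (T2_coord a j).
Proof.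
move=> aj; set w := T2_coord a j; set p := base j.
have ap : dom a p by exact/T2_domE.
have wp : xpart w = coord a p by exact: xpart_T2_coord.
have oa := open_chart_image HA a.
have [phi [sphi phi0 phi1 phiV]] := cutoff_exists HM ap oa (chart_image_coord ap).
pose V : set 'rV[R]_n := [set x | phi x = 1]° `&` chart_image a.
have oV : open V by apply: openI => //; exact: open_interior.
have Vp : V (coord a p) by split; [exact: phi1|exact: chart_image_coord].
have phiV1 x : V x -> phi x = 1 by move=> [/interior_subset].
have [psi [spsi psi0 psi1 psiV]] := cutoff_exists HM ap oV Vp.
pose e i (x : 'rV[R]_n) : 'rV[R]_n := phi x *: delta_mx 0 i.
(* Near the point [e i] is the constant field, and the extension has these components. *)
pose E i : vfield M := vextend a (e i).
have vE i : is_vector_field (E i).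
  apply: (vextend_field HA).
    apply: smooth_on_scale_mx; [exact: oa| |exact: smooth_on_cst].
    exact: smooth_on_sub sphi.
  move=> b q bq naq; have [Q [oQ Qq Qphi]] := phi0 b q bq naq.
  by exists Q; split => // r ar br Qr; rewrite /e Qphi// scale0r.
have EV i x : V x -> E i a x = delta_mx 0 i.
  move=> Vx; have [q aq qx] := Vx.2.
  rewrite -qx /E (vextendE HA)// /e phiV1 ?scale1r//.
  by rewrite qx.
exists V, E; split.
  by split => //; [rewrite wp|move=> x []].
move=> nabla Hn Xb Yb vX vY.
(* The factor 1 brings the pullback of [psi] to the form of [smooth_xpart_mul]. *)
pose psi2 : T2 M -> R := extend (A := T2 M) (W := R) a (fun w => psi (xpart w) * 1).
pose V2 : set 'rV[R]_(n + n + n) := [set w | V (xpart w)].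
have oV2 : open V2 by exact: open_cyl.
have psi2E q : T2_dom a q -> psi2 q = psi (xpart (T2_coord a q)).
  move=> aq; rewrite /psi2 (extendE (A := T2 M) (W := R) _ aq) mulr1.
  reflexivity.
pose F A := glift (bdeg A) (E (bidx A)).
have vF A : is_vector_field (F A) by exact: glift_field.
apply: (@connection_frame _ _ (T2 M) HT nabla Hn a j psi2 aj _ _ V2 F oV2 _ vF) => //.
- apply: smooth_extend => //; last exact: vanishes_off_xpart.
  by apply: smooth_xpart_mul => //; exact: smooth_on_cst.
- rewrite psi2E// -/w wp; exact: nbhs_singleton psi1.
- by change (V (xpart w)); rewrite wp.
- move=> A q aq V2q; change (T2_pt M) in q.
  change (graded_lift (bdeg A) (E (bidx A) a) (T2_coord a q) = delta_mx 0 A).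
  rewrite -(graded_lift_delta A (T2_coord a q)).
  exact: (graded_lift_ext oV _ (EV (bidx A)) V2q).
- move=> q psiq; change (T2_pt M) in q.
  have [aq|naq] := pselect (T2_dom a q); last first.
    by exfalso; apply: psiq; exact: (extend_out (A := T2 M) (W := R) _ naq).
  split; first exact: aq.
  have : psi (xpart (T2_coord a q)) <> 0 by rewrite -psi2E.
  by move=> /psiV [].
- move=> h sh.
  exists (extend (A := T2 M) (W := R) a (fun w => phi (xpart w) * h w)).
    by apply: smooth_extend => //; [exact: smooth_xpart_mul|exact: vanishes_off_xpart].
  move=> q aq Vq; rewrite (extendE (A := T2 M) (W := R) _ aq) phiV1 ?mul1r//.
Qed.

End LocalFrame.

Section BaseFrame.
Variables (R : realType) (n : nat) (M : atlas R n).
Variables (a : chart M) (V : set 'rV[R]_n) (E : 'I_n -> vfield M).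
Hypotheses (oV : open V) (Va : V `<=` chart_image a).
Hypothesis vE : forall i, is_vector_field (E i).
Hypothesis EV : forall i x, V x -> E i a x = delta_mx 0 i.
Variables (nabla : vfield M -> vfield M -> vfield M) (g c : field02 M).

Lemma frame_derive0 i v x : V x -> 'D_v (E i a) x = 0.
Proof.
move=> Vx; rewrite -(derive_cst (delta_mx 0 i : 'rV[R]_n) x v).
by apply: (derive_ext oV _ _ Vx) => y Vy; rewrite EV.
Qed.

Lemma frame_torsion : torsion_free nabla -> forall i j x, V x ->
  nabla (E i) (E j) a x = nabla (E j) (E i) a x.
Proof.
move=> tf i j x Vx; have := tf _ _ (vE i) (vE j) a x (Va Vx).
rewrite /vf_sub /lie_bracket !frame_derive0// subr0 => /eqP.
by rewrite subr_eq0 => /eqP.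
Qed.

Lemma bil_delta_r (B : 'M[R]_n) u k : bil B u (delta_mx 0 k) = (u *m B) 0 k.
Proof.
rewrite bil_row (bigD1 k)//= big1 ?addr0; first by rewrite [delta_mx _ _ _ _]mxE !eqxx mulr1.
by move=> l lk; rewrite [delta_mx _ _ _ _]mxE (negPf lk) andbF mulr0.
Qed.

Lemma delta_mulmx (B : 'M[R]_n) i k : ((delta_mx 0 i : 'rV[R]_n) *m B) 0 k = B i k.
Proof. by rewrite -rowE mxE. Qed.

Lemma frame_cov02 (T : field02 M) : symmetric02 T -> forall i j k x, V x ->
  cov02 nabla T (E i) (E j) (E k) a x = pd i (fun y => T a y j k) x -
    (nabla (E i) (E j) a x *m T a x) 0 k - (nabla (E i) (E k) a x *m T a x) 0 j.
Proof.
move=> sT i j k x Vx; rewrite /cov02 /app02 !EV//.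
rewrite bil_delta_r bilC ?bil_delta_r; last exact: sT (Va Vx).
congr (_ - _ - _); rewrite /pd; apply: (derive_ext oV _ _ Vx) => y Vy.
by rewrite !EV// bil_delta_r delta_mulmx.
Qed.

Lemma frame_metric : symmetric02 g -> metric_connection g nabla -> forall i j k x, V x ->
  pd i (fun y => g a y j k) x =
    (nabla (E i) (E j) a x *m g a x) 0 k + (nabla (E i) (E k) a x *m g a x) 0 j.
Proof.
move=> sg mg i j k x Vx.
have := mg _ _ _ (vE i) (vE j) (vE k) a x (Va Vx).
rewrite frame_cov02// => /eqP; rewrite -addrA -opprD subr_eq0 => /eqP; exact.
Qed.

Variable H : field12 M.
Hypotheses (sc : symmetric02 c) (HgH : forall X Y Z : vfield M,
    is_vector_field X -> is_vector_field Y -> is_vector_field Z ->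
    forall (a : chart M) (x : 'rV[R]_n), chart_image a x ->
      app02 g (app12 H X Y) Z a x =
      2^-1 * (cov02 nabla c X Y Z a x + cov02 nabla c Y X Z a x
              - cov02 nabla c Z X Y a x)).

Lemma frame_cov02_sym i j k x : V x ->
  cov02 nabla c (E i) (E j) (E k) a x = cov02 nabla c (E i) (E k) (E j) a x.
Proof.
move=> Vx; rewrite !frame_cov02// addrAC; congr (_ - _ - _).
apply: (derive_ext oV _ _ Vx) => y Vy.
by rewrite -[in LHS](sc (Va Vy)) mxE.
Qed.

Lemma frame_HgH i j k x : V x -> (app12 H (E i) (E j) a x *m g a x) 0 k =
  2^-1 * (cov02 nabla c (E i) (E j) (E k) a x + cov02 nabla c (E j) (E i) (E k) a x
              - cov02 nabla c (E k) (E i) (E j) a x).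
Proof.
move=> Vx; rewrite -HgH//; last exact: Va.
by rewrite /app02 [E k a x]EV// bil_delta_r.
Qed.

Lemma frame_tensor_sym : (forall x, V x -> g a x \in unitmx) -> forall i j x, V x ->
  app12 H (E i) (E j) a x = app12 H (E j) (E i) a x.
Proof.
move=> ug i j x Vx; apply: (can_inj (mulmxK (ug x Vx))).
apply/rowP => k; rewrite !frame_HgH// (frame_cov02_sym k i j)//.
by congr (_ * (_ - _)); rewrite addrC.
Qed.

(** Adding the defining equation of [H] for [(i, j, k)] and [(i, k, j)] leaves
    the covariant derivative of [c] in the direction [i] alone: [H] makes the
    perturbed connection compatible with the part [c] of the metric. *)
Lemma frame_deformation i j k x : V x -> pd i (fun y => c a y j k) x =
  (nabla (E i) (E j) a x *m c a x) 0 k + (nabla (E i) (E k) a x *m c a x) 0 j +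
  ((app12 H (E i) (E j) a x *m g a x) 0 k + (app12 H (E i) (E k) a x *m g a x) 0 j).
Proof.
move=> Vx; rewrite !frame_HgH//.
rewrite (frame_cov02_sym i k j)// (frame_cov02_sym k i j)// (frame_cov02_sym j i k)//.
have := @frame_cov02 c sc i j k x Vx.
move: (cov02 _ _ _ _ _ a x) (cov02 _ _ _ _ _ a x) (cov02 _ _ _ _ _ a x) => p q r.
move: (pd _ _ _) ((_ *m _) 0 k) ((_ *m _) 0 j) => d u v ->.
by field.
Qed.

End BaseFrame.

(** * The Levi-Civita connection of the deformed metric *)

Section DeformedMetric.
Variables (R : realType) (n : nat) (M : atlas R n) (g c : field02 M) (a : chart M).
Variable U : set 'rV[R]_n.
Hypotheses (oU : open U) (sg : smooth_on U (g a)) (sc : smooth_on U (c a)).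

Lemma deformed_metric_jet w A B : U (xpart w) -> deformed_metric g c a w A B =
  jet (bdeg A + bdeg B) (fun x => g a x (bidx A) (bidx B)) w +
  jet 2 (fun x => if (bdeg A + bdeg B == 0)%N then c a x (bidx A) (bidx B) else 0) w.
Proof. by move=> Uw; rewrite deformed_metricE (jet_mxE _ _ _ oU sg). Qed.

Lemma smooth_metric_entries A B : smooth_on U (fun x => g a x (bidx A) (bidx B)) /\
  smooth_on U (fun x => if (bdeg A + bdeg B == 0)%N then c a x (bidx A) (bidx B) else 0).
Proof.
have [hg _] := smooth_on_mxP (g a) oU; have [hc _] := smooth_on_mxP (c a) oU.
split; first exact: hg.
by case: eqP => _; [exact: hc|exact: smooth_on_cst].
Qed.

Lemma smooth_deformed_metric : smooth_on [set w | U (xpart w)] (deformed_metric g c a).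
Proof.
have oc := open_cyl oU; apply/smooth_on_mxP => // A B.
have [s1 s2] := smooth_metric_entries A B.
apply: (smooth_on_ext (f := fun w =>
  jet (bdeg A + bdeg B) (fun x => g a x (bidx A) (bidx B)) w +
  jet 2 (fun x => if (bdeg A + bdeg B == 0)%N then c a x (bidx A) (bidx B) else 0) w)).
- exact: oc.
- by move=> w Uw; rewrite deformed_metric_jet.
- by apply: smooth_on_add; [exact: oc|exact: smooth_on_jet|exact: smooth_on_jet].
Qed.

Lemma deformed_metric_sym w : (forall x, U x -> (g a x)^T = g a x) ->
  (forall x, U x -> (c a x)^T = c a x) -> U (xpart w) ->
  (deformed_metric g c a w)^T = deformed_metric g c a w.
Proof.
move=> gT cT Uw; apply/matrixP => A B; rewrite mxE !deformed_metric_jet//.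
rewrite addnC; congr (_ + _); apply: (jet_ext _ oU _ Uw) => x Ux.
  by rewrite -[in LHS](gT x Ux) mxE.
by case: ifP => // _; rewrite -[in LHS](cT x Ux) mxE.
Qed.

(** The coordinate direction [A] is a lift of a coordinate field of [M], so
    [derive_graded_lift] applies; [c] is a jet coefficient of index 2, hence
    constant along the fibres. *)
Lemma pd_deformed_metric A B C w : U (xpart w) ->
  pd A (fun v => deformed_metric g c a v B C) w =
  jet (bdeg A + bdeg B + bdeg C) (pd (bidx A) (fun x => g a x (bidx B) (bidx C))) w +
  (if (bdeg A + bdeg B + bdeg C == 0)%N
   then pd (bidx A) (fun x => c a x (bidx B) (bidx C)) (xpart w) else 0).
Proof.
move=> Uw; have [s1 s2] := smooth_metric_entries B C.
have oc := open_cyl oU; have sE := @smooth_on_cst R n _ U (delta_mx 0 (bidx A) : 'rV[R]_n).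
have dj m (f : 'rV[R]_n -> R) : smooth_on U f -> differentiable (jet m f) w.
  by move=> sf; have sj := smooth_on_jet oU m sf; exact: (smooth_on_differentiable sj Uw).
transitivity (pd A (fun v => jet (bdeg B + bdeg C) (fun x => g a x (bidx B) (bidx C)) v +
    jet 2 (fun x => if (bdeg B + bdeg C == 0)%N then c a x (bidx B) (bidx C) else 0) v) w).
  apply: near_eq_derive; apply: filterS (open_nbhs_nbhs (conj oc Uw)) => v Uv.
  exact: deformed_metric_jet.
rewrite /pd derive_addf; [|exact: dj|exact: dj].
rewrite -(graded_lift_delta A w) !(derive_graded_lift oU)//.
have <- : (bdeg B + bdeg C + bdeg A = bdeg A + bdeg B + bdeg C)%N by rewrite addnC addnA.
congr (_ + _).
rewrite add2n; case: (bdeg A) => [|d]; last by rewrite addnS.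
by rewrite addn0; case: eqP => _ //; rewrite -[LHS]/('D__ _ (xpart w)) derive_cst.
Qed.

End DeformedMetric.

Theorem proposition3 (R : realType) (n : nat) (M : atlas R n)
  (HM : is_manifold M)
  (g : field02 M) (Hg : is_pseudo_riemannian g)
  (nabla : vfield M -> vfield M -> vfield M) (Hnabla : is_levi_civita g nabla)
  (c : field02 M) (Hc : is_tensor02 c) (Hcsym : symmetric02 c)
  (H : field12 M) (HH : is_tensor12 H)
  (nabla2 : vfield (T2 M) -> vfield (T2 M) -> vfield (T2 M))
  (Hnabla2 : is_second_lift nabla nabla2)
  (H0 : field12 (T2 M)) (HH0 : is_zeroth_lift12 H H0)
  (HgH : forall X Y Z : vfield M,
    is_vector_field X -> is_vector_field Y -> is_vector_field Z ->
    forall (a : chart M) (x : 'rV[R]_n), chart_image a x ->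
      app02 g (app12 H X Y) Z a x =
      2^-1 * (cov02 nabla c X Y Z a x + cov02 nabla c Y X Z a x
              - cov02 nabla c Z X Y a x)) :
  is_levi_civita (deformed_metric g c)
    (fun X Y : vfield (T2 M) => vf_add (nabla2 X Y) (app12 H0 X Y)).
Proof.
have HA := manifold_smooth_atlas HM; have HT := T2_smooth_atlas HA.
have [[sg tg] gsym gunit] := Hg; have [conn tfree metr] := Hnabla.
have [sc tc] := Hc; have [tH0 _ _] := HH0.
pose nb := fun X Y : vfield (T2 M) => vf_add (nabla2 X Y) (app12 H0 X Y).
have Hnb : is_connection nb.
  exact: (connection_add_tensor HT (second_lift_connection Hnabla2) tH0).
(* Christoffel symbols at a point, with the two properties that torsion and metric need. *)
rewrite -/nb; have loc (a : chart M) w : chart_image (A := T2 M) a w ->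
  exists Gamma : 'I_(n + n + n) -> 'I_(n + n + n) -> 'rV[R]_(n + n + n), [/\
    forall X Y, is_vector_field X -> is_vector_field Y ->
      nb X Y a w = 'D_(X a w) (Y a) w + \sum_A \sum_B (X a w 0 A * Y a w 0 B) *: Gamma A B,
    forall A B, Gamma A B = Gamma B A &
    forall A B C, pd A (fun v => deformed_metric g c a v B C) w =
      (Gamma A B *m deformed_metric g c a w) 0 C + (Gamma A C *m deformed_metric g c a w) 0 B].
  move=> [j aj <-]; change (T2_pt M) in j; change (T2_dom a j) in aj.
  change (@Defs.coord R _ (T2 M) a j) with (T2_coord a j).
  have [V [E [[oV Vw Va vE EV] nbE]]] := local_frame HM aj.
  set w' := T2_coord a j in Vw nbE *.
  pose K i k := nabla (E i) (E k) a; pose L i k := app12 H (E i) (E k) a.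
  have vK i k : is_vector_field (nabla (E i) (E k)) by exact: connection_field.
  have vL i k : is_vector_field (app12 H (E i) (E k)) by exact: app12_field.
  have sK i k : smooth_on V (K i k) by exact: (smooth_on_sub Va ((vK i k).1 a)).
  have sL i k : smooth_on V (L i k) by exact: (smooth_on_sub Va ((vL i k).1 a)).
  have sgV : smooth_on V (g a) by exact: (smooth_on_sub Va (sg a)).
  have scV : smooth_on V (c a) by exact: (smooth_on_sub Va (sc a)).
  have aw : chart_image (A := T2 M) a w' by exists j.
  pose Gamma A B := nb (glift (bdeg A) (E (bidx A))) (glift (bdeg B) (E (bidx B))) a w'.
  have GammaE A B : Gamma A B = graded_lift (bdeg A + bdeg B) (K (bidx A) (bidx B)) w' +
      (if (bdeg A + bdeg B == 0)%N then graded_lift 2 (L (bidx A) (bidx B)) w' else 0).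
    rewrite /Gamma /nb /vf_add.
    rewrite (second_lift_glift Hnabla2 (vE _) (vE _) (bdeg_lt3 A) (bdeg_lt3 B) aw).
    rewrite (zeroth_lift_glift HH0 (vE _) (vE _) (bdeg_lt3 A) (bdeg_lt3 B) aw).
    by case: ifP.
  exists Gamma; split.
  - by move=> X Y vX vY; exact: nbE.
  - move=> A B; rewrite !GammaE (addnC (bdeg B)); congr (_ + _).
      apply: (graded_lift_ext oV _ _ Vw) => x Vx.
      exact: (frame_torsion oV Va vE EV tfree).
    case: ifP => // _; apply: (graded_lift_ext oV _ _ Vw) => x Vx.
    apply: (frame_tensor_sym oV Va vE EV Hcsym HgH _ _ _ Vx) => y Vy.
    exact: gunit (Va _ Vy).
  - move=> A B C.
    (* A Christoffel symbol is a lift, plus the 0-th lift of [H] in codegree 0. *)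
    have half A' B' C' : (Gamma A' B' *m deformed_metric g c a w') 0 C' =
        jet (bdeg A' + bdeg B' + bdeg C')
          (fun x => (K (bidx A') (bidx B') x *m g a x) 0 (bidx C')) w' +
        (if (bdeg A' + bdeg B' + bdeg C' == 0)%N then
          (K (bidx A') (bidx B') (xpart w') *m c a (xpart w')) 0 (bidx C') +
          (L (bidx A') (bidx B') (xpart w') *m g a (xpart w')) 0 (bidx C') else 0).
      rewrite GammaE mulmxDl mxE (graded_lift_metric c oV sgV)// (addnC (bdeg C')) -addrA.
      congr (_ + _).
      have -> : ((if (bdeg A' + bdeg B' == 0)%N then graded_lift 2 (L (bidx A') (bidx B')) w' else 0)
          *m deformed_metric g c a w') 0 C' =
          if (bdeg A' + bdeg B' + bdeg C' == 0)%N then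
          (L (bidx A') (bidx B') (xpart w') *m g a (xpart w')) 0 (bidx C') else 0.
        case: (bdeg A' + bdeg B')%N => [|d]; last by rewrite mul0mx mxE.
        rewrite eqxx (graded_lift_metric c oV sgV)// addn2 addr0 add0n.
        by case: (bdeg C').
      by case: ifP => _; rewrite ?addr0.
    have sKg i l k : smooth_on V (fun x => (K i l x *m g a x) 0 k).
      have [hK _] := smooth_on_mxP (K i l) oV; have [hg _] := smooth_on_mxP (g a) oV.
      under eq_fun do rewrite mxE.
      by apply: smooth_on_sum => // l' _; apply: smooth_on_mul; [exact: oV|exact: hK|exact: hg].
    rewrite (pd_deformed_metric oV sgV scV A B C Vw) !half (addnAC (bdeg A) (bdeg C)).
    rewrite addrACA -(jetD oV)//; congr (_ + _).
      apply: (jet_ext _ oV _ Vw) => x Vx; exact: (frame_metric oV Va vE EV gsym metr).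
    case: ifP => _; last by rewrite addr0.
    by rewrite addrACA -(frame_deformation oV Va vE EV Hcsym HgH).
split.
- exact: Hnb.
- move=> X Y vX vY a w aw; have [Gamma [nbE Gsym _]] := loc a w aw.
  exact: (torsion_free_Christoffel nbE Gsym).
- move=> X Y Z vX vY vZ a w aw; have [Gamma [nbE _ dG]] := loc a w aw.
  have oa := open_chart_image HA a.
  have aw' : @chart_image R n M a (xpart w) by apply/(T2_chart_image HA).
  apply: (metric_Christoffel HT aw nbE) => //.
  + apply: (smooth_on_sub _ (smooth_deformed_metric oa (sg a) (sc a))).
    by move=> v /(T2_chart_image HA).
  + exact: (deformed_metric_sym oa (sg a) (fun x => gsym a x) (fun x => Hcsym a x) aw').
Qed.
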